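(* Let $f$ be a NET map, with $p_j,q_j,\Lambda_j,\Gamma_j,P_j$ ($j\in\{1,2\}$) and the ordered basis $(\lambda_2,\mu_2)$ of $\Lambda_2$ as in the context. Let $\delta$ be an essential, nonperipheral simple closed curve in $S^2\setminus P_2$ with slope $\frac pq$, where $p$ and $q$ are relatively prime integers. Let $\lambda=q\lambda_2+p\mu_2\in\Lambda_2$. Let $d$ be the order of the image of $\lambda$ in $\Lambda_2/\Lambda_1$. Let $d'$ be the positive integer such that $dd'=|\Lambda_2/\Lambda_1|=\deg(f)$. Let $\mu\in\Lambda_2$ be such that $\lambda$ and $\mu$ form a basis of $\Lambda_2$ (such $\mu$ exists since $p$ and $q$ are relatively prime). Let $c_1\le c_2\le c_3\le c_4$ be the coset numbers for $q_1^{-1}(p_1^{-1}(P_2))$ relative to $\lambda$ and $\mu$. Then: (1) Every connected component of $f^{-1}(\delta)$ maps to $\delta$ with degree $d$. (2) The number of essential, nonperipheral components in $f^{-1}(\delta)$ is $c_3-c_2$. (3) The number of peripheral components in $f^{-1}(\delta)$ is $c_2-c_1+c_4-c_3$. (4) The number of null homotopic components in $f^{-1}(\delta)$ is $c_1-c_4+d'$. (5) The lines in $\mathbb R^2$ with slope $\frac pq$ relative to the basis $(\lambda_2,\mu_2)$ of $\Lambda_2$ which map under $p_1\circ q_1$ to essential, nonperipheral simple closed curves in $S^2\setminus P_2$ are exactly the $\Gamma_1$-translates of the lines with parametric forms $(x,y)=t\lambda+u\mu$ with parameter $t$ and $c_2<u<c_3$. (In (2)–(4), essential, peripheral and null homotopic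 are meant in $S^2\setminus P_2$.)
   Context: A Thurston map is an orientation-preserving branched covering map $f\colon S^2\to S^2$ whose postcritical set $P_f=\{f^{\circ m}(c): m\ge 1,\ c \text{ a critical point of } f\}$ is finite. It is nearly Euclidean (a NET map) if its local degree at each of its critical points is 2 and it has exactly four postcritical points. Setting for a NET map $f$. There are tori $T_1,T_2$, degree 2 branched coverings $p_j\colon T_j\to S^2$ and a continuous map $\widetilde f\colon T_1\to T_2$ with $p_2\circ\widetilde f=f\circ p_1$ such that the set of branch points of $p_2$ is $P_f$. Let $P_j\subset S^2$ be the (four-element) set of branch points of $p_j$; so $P_2=P_f$ and $P_1$ is the set of non-critical points of $f^{-1}(P_2)$. Universal coverings $q_j\colon\mathbb R^2\to T_j$ are chosen so that: the set $\Lambda_j$ of ramification points of $p_j\circ q_j\colon\mathbb R^2\to S^2$ is a lattice in $\mathbb R^2$; the group $\Gamma_j$ of deck transformations of $p_j\circ q_j$ consists of the maps $x\mapsto 2\lambda\pm x$ with $\lambda\in\Lambda_j$; and $\widetilde f$ lifts to the identity map of $\mathbb R^2$, i.e. $q_2=\widetilde f\circ q_1$. Then $\Lambda_1\subseteq\Lambda_2$, $\Gamma_1\subseteq\Gamma_2$, $T_j=\mathbb R^2/2\Lambda_j$, $S^2=\mathbb R^2/\Gamma_j$ via $p_j\circ q_j$, $\deg f=|\Lambda_2/\Lambda_1|$, and $q_1^{-1}(p_1^{-1}(P_2))$ is contained in $\Lambda_2$ and is a union of cosets of $2\Lambda_1$. Fix an ordered basis $(\lambda_2,\mu_2)$ of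 $\Lambda_2$. Slopes. $\widehat{\mathbb Q}=\mathbb Q\cup\{\infty\}$, $\infty=\frac{\pm1}{0}$. A line in $\mathbb R^2$ parallel to $x\lambda_2+y\mu_2$ has slope $y/x$ relative to $(\lambda_2,\mu_2)$. A simple closed curve in $S^2\setminus P_2$ is essential if it is not null homotopic, and peripheral if it is homotopic to a very small closed curve around an element of $P_2$. An essential, nonperipheral simple closed curve in $S^2\setminus P_2$ has slope $\frac pq$ ($p,q$ relatively prime) if it is homotopic in $S^2\setminus P_2$ to the image under $p_2\circ q_2$ of a line in $\mathbb R^2\setminus\Lambda_2$ parallel to $q\lambda_2+p\mu_2$; this gives a bijection between homotopy classes of such curves and $\widehat{\mathbb Q}$. Coset numbers. Let $A$ be a finite Abelian group and $H\subseteq A$ a disjoint union of four inverse pairs $\{\pm h_1\},\dots,\{\pm h_4\}$ (possibly $h_i=-h_i$). Let $B$ be a subgroup with $A/B$ cyclic of order $n$ and let $a\in A$ have image generating $A/B$. For every $k$ there is exactly one integer $c$ with $0\le c\le n/2$ such that $ca+B$ contains $h_k$ or $-h_k$. The four integers so obtained, ordered as $c_1\le c_2\le c_3\le c_4$, are the coset numbers for $H$ relative to $B$ and $a$. The coset numbers for $q_1^{-1}(p_1^{-1}(P_2))$ relative to a basis $\lambda,\mu$ of $\Lambda_2$ are those with $A=\Lambda_2/2\Lambda_1$, $H=p_1^{-1}(P_2)$, $B$ the cyclic subgroup generated by the image of $\lambda$ and $a$ the image of $\mu$. *)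

(* Defs.v *)
From HB Require Import structures.
From mathcomp Require Import all_boot all_order all_algebra.
From mathcomp Require Import all_classical all_reals all_analysis.
From mathcomp Require Import complex.

Set Implicit Arguments.
Unset Strict Implicit.
Unset Printing Implicit Defensive.

Import Order.TTheory GRing.Theory Num.Theory.
Import numFieldNormedType.Exports.
Local Open Scope classical_set_scope.
Local Open Scope card_scope.
Local Open Scope ring_scope.

Notation plane R := 'rV[R]_2.

Definition sphere (R : realType) (n : nat) : set 'rV[R]_n.+1 :=
  [set v | \sum_(i < n.+1) v ord0 i ^+ 2 = 1].
Arguments sphere : clear implicits.

(* Through [set_type] these carry the subtype topology. *)
Notation S1 R := (set_type (sphere R 1)).
Notation S2 R := (set_type (sphere R 2)).

Definition homeomorphism (X Y : topologicalType) (g : X -> Y) : Prop :=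
  continuous g /\
  exists h : Y -> X, [/\ continuous h, cancel g h & cancel h g].

Definition is_torus (R : realType) (T : topologicalType) : Prop :=
  exists g : T -> (S1 R * S1 R)%type, homeomorphism g.

Definition evenly_covered (X Y : topologicalType) (q : X -> Y) (V : set Y) :=
  exists F : set (set X),
  [/\ \bigcup_(U in F) U = q @^-1` V,
      trivIset F id
    & forall U, F U ->
      [/\ open U, {in U &, injective q}, q @` U = V
        & forall W, W `<=` U -> open W -> open (q @` W)]].

Definition covering_map (X Y : topologicalType) (q : X -> Y) : Prop :=
  [/\ continuous q, range q = setT
    & forall y, exists V, [/\ open V, V y & evenly_covered q V]].

(* The plane stands for the open unit disk: the two are homeomorphic by a
   radial map fixing the origin. *)
Definition is_chart (R : realType) (X : topologicalType)
    (phi : plane R -> X) (x : X) : Prop :=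
  [/\ continuous phi, injective phi,
      forall U, open U -> open (phi @` U) & phi 0 = x].

Definition complex_power (R : realType) (k : nat) (z : plane R) : plane R :=
  let w := complex.Complex (z ord0 ord0) (z ord0 ord_max) ^+ k in
  \row_(i < 2) [:: complex.Re w; complex.Im w]`_i.

Definition local_form (R : realType) (X Y : topologicalType) (f : X -> Y)
    (x : X) (k : nat) (phi : plane R -> X) (psi : plane R -> Y) : Prop :=
  [/\ (0 < k)%N, is_chart phi x, is_chart psi (f x)
    & forall z, f (phi z) = psi (complex_power k z)].

Definition local_degree (R : realType) (X Y : topologicalType) (f : X -> Y)
    (x : X) (k : nat) : Prop :=
  exists (phi : plane R -> X) (psi : plane R -> Y), local_form f x k phi psi.

(* Only used for maps between compact surfaces, where this local condition
   gives a branched covering in the usual sense. *)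
Definition branched_covering (R : realType) (X Y : topologicalType)
    (f : X -> Y) : Prop :=
  continuous f /\ forall x, exists k, local_degree R f x k.

Definition critical_points (R : realType) (X Y : topologicalType)
    (f : X -> Y) : set X :=
  [set x | exists2 k, (1 < k)%N & local_degree R f x k].

Definition branch_points (R : realType) (X Y : topologicalType)
    (f : X -> Y) : set Y :=
  f @` critical_points R f.

Definition map_degree (R : realType) (X Y : topologicalType) (f : X -> Y)
    (n : nat) : Prop :=
  forall y, ~ branch_points R f y -> f @^-1` [set y] #= `I_n.

Definition deck_group (X Y : topologicalType) (f : X -> Y) : set (X -> X) :=
  [set g | homeomorphism g /\ forall x, f (g x) = f x].

(* S2 is oriented by its outward normal.  In a positively oriented orthonormal
   basis (the rows of A) whose last vector is phi 0, theta is a longitude along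
   the image of the circle of radius r: it has to increase by one full turn. *)
Definition positive_chart (R : realType) (phi : plane R -> S2 R) : Prop :=
  \forall r \near (0 : R)^'+,
  exists (A : 'M[R]_3) (rho h theta : R -> R),
  [/\ A *m A^T = 1%:M, \det A = 1 & row ord_max A = \val (phi 0)] /\
  [/\ continuous theta, theta (2 * pi) = theta 0 + 2 * pi
    & forall t, 0 < rho t /\
      \val (phi (r *: \row_(i < 2) [:: cos t; sin t]`_i)) =
      (\row_(i < 3)
         [:: rho t * cos (theta t); rho t * sin (theta t); h t]`_i) *m A].

Definition orientation_preserving (R : realType) (f : S2 R -> S2 R) : Prop :=
  forall x, exists k (phi psi : plane R -> S2 R),
  [/\ local_form f x k phi psi, positive_chart phi & positive_chart psi].

Definition postcritical_set (R : realType) (f : S2 R -> S2 R) : set (S2 R) :=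
  [set y | exists m c,
    [/\ (0 < m)%N, critical_points R f c & iter m f c = y]].

Definition Thurston_map (R : realType) (f : S2 R -> S2 R) : Prop :=
  [/\ branched_covering R f, orientation_preserving f
    & finite_set (postcritical_set f)].

Definition NET_map (R : realType) (f : S2 R -> S2 R) : Prop :=
  [/\ Thurston_map f,
      forall c, critical_points R f c -> local_degree R f c 2
    & postcritical_set f #= `I_4].

Definition lattice_basis (R : realType) (L : set (plane R))
    (u v : plane R) : Prop :=
  (forall s t : R, s *: u + t *: v = 0 -> s = 0 /\ t = 0) /\
  L = [set x | exists m n : int, x = u *~ m + v *~ n].

Definition is_lattice (R : realType) (L : set (plane R)) : Prop :=
  exists u v, lattice_basis L u v.

Definition twice (V : zmodType) (L : set V) : set V :=
  [set x *+ 2 | x in L].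

Definition cosets (V : zmodType) (A B : set V) : set (set V) :=
  [set C | exists2 x, A x & C = [set y | B (y - x)]].

Definition order_mod (V : zmodType) (B : set V) (x : V) (d : nat) : Prop :=
  [/\ (0 < d)%N, B (x *+ d) & forall k, (0 < k < d)%N -> ~ B (x *+ k)].

Definition has_card (T : Type) (A : set T) (z : int) : Prop :=
  exists2 n : nat, z = n%:Z & A #= `I_n.

(* A quotient group A/M is handled through preimages in V: subsets of A/M are
   M-saturated subsets of A, and subgroups of A/M are subgroups of A containing
   M.  [inverse_pair M h] is the preimage of {h + M, -h + M}. *)
Definition inverse_pair (V : zmodType) (M : set V) (h : V) : set V :=
  [set x | M (x - h) \/ M (x + h)].

(* The coset numbers for H/M, a subset of A/M, relative to B/M and a + M. *)
Definition coset_numbers (V : zmodType) (A M H B : set V) (a : V)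
    (c : 4.-tuple nat) : Prop :=
  exists (n : nat) (h : 'I_4 -> V),
  [/\ A = [set x | exists k : int, B (x - a *~ k)],
      cosets A B #= `I_n,
      H = \bigcup_i inverse_pair M (h i),
      trivIset setT (fun i => inverse_pair M (h i))
    & sorted leq c /\
      forall i, (2 * tnth c i <= n)%N /\
        exists2 x, inverse_pair M (h i) x & B (x - a *+ tnth c i)].

Definition cyclic_mod (V : zmodType) (M : set V) (x : V) : set V :=
  [set y | exists k : int, M (y - x *~ k)].

Record NET_data (R : realType) (f : S2 R -> S2 R) (T1 T2 : topologicalType)
    (p1 : T1 -> S2 R) (p2 : T2 -> S2 R) (ft : T1 -> T2)
    (q1 : plane R -> T1) (q2 : plane R -> T2)
    (L1 L2 : set (plane R)) : Prop := {
  torus1 : is_torus R T1;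
  torus2 : is_torus R T2;
  p1_branched : branched_covering R p1 /\ map_degree R p1 2;
  p2_branched : branched_covering R p2 /\ map_degree R p2 2;
  ft_continuous : continuous ft;
  ft_lifts_f : forall x, p2 (ft x) = f (p1 x);
  branch_p2 : branch_points R p2 = postcritical_set f;
  (* the plane being simply connected, these coverings are universal *)
  q1_covering : covering_map q1;
  q2_covering : covering_map q2;
  L1_lattice : is_lattice L1;
  L2_lattice : is_lattice L2;
  L1_ramification : critical_points R (p1 \o q1) = L1;
  L2_ramification : critical_points R (p2 \o q2) = L2;
  deck1 : deck_group (p1 \o q1) =
    [set g | exists2 l, L1 l & g = (fun x => l *+ 2 + x) \/
                               g = (fun x => l *+ 2 - x)];
  deck2 : deck_group (p2 \o q2) =
    [set g | exists2 l, L2 l & g = (fun x => l *+ 2 + x) \/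
                               g = (fun x => l *+ 2 - x)];
  id_lifts_ft : forall x, q2 x = ft (q1 x);
  (* T_j is the quotient of the plane by 2 L_j, and S2 its quotient by the
     deck group *)
  fiber_q1 : forall x y, q1 x = q1 y <-> twice L1 (y - x);
  fiber_q2 : forall x y, q2 x = q2 y <-> twice L2 (y - x);
  fiber_p1q1 : forall x y, p1 (q1 x) = p1 (q1 y) <->
    exists2 g, deck_group (p1 \o q1) g & y = g x;
  fiber_p2q2 : forall x y, p2 (q2 x) = p2 (q2 y) <->
    exists2 g, deck_group (p2 \o q2) g & y = g x
}.

Section Curves.
Variables (R : realType) (X : topologicalType) (P : set X).

Definition parametrizes (gamma : S1 R -> X) (C : set X) : Prop :=
  [/\ continuous gamma, injective gamma & range gamma = C].

Definition simple_closed_curve (C : set X) : Prop :=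
  (exists gamma, parametrizes gamma C) /\ C `&` P = set0.

Definition freely_homotopic (gamma0 gamma1 : S1 R -> X) : Prop :=
  exists H : R * S1 R -> X,
  [/\ {within `[0, 1] `*` setT, continuous H},
      forall t z, 0 <= t <= 1 -> ~ P (H (t, z)),
      forall z, H (0, z) = gamma0 z
    & forall z, H (1, z) = gamma1 z].

Definition homotopic_curves (C0 C1 : set X) : Prop :=
  exists gamma0 gamma1, [/\ parametrizes gamma0 C0, parametrizes gamma1 C1
    & freely_homotopic gamma0 gamma1].

Definition null_homotopic (C : set X) : Prop :=
  exists gamma x, parametrizes gamma C /\ freely_homotopic gamma (fun=> x).

(* Images of the unit circle under charts at x that take all their values in a
   given neighborhood of x are the very small closed curves around x. *)
Definition peripheral (C : set X) : Prop :=
  exists2 x, P x & forall U, nbhs x U ->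
  exists gamma (phi : plane R -> X),
  [/\ parametrizes gamma C, is_chart phi x, range phi `<=` U
    & freely_homotopic gamma (fun z => phi (\val z))].

Definition essential_nonperipheral (C : set X) : Prop :=
  [/\ simple_closed_curve C, ~ null_homotopic C & ~ peripheral C].

End Curves.

Definition line (R : realType) (x v : plane R) : set (plane R) :=
  range (fun t : R => x + t *: v).

(* C has slope p / q relative to (l2, m2), where pr is the map from the plane
   onto S2, L its lattice of ramification points and P its branch points. *)
Definition has_slope (R : realType) (pr : plane R -> S2 R) (L : set (plane R))
    (P : set (S2 R)) (l2 m2 : plane R) (p q : int) (C : set (S2 R)) : Prop :=
  exists2 x, line x (l2 *~ q + m2 *~ p) `&` L = set0 &
    homotopic_curves R P C (pr @` line x (l2 *~ q + m2 *~ p)).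

Definition components (X : topologicalType) (A : set X) : set (set X) :=
  [set K | exists2 x, A x & K = connected_component A x].

(* Up to parametrizations of the simple closed curves K and C, f restricts to a
   d-sheeted covering of the circle by itself. *)
Definition maps_with_degree (R : realType) (X Y : topologicalType)
    (f : X -> Y) (K : set X) (C : set Y) (d : nat) : Prop :=
  exists (alpha : S1 R -> X) (gamma : S1 R -> Y) (g : S1 R -> S1 R),
  [/\ parametrizes alpha K, parametrizes gamma C,
      forall z, f (alpha z) = gamma (g z), covering_map g
    & forall w, g @^-1` [set w] #= `I_d].

(* Main.v *)
Require Import Defs.
From mathcomp Require Import all_boot all_order all_algebra.
From mathcomp Require Import all_classical all_reals all_analysis.
From mathcomp Require Import zify ring lra.
Import Order.TTheory GRing.Theory Num.Theory.
Import numFieldNormedType.Exports.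
Set Implicit Arguments.
Unset Strict Implicit.
Unset Printing Implicit Defensive.
Local Open Scope classical_set_scope.
Local Open Scope card_scope.
Local Open Scope ring_scope.

(** In the coordinates given by l and m the lattice L2 becomes the integral
    lattice, and the map p2 o q2 becomes a map F2 that identifies the sphere with
    the quotient of the plane by the even integer translations and the half-turn
    about the origin: a pillowcase (a pillow map, below). The map p1 o q1 becomes
    a map G with f o G = F2. As l has order d modulo L1, and L1 has index d d' in
    L2, the lattice L1 has a basis (d, 0), (j, d') (subgroup_normal_form), so that
    a shear and a rescaling turn G into a pillow map as well (F1_pillow).
    Horizontal lines at heights strictly between 0 and d' are mapped by G to
    simple closed curves, and those at the heights 0 and d' are folded onto arcs.
    A coset number is the height, between 0 and d', of a point of P2 in this
    picture (coset_points).

    By hypothesis delta is homotopic off P2 to the image under F2 of a horizontal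
    line, which can be taken at a height y0 with 0 < y0 < 1. This homotopy lifts
    to the plane, because F2 only branches at the integral points, which lie over
    P2 (straighten): a lift of delta is an arc that advances by (2, 0) in one turn,
    deformed into a horizontal line through arcs of the same kind that avoid the
    integral points. The preimage of delta under f is the image under G of the
    translates and half-turns of this arc. Up to the group of G there are d' of
    them, one for each i < d', and the i-th one is deformed into a horizontal line
    at a height between i and i + 1. Under G the i-th arc closes up after d turns,
    which gives the degree (comp_degree), and the deformation takes place off P2
    because f maps P2 into itself (comp_homotopic).

    It remains to find the type of a horizontal curve of the pillowcase from the
    heights of the four punctures (horizontal_type). If all punctures lie on one
    side, the curve slides to the fold on the other side and contracts
    (horizontal_null). If exactly one puncture lies on one side, the curve is
    peripheral: confocal ellipses identify that side of the pillowcase with a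
    disk, in which the curve is an ellipse around the puncture
    (horizontal_peripheral). If two punctures lie on either side, the curve
    separates two punctures x and y, even when a third one is prescribed, and
    cannot be contracted off x and y; this comes from the winding number of the
    circle (E_not_null), by way of a theorem on retractions of the sphere
    (disk_boundary_essential). As the punctures are at the heights c1, c2, c3 and
    c4, the essential nonperipheral components are those with c2 <= i < c3, the
    peripheral ones those with c1 <= i < c2 or c3 <= i < c4, and the others are
    null homotopic. The same classification, applied to the horizontal lines
    themselves, gives the lines whose images are essential and nonperipheral
    (level_curve_essential, level_curve_essentialP). *)

(** * Open maps and quotients *)

Definition open_map (X Y : topologicalType) (p : X -> Y) : Prop :=
  forall U, open U -> open (p @` U).

(** The complement of p @` U is the image of the part of K outside the saturation
    of U, which is compact. *)
Lemma saturated_open_map (X Y : topologicalType) (p : X -> Y) (K : set X) :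
  hausdorff_space Y -> continuous p -> compact K -> p @` K = setT ->
  (forall U, open U -> open (p @^-1` (p @` U))) -> open_map p.
Proof.
move=> hY cp cK pK sat U oU.
have -> : p @` U = ~` (p @` (K `&` ~` (p @^-1` (p @` U)))).
  apply/seteqP; split=> [_ [x Ux <-] [y [Ky /= nUy]]|y nUy].
    by move=> yx; apply: nUy; exists x.
  have : (p @` K) y by rewrite pK.
  case=> x Kx xy; apply: contrapT => nU; apply: nUy; exists x => //; split=> //=.
  by rewrite xy.
apply: closed_openC; apply: compact_closed => //.
apply: continuous_compact; first exact: continuous_subspaceT.
apply: compact_closedI => //; exact/open_closedC/sat.
Qed.

(** An open surjection is a quotient map. *)
Lemma open_map_factor (X Y Z : topologicalType) (p : X -> Y) (g : Y -> Z) :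
  open_map p -> (forall y, exists x, p x = y) ->
  continuous (g \o p) -> continuous g.
Proof.
move=> op sp /continuousP cgp; apply/continuousP => W /cgp/op.
congr open; apply/seteqP; split=> [_ [x Wx <-]//|y Wy].
by have [x xy] := sp y; exists x => //=; rewrite xy.
Qed.

Lemma open_map_prod (X Y Z W : topologicalType) (p : X -> Y) (q : Z -> W) :
  open_map p -> open_map q -> open_map (fun x : X * Z => (p x.1, q x.2)).
Proof.
move=> op oq U; rewrite !openE => oU _ [[x z] Uxz <-].
have [/= [A B] [/= + +] ABU] := oU _ Uxz.
rewrite !nbhsE => -[A' [oA' A'x] A'A] [B' [oB' B'z] B'B].
exists (p @` A', q @` B').
  by split; apply: open_nbhs_nbhs; split;
     [exact: op|exists x|exact: oq|exists z].
move=> /= -[y w] [/= [x' A'x' <-] [z' B'z' <-]]; exists (x', z') => //.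
by apply: ABU; split; [exact: A'A|exact: B'B].
Qed.

Lemma open_map_id (X : topologicalType) : open_map (@id X).
Proof. by move=> U; rewrite image_id. Qed.

(** On a compact set, a continuous map to a Hausdorff space is a quotient map
    onto its image, being closed. *)
Lemma compact_quotient (X Y Z : topologicalType) (p : X -> Y) (K : set X)
    (g : Y -> Z) :
  hausdorff_space Y -> compact K -> {within K, continuous p} ->
  {within K, continuous (g \o p)} -> {within p @` K, continuous g}.
Proof.
move=> hY cK cp /continuous_closedP cgp; apply/continuous_closedP => C cC.
have cpK : closed (p @` K).
  by apply: compact_closed => //; exact: continuous_compact.
rewrite -closed_setSI //.
have -> : p @` K `&` g @^-1` C = p @` (K `&` (g \o p) @^-1` C).
  apply/seteqP; split=> [_ [[x Kx <-] Cx]|_ [x [Kx Cx] <-]]; first by exists x.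
  by split=> //; exists x.
have [D cD DE] := (closed_subspaceP _ _).1 (cgp _ cC).
apply: compact_closed => //.
apply: continuous_compact.
  by apply: continuous_subspaceW cp; exact: subIsetl.
by rewrite setIC -DE setIC; apply: compact_closedI.
Qed.

(** * Continuity of explicit maps *)

Section Continuity.
Variables (R : realType) (X : topologicalType).
Implicit Types (Y Z : topologicalType) (f g : X -> R).

Lemma ct_cst Y (y : Y) : continuous (fun _ : X => y).
Proof. exact: cst_continuous. Qed.

Lemma ct_id : continuous (fun x : X => x).
Proof. by move=> x; exact: cvg_id. Qed.

Lemma ct_comp Y Z (f : X -> Y) (g : Y -> Z) :
  continuous g -> continuous f -> continuous (fun x => g (f x)).
Proof. by move=> cg cf x; apply: continuous_comp; [exact: cf|exact: cg]. Qed.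

Lemma ct_pair Y Z (f : X -> Y) (g : X -> Z) :
  continuous f -> continuous g -> continuous (fun x => (f x, g x)).
Proof. by move=> cf cg x; apply: cvg_pair; [exact: cf|exact: cg]. Qed.

Lemma ct_fst Y Z (f : X -> Y * Z) : continuous f -> continuous (fun x => (f x).1).
Proof. by move=> cf; apply: ct_comp cf => x; exact: cvg_fst. Qed.

Lemma ct_snd Y Z (f : X -> Y * Z) : continuous f -> continuous (fun x => (f x).2).
Proof. by move=> cf; apply: ct_comp cf => x; exact: cvg_snd. Qed.

Lemma ct_add f g : continuous f -> continuous g -> continuous (fun x => f x + g x).
Proof. by move=> cf cg x; apply: cvgD; [exact: cf|exact: cg]. Qed.

Lemma ct_opp f : continuous f -> continuous (fun x => - f x).
Proof. by move=> cf x; apply: cvgN; exact: cf. Qed.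

Lemma ct_mul f g : continuous f -> continuous g -> continuous (fun x => f x * g x).
Proof. by move=> cf cg x; apply: cvgM; [exact: cf|exact: cg]. Qed.

Lemma ct_exp f n : continuous f -> continuous (fun x => f x ^+ n).
Proof.
move=> cf; elim: n => [|n IH]; first by move=> x; exact: cvg_cst.
by under eq_fun do rewrite exprS; exact: ct_mul.
Qed.

Lemma ct_inv f : (forall x, f x != 0) -> continuous f ->
  continuous (fun x => (f x)^-1).
Proof. by move=> f0 cf x; apply: cvgV; [exact: f0|exact: cf]. Qed.

Lemma ct_norm f : continuous f -> continuous (fun x => `|f x|).
Proof. by move=> cf x; apply: cvg_norm; exact: cf. Qed.

Lemma ct_sqrt f : continuous f -> continuous (fun x => Num.sqrt (f x)).
Proof. by apply: ct_comp; exact: sqrt_continuous. Qed.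

Lemma ct_max f g : continuous f -> continuous g ->
  continuous (fun x => Num.max (f x) (g x)).
Proof.
move=> cf cg.
have -> : (fun x => Num.max (f x) (g x)) =
          (fun x => (f x + g x + `|f x - g x|) / 2).
  by apply/funext => x; rewrite maxr_absE.
apply: ct_mul; last exact: ct_cst.
apply: ct_add; first exact: ct_add.
by apply: ct_norm; apply: ct_add => //; exact: ct_opp.
Qed.

Lemma ct_min f g : continuous f -> continuous g ->
  continuous (fun x => Num.min (f x) (g x)).
Proof.
move=> cf cg.
have -> : (fun x => Num.min (f x) (g x)) =
          (fun x => (f x + g x - `|f x - g x|) / 2).
  by apply/funext => x; rewrite minr_absE.
apply: ct_mul; last exact: ct_cst.
apply: ct_add; first exact: ct_add.
by apply: ct_opp; apply: ct_norm; apply: ct_add => //; exact: ct_opp.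
Qed.

Lemma ct_cos f : continuous f -> continuous (fun x => cos (f x)).
Proof. by apply: ct_comp; exact: continuous_cos. Qed.

Lemma ct_sin f : continuous f -> continuous (fun x => sin (f x)).
Proof. by apply: ct_comp; exact: continuous_sin. Qed.

Lemma ct_coord n (f : X -> 'rV[R]_n) i j :
  continuous f -> continuous (fun x => f x i j).
Proof.
move=> cf; apply: (@ct_comp _ _ f (fun M : 'rV[R]_n => M i j)) => //.
exact: coord_continuous.
Qed.

Lemma ct_row n (f : X -> 'rV[R]_n) :
  (forall i, continuous (fun x => f x ord0 i)) -> continuous f.
Proof.
move=> cf x A [P Px PA].
have : nbhs x [set y | forall i, P ord0 i (f y ord0 i)].
  by apply: filter_forall => i; apply: cf; exact: Px.
by apply: filterS => y Py; apply: PA => i j; rewrite (ord1 i); exact: Py.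
Qed.

Lemma ct_val Y (A : set Y) (f : X -> A) :
  continuous f -> continuous (fun x => \val (f x)).
Proof. by apply: ct_comp; exact: initial_continuous. Qed.

Lemma ct_set_type Y (A : set Y) (f : X -> A) :
  continuous (fun x => \val (f x)) -> continuous f.
Proof. exact: (@continuous_comp_initial A X Y set_val f). Qed.

End Continuity.

Ltac ct_hook f := fail.
Ltac ct_hyp f := first [ assumption
  | match goal with H : forall x, continuous_at x ?g |- _ =>
      lazymatch f with fun y => g (@?a y) => apply: (@ct_comp _ _ _ a g H) end end ].

(* Eta-expands the function, to expose its head symbol. *)
Ltac ct_eta := lazymatch goal with |- forall x : ?T, @continuous_at ?X ?Y x ?f =>
  lazymatch f with
  | fun _ => _ => idtac
  | _ => tryif is_var f then idtac
         else change (forall x : T, @continuous_at X Y x (fun y => f y))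
  end end.

(* Continuity by recursion on the expression of the function. *)
Ltac ct_step := first [match goal with H : ?G |- ?G => exact: H end
  | ct_eta; lazymatch goal with |- forall x, continuous_at x ?f =>
  lazymatch f with
  | fun _ => ?c => exact: ct_cst
  | fun y => y => exact: ct_id
  | fun y => (@?a y, @?b y) => apply: (@ct_pair _ _ _ a b)
  | fun y => (@?a y + @?b y)%R => apply: (@ct_add _ _ a b)
  | fun y => (- (@?a y))%R => apply: (@ct_opp _ _ a)
  | fun y => (@?a y * @?b y)%R => apply: (@ct_mul _ _ a b)
  | fun y => (@?a y ^+ ?n)%R => apply: (@ct_exp _ _ a n)
  | fun y => ((@?a y)^-1)%R => apply: (@ct_inv _ _ a)
  | fun y => (`|@?a y|)%R => apply: (@ct_norm _ _ a)
  | fun y => Num.sqrt (@?a y) => apply: (@ct_sqrt _ _ a)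
  | fun y => Num.max (@?a y) (@?b y) => apply: (@ct_max _ _ a b)
  | fun y => Num.min (@?a y) (@?b y) => apply: (@ct_min _ _ a b)
  | fun y => cos (@?a y) => apply: (@ct_cos _ _ a)
  | fun y => sin (@?a y) => apply: (@ct_sin _ _ a)
  | fun y => (@?a y).1 => apply: (@ct_fst _ _ _ a)
  | fun y => (@?a y).2 => apply: (@ct_snd _ _ _ a)
  | _ => first [ct_hyp f | ct_hook f]
  end end ].
Ltac ct := repeat ct_step.

Lemma set_type_hausdorff (X : topologicalType) (A : set X) :
  hausdorff_space X -> hausdorff_space A.
Proof.
move=> hX p q pq; apply: val_inj; apply: hX => B C Bp Cq.
have [||z [Bz Cz]] := pq (\val @^-1` B) (\val @^-1` C).
- by move: Bp; exact: (@initial_continuous A X set_val).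
- by move: Cq; exact: (@initial_continuous A X set_val).
by exists (\val z).
Qed.

(** * The circle *)

Section Circle.
Variable R : realType.
Implicit Types (v : R * R) (z w : S1 R) (s t : R).

Definition vec (a b : R) : plane R := \row_(i < 2) [:: a; b]`_i.

Lemma vec0 a b : vec a b ord0 ord0 = a. Proof. by rewrite mxE. Qed.
Lemma vec1 a b : vec a b ord0 ord_max = b. Proof. by rewrite mxE. Qed.

Lemma plane_eq (u v : plane R) : u ord0 ord0 = v ord0 ord0 ->
  u ord0 ord_max = v ord0 ord_max -> u = v.
Proof.
move=> e0 e1; apply/rowP => i.
by case: (unliftP ord_max i) => [j ->|-> //]; rewrite (ord1 j);
   move: e0; congr (u _ _ = v _ _); exact/val_inj.
Qed.

Lemma ct_vec (X : topologicalType) (f g : X -> R) :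
  continuous f -> continuous g -> continuous (fun x => vec (f x) (g x)).
Proof.
move=> cf cg; apply: ct_row => i.
by case: (unliftP ord_max i) => [j ->|->];
  rewrite ?(ord1 j); under eq_fun do rewrite mxE /=.
Qed.

Definition len v : R := Num.sqrt (v.1 ^+ 2 + v.2 ^+ 2).

Lemma len_eq0 v : (len v == 0) = (v == 0).
Proof.
case: v => a b; rewrite /len sqrtr_eq0 /= le_eqVlt ltNge addr_ge0 ?sqr_ge0 //= orbF.
by rewrite paddr_eq0 ?sqr_ge0 // !sqrf_eq0.
Qed.

Lemma len_ge0 v : 0 <= len v. Proof. exact: sqrtr_ge0. Qed.

Lemma len_sqr v : len v ^+ 2 = v.1 ^+ 2 + v.2 ^+ 2.
Proof. by rewrite sqr_sqrtr // addr_ge0 ?sqr_ge0. Qed.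

Definition unitv v : R * R :=
  if v == 0 then (1, 0) else (v.1 / len v, v.2 / len v).

Lemma unitvP v : (unitv v).1 ^+ 2 + (unitv v).2 ^+ 2 = 1.
Proof.
rewrite /unitv; case: ifPn => [_|v0] /=; first by rewrite expr1n expr0n addr0.
rewrite !expr_div_n -mulrDl -len_sqr divff //.
by rewrite sqrf_eq0 len_eq0.
Qed.

Lemma sphere1P (u : plane R) : sphere R 1 u <->
  u ord0 ord0 ^+ 2 + u ord0 ord_max ^+ 2 = 1.
Proof.
rewrite /sphere /= big_ord_recr big_ord1 /=.
by have -> : widen_ord (leqnSn 1) ord0 = ord0 by exact/val_inj.
Qed.

Fact dir_subproof v : vec (unitv v).1 (unitv v).2 \in sphere R 1.
Proof. by apply/mem_set/sphere1P; rewrite vec0 vec1 unitvP. Qed.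

(** The zero vector is sent to the base point, which makes dir total. *)
Definition dir v : S1 R := exist (fun u => u \in sphere R 1) _ (dir_subproof v).

Definition zx z : R := \val z ord0 ord0.
Definition zy z : R := \val z ord0 ord_max.

Lemma zxyP z : zx z ^+ 2 + zy z ^+ 2 = 1.
Proof. by apply/sphere1P; exact/set_mem/(valP z). Qed.

Lemma zx_bound z : -1 <= zx z <= 1.
Proof.
by rewrite -ler_norml -(ler_pXn2r (ltn0Sn 1)) ?nnegrE // real_normK ?num_real //
  expr1n -(zxyP z) lerDl sqr_ge0.
Qed.

Lemma S1_eq z w : zx z = zx w -> zy z = zy w -> z = w.
Proof. by move=> e0 e1; apply/val_inj/plane_eq. Qed.

Lemma zx_dir v : v.1 ^+ 2 + v.2 ^+ 2 = 1 -> zx (dir v) = v.1.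
Proof.
move=> v1; have v0 : v != 0.
  apply/eqP => v0; move: v1; rewrite v0 expr0n addr0 => /eqP.
  by rewrite eq_sym oner_eq0.
by rewrite /zx /= vec0 /unitv (negbTE v0) /= /len v1 sqrtr1 divr1.
Qed.

Lemma zy_dir v : v.1 ^+ 2 + v.2 ^+ 2 = 1 -> zy (dir v) = v.2.
Proof.
move=> v1; have v0 : v != 0.
  apply/eqP => v0; move: v1; rewrite v0 expr0n addr0 => /eqP.
  by rewrite eq_sym oner_eq0.
by rewrite /zy /= vec1 /unitv (negbTE v0) /= /len v1 sqrtr1 divr1.
Qed.

Lemma zx_dir_gen v : v != 0 -> zx (dir v) = v.1 / len v.
Proof. by move=> v0; rewrite /zx /= vec0 /unitv (negbTE v0). Qed.

Lemma zy_dir_gen v : v != 0 -> zy (dir v) = v.2 / len v.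
Proof. by move=> v0; rewrite /zy /= vec1 /unitv (negbTE v0). Qed.

Lemma dir_zxy z : dir (zx z, zy z) = z.
Proof. by apply: S1_eq; rewrite ?zx_dir ?zy_dir //= zxyP. Qed.

Lemma dir_scale (k : R) v : 0 < k -> dir (k * v.1, k * v.2) = dir v.
Proof.
move=> k0; have [->|v0] := eqVneq v 0; first by rewrite /= !mulr0.
have kv0 : (k * v.1, k * v.2) != 0.
  apply: contra v0 => /eqP[] /eqP; rewrite mulf_eq0 (gt_eqF k0) /= => /eqP e1.
  move=> /eqP; rewrite mulf_eq0 (gt_eqF k0) /= => /eqP e2.
  by case: v e1 e2 => a b /= -> ->.
have lk : len (k * v.1, k * v.2) = k * len v.
  rewrite /len /= !exprMn -mulrDr sqrtrM ?sqr_ge0 // sqrtr_sqr gtr0_norm //.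
apply: S1_eq; rewrite ?zx_dir_gen ?zy_dir_gen //= lk.
- by rewrite -mulf_div divff ?mul1r // gt_eqF.
- by rewrite -mulf_div divff ?mul1r // gt_eqF.
Qed.

Lemma ct_zx (X : topologicalType) (f : X -> S1 R) :
  continuous f -> continuous (fun x => zx (f x)).
Proof. by move=> cf; apply: ct_coord; apply: ct_val. Qed.

Lemma ct_zy (X : topologicalType) (f : X -> S1 R) :
  continuous f -> continuous (fun x => zy (f x)).
Proof. by move=> cf; apply: ct_coord; apply: ct_val. Qed.

Lemma ct_dir (X : topologicalType) (f : X -> R * R) :
  (forall x, f x != 0) -> continuous f -> continuous (fun x => dir (f x)).
Proof.
move=> f0 cf; apply: ct_set_type => /=; apply: ct_vec.
- rewrite (_ : (fun _ => _) = (fun x => (f x).1 / len (f x))).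
    by rewrite /len; ct => x; rewrite -/(len (f x)) len_eq0.
  by apply/funext => x; rewrite /unitv (negbTE (f0 x)).
- rewrite (_ : (fun _ => _) = (fun x => (f x).2 / len (f x))).
    by rewrite /len; ct => x; rewrite -/(len (f x)) len_eq0.
  by apply/funext => x; rewrite /unitv (negbTE (f0 x)).
Qed.

Lemma S1_hausdorff : hausdorff_space (S1 R).
Proof. exact/set_type_hausdorff/norm_hausdorff. Qed.

Lemma S2_hausdorff : hausdorff_space (S2 R).
Proof. exact/set_type_hausdorff/norm_hausdorff. Qed.

(** ** The exponential map *)

Definition E t : S1 R := dir (cos t, sin t).

Lemma zxE t : zx (E t) = cos t.
Proof. by rewrite zx_dir //= cos2Dsin2. Qed.

Lemma zyE t : zy (E t) = sin t.
Proof. by rewrite zy_dir //= cos2Dsin2. Qed.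

Lemma cos_sin_neq0 t : (cos t, sin t) != 0.
Proof.
apply/eqP => -[c s]; have /eqP := cos2Dsin2 t.
by rewrite c s expr0n addr0 eq_sym oner_eq0.
Qed.

Lemma E_continuous : continuous E.
Proof. by apply: ct_dir => [x|]; [exact: cos_sin_neq0|ct]. Qed.

Lemma ct_E (X : topologicalType) (f : X -> R) :
  continuous f -> continuous (fun x => E (f x)).
Proof. by apply: ct_comp; exact: E_continuous. Qed.

Lemma E_per (k : int) t : E (t + (2 * pi) * k%:~R) = E t.
Proof.
have cp n s : (cos (s + (2 * pi) * n%:R) = cos s) /\ (sin (s + (2 * pi) * n%:R) = sin s).
  rewrite mulr_natr (mulr_natl pi 2).
  by rewrite (periodicn (@cosD2pi R)) (periodicn (@sinD2pi R)).
have {}cp n s : E (s + (2 * pi) * n%:R) = E s by have [c s'] := cp n s; rewrite /E c s'.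
case: k => n; first exact: cp.
by rewrite NegzE mulrNz mulrN -(cp n.+1 (t - _)) subrK.
Qed.

Lemma E_per1 t : E (t + 2 * pi) = E t.
Proof. by have := E_per 1 t; rewrite mulr1. Qed.

Lemma pi2_gt0 : 0 < 2 * pi :> R. Proof. by rewrite mulr_gt0 ?pi_gt0. Qed.

Lemma E_surj z : exists2 t, 0 <= t <= 2 * pi & E t = z.
Proof.
have zP := zxyP z.
have zx1 := zx_bound z.
have a0 := acos_ge0 zx1; have api := acos_lepi zx1.
have sa : sin (acos (zx z)) = `|zy z|.
  by rewrite sin_acos // -sqrtr_sqr; congr Num.sqrt; rewrite -zP; ring.
have ca : cos (acos (zx z)) = zx z by rewrite acosK // in_itv.
have [y0|y0] := leP 0 (zy z).
  exists (acos (zx z)); first lra.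
  by apply: S1_eq; rewrite ?zxE ?zyE ?ca // sa ger0_norm.
exists (2 * pi - acos (zx z)); first lra.
rewrite addrC E_per1.
by apply: S1_eq; rewrite ?zxE ?zyE ?cosN ?ca // sinN sa ltr0_norm // opprK.
Qed.

Lemma E_eq s t : E s = E t <-> exists k : int, t = s + (2 * pi) * k%:~R.
Proof.
split=> [est|[k ->]]; last by rewrite E_per.
have p0 := @pi_gt0 R; have pp := pi2_gt0.
pose k := Num.floor ((t - s) / (2 * pi)).
pose r := t - s - 2 * pi * k%:~R.
have r0 : 0 <= r < 2 * pi.
  have := ge_floor ((t - s) / (2 * pi)); have := lt_succ_floor ((t - s) / (2 * pi)).
  rewrite -/k ler_pdivlMr // ltr_pdivrMr // intrD /r; lra.
have cr : cos r = 1.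
  have -> : cos r = cos (t - s).
    by rewrite -!zxE -(E_per (- k) (t - s)) /r mulrNz mulrN.
  by rewrite cosB -!zxE -!zyE est -!expr2 zxyP.
exists k; suff : r = 0 by rewrite /r; lra.
have [rpi|rpi] := leP r pi.
  by apply: cos_inj; rewrite ?in_itv /= ?cos0 //; lra.
have : cos (2 * pi - r) = cos 0.
  by rewrite cos0 -[RHS]cr -zxE (addrC _ (- r)) E_per1 zxE cosN.
move/cos_inj; rewrite !in_itv /=; lra.
Qed.

(** The saturation of an open set is the union of its translates by the periods. *)
Lemma E_open : open_map E.
Proof.
apply: (@saturated_open_map _ _ _ `[0, 2 * pi]).
- exact: S1_hausdorff.
- exact: E_continuous.
- exact: segment_compact.
- apply/seteqP; split=> // z _; have [t t0 <-] := E_surj z.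
  by exists t => //=; rewrite in_itv.
move=> U oU.
have -> : E @^-1` (E @` U) =
    \bigcup_(k in [set: int]) (fun x => x + (2 * pi) * k%:~R) @^-1` U.
  apply/seteqP; split=> [x [y Uy] /= /esym/E_eq [k xy]|x [k _ /= Ux]].
    by exists k => //=; rewrite -xy.
  by exists (x + (2 * pi) * k%:~R) => //; rewrite E_per.
apply: bigcup_open => k _; apply: open_comp => // x _.
by apply: (@ct_add R _ (fun x => x)); ct.
Qed.

Lemma E_factor (Y : topologicalType) (g : S1 R -> Y) :
  continuous (g \o E) -> continuous g.
Proof.
by apply: open_map_factor; [exact: E_open|move=> z; have [t _] := E_surj z; exists t].
Qed.

(** R * R maps onto R * S1 by an open map. *)
Lemma E_factor2 (X Y : topologicalType) (g : X * S1 R -> Y) :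
  continuous (fun x : X * R => g (x.1, E x.2)) -> continuous g.
Proof.
apply: open_map_factor; first exact: (open_map_prod (@open_map_id X) E_open).
by move=> [x z]; have [t _ <-] := E_surj z; exists (x, t).
Qed.

(** A discontinuous choice, which only enters through functions of period
    2 pi; these are continuous on the circle. *)
Definition arg z : R := xget 0 [set t | E t = z].

Lemma argK z : E (arg z) = z.
Proof. by rewrite /arg; case: xgetP => // nz; have [t _ tz] := E_surj z; case: (nz t). Qed.

Lemma S1_connected : connected [set: S1 R].
Proof.
have -> : [set: S1 R] = E @` [set: R].
  by apply/seteqP; split=> // z _; exists (arg z) => //; exact: argK.
apply: connected_continuous_connected; last exact/continuous_subspaceT/E_continuous.
exact/connected_intervalP.
Qed.

Lemma S1_compact : compact [set: S1 R].
Proof.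
have -> : [set: S1 R] = E @` `[0, 2 * pi].
  apply/seteqP; split=> // z _; have [t t0 <-] := E_surj z.
  by exists t => //=; rewrite in_itv.
apply: continuous_compact; first exact/continuous_subspaceT/E_continuous.
exact: segment_compact.
Qed.

Definition conjS z : S1 R := dir (zx z, - zy z).

Lemma conjSE t : conjS (E t) = E (- t).
Proof.
by apply: S1_eq; rewrite ?zx_dir ?zy_dir /= ?zxE ?zyE ?sinN ?cosN ?sqrrN ?cos2Dsin2.
Qed.

Lemma conjSK z : conjS (conjS z) = z.
Proof. by rewrite -(argK z) !conjSE opprK. Qed.

Lemma conjS_continuous : continuous conjS.
Proof.
apply: E_factor; have -> : conjS \o E = (fun t => E (- t)).
  by apply/funext => t; rewrite /= conjSE.
by apply: ct_E; ct.
Qed.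

End Circle.

Ltac ct_hook f ::= lazymatch f with
  | fun y => E (@?a y) => apply: (@ct_E _ _ a)
  | fun y => zx (@?a y) => apply: (@ct_zx _ _ a)
  | fun y => zy (@?a y) => apply: (@ct_zy _ _ a)
  | fun y => vec (@?a y) (@?b y) => apply: (@ct_vec _ _ a b)
  | fun y => fun_of_matrix (@?a y) ?i ?j => apply: (@ct_coord _ _ _ a i j)
  end.

(** * Free homotopies *)

Lemma closed_glue (X Y : topologicalType) (A B : set X) (f g h : X -> Y) :
  closed A -> closed B -> A `|` B = setT ->
  {within A, continuous f} -> {within B, continuous g} ->
  (forall x, A x -> h x = f x) -> (forall x, B x -> h x = g x) -> continuous h.
Proof.
move=> cA cB AB cf cg hf hg.
suff : {within A `|` B, continuous h} by rewrite AB => c; apply/continuous_subspace_setT.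
apply: withinU_continuous => //.
- apply: (subspace_eq_continuous _ cf) => x; rewrite inE => Ax.
  exact: esym (hf x Ax).
- apply: (subspace_eq_continuous _ cg) => x; rewrite inE => Bx.
  exact: esym (hg x Bx).
Qed.

Lemma within_comp_total (X Y Z : topologicalType) (A : set Y) (f : Y -> Z)
    (u : X -> Y) :
  {within A, continuous f} -> continuous u -> (forall x, A (u x)) ->
  continuous (fun x => f (u x)).
Proof.
move=> /subspace_continuousP cf cu Au x U /(cf _ (Au x)) /= fU.
have H := cu x _ fU.
change (nbhs x [set y | A (u y) -> U (f (u y))]) in H.
change (nbhs x [set y | U (f (u y))]).
by move: H; apply: filterS => y /= fuy; exact: fuy (Au y).
Qed.

Section Homotopy.
Variables (R : realType) (X : topologicalType).
Implicit Types (P : set X) (g : S1 R -> X).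

Definition clamp (t : R) : R := Num.max 0 (Num.min 1 t).

Lemma clamp01 t : 0 <= clamp t <= 1.
Proof. by rewrite /clamp le_max lexx /= ge_max ler01 ge_min lexx. Qed.

Lemma clamp_id t : 0 <= t <= 1 -> clamp t = t.
Proof.
by move=> /andP[t0 t1]; rewrite /clamp (min_idPr t1); apply/max_idPr.
Qed.

(** Precomposing with the clamping of time makes the homotopy continuous and
    off P for all times, so that no subspace topology is involved. *)
Lemma freely_homotopicP P g0 g1 : freely_homotopic P g0 g1 <->
  exists H : R * S1 R -> X, [/\ continuous H, forall x, ~ P (H x),
    forall z, H (0, z) = g0 z & forall z, H (1, z) = g1 z].
Proof.
split=> [[H [cH HP H0 H1]]|[H [cH HP H0 H1]]]; last first.
  by exists H; split=> //; exact: continuous_subspaceT.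
have c01 := clamp01.
exists (fun x => H (clamp x.1, x.2)); split=> [|x|z|z] /=.
- apply: (within_comp_total cH) => [|x]; first by rewrite /clamp; ct.
  by split=> //=; rewrite in_itv /= clamp01.
- exact: HP.
- by rewrite clamp_id ?lexx ?ler01.
- by rewrite clamp_id ?lexx ?ler01.
Qed.

Lemma fh_of P (H : R * S1 R -> X) g0 g1 : continuous H ->
  (forall t z, 0 <= t <= 1 -> ~ P (H (t, z))) ->
  (forall z, H (0, z) = g0 z) -> (forall z, H (1, z) = g1 z) ->
  freely_homotopic P g0 g1.
Proof. by move=> cH HP H0 H1; exists H; split=> //; exact: continuous_subspaceT. Qed.

Lemma fh_sub P P' g0 g1 : P `<=` P' ->
  freely_homotopic P' g0 g1 -> freely_homotopic P g0 g1.
Proof.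
by move=> PP' [H [cH HP H0 H1]]; exists H; split=> // t z t01 /PP'; exact: HP.
Qed.

Lemma fh_sym P g0 g1 : freely_homotopic P g0 g1 -> freely_homotopic P g1 g0.
Proof.
move=> /freely_homotopicP[H [cH HP H0 H1]]; apply/freely_homotopicP.
exists (fun x => H (1 - x.1, x.2)); split=> [|x|z|z] //=.
- by apply: (ct_comp cH); ct.
- by rewrite subr0.
- by rewrite subrr.
Qed.

Lemma fh_trans P g1 g0 g2 : freely_homotopic P g0 g1 ->
  freely_homotopic P g1 g2 -> freely_homotopic P g0 g2.
Proof.
move=> /freely_homotopicP[H [cH HP H0 H1]] /freely_homotopicP[K [cK KP K0 K1]].
apply/freely_homotopicP.
pose h (x : R * S1 R) := H (clamp (2 * x.1), x.2).
pose k (x : R * S1 R) := K (clamp (2 * x.1 - 1), x.2).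
pose m x := if x.1 <= 2^-1 then h x else k x.
have c1 : clamp 1 = 1 by rewrite clamp_id // lexx ler01.
have c0 : clamp 0 = 0 by rewrite clamp_id // lexx ler01.
have cfst : continuous (fun x : R * S1 R => x.1) by ct.
exists m; split.
- apply: (@closed_glue _ _ [set x : R * S1 R | x.1 <= 2^-1]
    [set x : R * S1 R | 2^-1 <= x.1] h k).
  + exact: ((continuous_closedP _).1 cfst _ (closed_le (y := 2^-1))).
  + exact: ((continuous_closedP _).1 cfst _ (closed_ge (y := 2^-1))).
  + apply/seteqP; split=> // x _ /=.
    by have [?|/ltW ?] := leP x.1 2^-1; [left|right].
  + by apply: continuous_subspaceT; apply: (ct_comp cH); rewrite /clamp; ct.
  + by apply: continuous_subspaceT; apply: (ct_comp cK); rewrite /clamp; ct.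
  + by move=> x /= x2; rewrite /m x2.
  + move=> x /= x2; rewrite /m; case: ifPn => // x2'.
    have e : x.1 = 2^-1 by apply/le_anti/andP.
    rewrite /h /k e mulfV ?pnatr_eq0 // subrr c1 c0.
    by rewrite H1 K0.
- by move=> x; rewrite /m; case: ifP => _; [exact: HP|exact: KP].
- by move=> z; rewrite /m /= ifT ?invr_ge0 // /h /= mulr0 c0.
- move=> z; rewrite /m /= ifF.
    by rewrite /k /= mulr1 (_ : 2 - 1 = 1) ?c1 //; lra.
  by apply/negbTE; rewrite -ltNge; lra.
Qed.

Lemma fh_comp P (h : S1 R -> S1 R) g0 g1 : continuous h ->
  freely_homotopic P g0 g1 -> freely_homotopic P (g0 \o h) (g1 \o h).
Proof.
move=> ch /freely_homotopicP[H [cH HP H0 H1]]; apply/freely_homotopicP.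
exists (fun x => H (x.1, h x.2)); split=> [|x|z|z] //=.
by apply: (ct_comp cH); ct; apply: (ct_comp ch); ct.
Qed.

(** Two parametrizations of a simple closed curve differ by a self-map of the
    circle, because they are embeddings of a compact space. *)
Lemma parametrizes_comp g g' C : hausdorff_space X ->
  parametrizes g C -> parametrizes g' C ->
  exists2 h : S1 R -> S1 R, continuous h & g' = g \o h.
Proof.
move=> hX [cg ig gC] [cg' _ g'C].
have ex z : exists w, g w = g' z.
  have : C (g' z) by rewrite -g'C; exists z.
  by rewrite -gC => -[w _ wz]; exists w.
have [h hP] := choice ex.
exists h; last by apply/funext => z; rewrite /= hP.
apply/continuous_closedP => D cD.
have -> : h @^-1` D = g' @^-1` (g @` D).
  apply/seteqP; split=> [z Dz|z [w Dw wz]] /=; first by exists (h z).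
  by rewrite (_ : h z = w) //; apply: ig; rewrite hP.
apply: ((continuous_closedP _).1 cg'); apply: compact_closed => //.
apply: continuous_compact; first exact: continuous_subspaceT.
apply: (subclosed_compact cD (@S1_compact R)); exact: subsetT.
Qed.

(** The parametrization that contracts can be prescribed. *)
Lemma null_homotopic_param P C g : hausdorff_space X -> parametrizes g C ->
  null_homotopic R P C -> exists x, freely_homotopic P g (fun=> x).
Proof.
move=> hX gC [g' [x [g'C hg']]]; exists x.
have [h ch ->] := parametrizes_comp hX g'C gC.
exact: (fh_comp ch hg').
Qed.

End Homotopy.

(** * Lifting homotopies *)

Section Lifting.
Variables (R : realType) (M : pseudoMetricType R) (Y : topologicalType).
Variable F : M -> Y.

(** The fibers of F are orbits of a group of isometries of M, so that a radius
    of injectivity at one point serves for its whole fiber. *)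
Definition isometric_deck : Prop := forall X X', F X = F X' ->
  exists g : M -> M, [/\ g X = X', injective g, forall Z, F (g Z) = F Z
    & forall Z Z' e, ball Z e Z' -> ball (g Z) e (g Z')].

Definition inj_on_ball (X : M) (e : R) : Prop :=
  forall Z Z', ball X e Z -> ball X e Z' -> F Z = F Z' -> Z = Z'.

Definition locally_injective_at (X : M) : Prop :=
  exists2 e : R, 0 < e & inj_on_ball X e.

Hypotheses (F_open : open_map F) (F_deck : isometric_deck).

Lemma inj_on_ball_fiber X X' e : F X = F X' -> inj_on_ball X e -> inj_on_ball X' e.
Proof.
move=> /esym/F_deck [g [gX ig Fg bg]] iX Z Z' bZ bZ' ZZ'.
by apply/ig/iX; rewrite -?gX ?Fg //; exact: bg.
Qed.

Lemma near_lift X e : 0 < e ->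
  \forall y \near F X, exists2 X', ball X e X' & F X' = y.
Proof.
move=> e0; have : nbhs (F X) (F @` (ball X e)°).
  apply: open_nbhs_nbhs; split; first by apply: F_open; exact: open_interior.
  by exists X => //; exact: (nbhs_singleton (nbhs_interior (nbhsx_ballx X e e0))).
by apply: filterS => _ [X' /interior_subset bX' <-]; exists X'.
Qed.

(** The set of times at which two lifts agree is open by local injectivity,
    closed because M is Hausdorff, and the interval is connected. *)
Lemma unique_lift (a b : R) (L L' : R -> M) t0 :
  {within `[a, b], continuous L} -> {within `[a, b], continuous L'} ->
  (forall t, a <= t <= b -> F (L t) = F (L' t) /\ locally_injective_at (L t)) ->
  hausdorff_space M ->
  a <= t0 <= b -> L t0 = L' t0 -> forall t, a <= t <= b -> L t = L' t.
Proof.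
move=> /subspace_continuousP cL /subspace_continuousP cL' LL hM t0ab e0.
have itvP t : `[a, b]%classic t <-> a <= t <= b by rewrite /= in_itv.
have ab_conn : connected `[a, b]%classic by exact/connected_intervalP/interval_is_interval.
suff AE : [set t | `[a, b]%classic t /\ L t = L' t] = `[a, b]%classic.
  move=> t /(itvP t).2 tab.
  by have [] : [set t | `[a, b]%classic t /\ L t = L' t] t by rewrite AE.
apply: ab_conn.
- by exists t0; split=> //; exact/itvP.
- exists (~` closure [set t | `[a, b]%classic t /\ L t <> L' t]).
    exact/closed_openC/closed_closure.
  apply/seteqP; split=> t [tab Lt]; split=> //.
    move=> clt.
    have [_ [e ep ie]] := LL t ((itvP t).1 tab).
    have U1 := cL t tab _ (nbhsx_ballx (L t) e ep).
    have U2 := cL' t tab _ (nbhsx_ballx (L' t) e ep).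
    change (nbhs t [set s | `[a, b]%classic s -> ball (L t) e (L s)]) in U1.
    change (nbhs t [set s | `[a, b]%classic s -> ball (L' t) e (L' s)]) in U2.
    have [s [[sab ns] [/(_ sab) b1 /(_ sab) b2]]] := clt _ (filterI U1 U2).
    apply: ns; apply: ie => //; first by rewrite Lt.
    by have [] := LL s ((itvP s).1 sab).
  apply: contrapT => nL; apply: Lt; apply: subset_closure; split=> //.
- exists (closure [set t | `[a, b]%classic t /\ L t = L' t]); first exact: closed_closure.
  apply/seteqP; split=> t [tab Lt]; split=> //.
    by apply: subset_closure; split.
  apply: hM => A B At Bt.
  have U1 := cL t tab _ At; have U2 := cL' t tab _ Bt.
  change (nbhs t [set s | `[a, b]%classic s -> A (L s)]) in U1.
  change (nbhs t [set s | `[a, b]%classic s -> B (L' s)]) in U2.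
  have [s [[sab es] [/(_ sab) As /(_ sab) Bs]]] := Lt _ (filterI U1 U2).
  by exists (L s); split => //; rewrite es.
Qed.

Variables (Q : topologicalType) (K : set Q) (ret : Q -> Q) (h : R * Q -> Y).
Hypotheses (K_compact : compact K) (h_ct : continuous h).
Hypotheses (retK : forall q, K (ret q)) (h_ret : forall t q, h (t, ret q) = h (t, q)).
Hypothesis h_cov : forall (t : R) q, 0 <= t <= 1 ->
  exists2 X, F X = h (t, q) & locally_injective_at X.

Let rect := (`[0, 1]%classic : set R) `*` K.

Let rect_compact : compact rect.
Proof. by apply: compact_setX => //; exact: segment_compact. Qed.

Let uniform_inj : exists2 e : R, 0 < e & forall (t : R) q, 0 <= t <= 1 ->
  forall X, F X = h (t, q) -> inj_on_ball X e.
Proof.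
have /compact_near_coveringP cov := rect_compact.
have : \forall e \near (0 : R)^'+, rect `<=`
    (fun e x => forall X, F X = h x -> inj_on_ball X e) e.
  apply: cov => -[t0 q0] [/= t01 Kq0].
  have [|X0 X0h [e0 e0p i0]] := @h_cov t0 q0; first by rewrite in_itv in t01.
  have e2 : 0 < e0 / 2 by rewrite divr_gt0.
  have := near_lift X0 e2; rewrite X0h => /h_ct nl.
  exists ([set x | exists2 X', ball X0 (e0 / 2) X' & F X' = h x], [set e | e < e0 / 2]).
    by split=> //=; exact: nbhs_right_lt.
  move=> [x e] [/= [X' bX' X'h] ee] X Xh.
  apply: (@inj_on_ball_fiber X'); first by rewrite X'h Xh.
  move=> Z Z' bZ bZ'; apply: i0.
  - rewrite [e0]splitr; apply: ball_triangle bX' _; apply: le_ball bZ; exact: ltW.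
  - rewrite [e0]splitr; apply: ball_triangle bX' _; apply: le_ball bZ'; exact: ltW.
move=> /(filterI (nbhs_right_gt 0)) /filter_ex [e [e0 He]].
exists e => // t q t01 X Xh; apply: (He (t, ret q)) => //=.
  by split => /=; rewrite ?in_itv.
by rewrite h_ret.
Qed.

Let uniform_step (e : R) : 0 < e -> exists2 d : R, 0 < d & forall (t t' : R) q, 0 <= t <= 1 ->
  `|t - t'| < d -> forall X, F X = h (t, q) ->
  exists2 X', ball X e X' & F X' = h (t', q).
Proof.
move=> e0.
have /compact_near_coveringP cov := rect_compact.
have : \forall d \near (0 : R)^'+, rect `<=` (fun d x => forall t',
    `|x.1 - t'| < d -> forall X, F X = h x ->
    exists2 X', ball X e X' & F X' = h (t', x.2)) d.
  apply: cov => -[t0 q0] [/= t01 Kq0].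
  have [|X0 X0h _] := @h_cov t0 q0; first by rewrite in_itv in t01.
  have e2 : 0 < e / 2 by rewrite divr_gt0.
  have := near_lift X0 e2; rewrite X0h => /h_ct [[A B] /= [/nbhs_ballP[r /= r0 Ar] Bq] AB].
  exists (ball t0 (r / 2) `*` B, [set d | d < r / 2]).
    split=> /=; last by apply: nbhs_right_lt; rewrite divr_gt0.
    exists (ball t0 (r / 2), B) => //; split=> //.
    by apply: nbhsx_ballx; rewrite divr_gt0.
  move=> [[t q] d] [/= [tr Bq'] dr] t' /= tt' X Xh.
  have [|X1 b1 X1h] := AB (t, q).
    by split=> //=; apply: Ar; apply: le_ball tr; rewrite ler_pdivrMr // ler_peMr ?ltW // ltr1n.
  have [|X2 b2 X2h] := AB (t', q).
    split=> //=; apply: Ar; rewrite [r]splitr; apply: ball_triangle tr _.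
    exact: lt_trans dr.
  have [|g [gX1 ig Fg bg]] := @F_deck X1 X; first by rewrite X1h Xh.
  exists (g X2); last by rewrite Fg X2h.
  rewrite -gX1; apply: bg; rewrite [e]splitr.
  by apply: ball_triangle b2; exact: ball_sym.
move=> /(filterI (nbhs_right_gt 0)) /filter_ex [d [d0 Hd]].
exists d => // t t' q t01 tt' X Xh; rewrite -(h_ret t').
apply: (Hd (t, ret q)) => //=; last by rewrite h_ret.
by split => /=; rewrite ?in_itv.
Qed.

(** The lift is built in finitely many time steps, simultaneously for all q:
    each step moves L q to the unique nearby point over h (t', q). The map ret
    retracts the parameters onto a compact set that determines h, which gives
    the uniform radius and the uniform step. The map F is allowed to branch
    away from the image of h, as pillow maps do. *)
Lemma homotopy_lifting (L0 : Q -> M) :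
  continuous L0 -> (forall q, F (L0 q) = h (0, q)) ->
  exists L : Q -> M, [/\ continuous L, forall q, F (L q) = h (1, q)
    & forall q, (forall t : R, 0 <= t <= 1 -> h (t, q) = h (0, q)) -> L q = L0 q].
Proof.
move=> cL0 FL0.
have [e e0 inj] := uniform_inj.
have e2 : 0 < e / 2 by rewrite divr_gt0.
have e4 : 0 < e / 2 / 2 by rewrite divr_gt0.
have [d d0 step] := uniform_step e2.
have [N Nd] : exists N : nat, N.+1%:R^-1 < d.
  have [N _ /(_ N (leqnn N)) ND] := near_infty_natSinv_lt (PosNum d0).
  by exists N; exact: ND.
pose tm (i : nat) : R := i%:R / N.+1%:R.
have tm01 i : (i <= N.+1)%N -> 0 <= tm i <= 1.
  by move=> iN; rewrite divr_ge0 //= ler_pdivrMr // mul1r ler_nat.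
have tmS i : `|tm i - tm i.+1| < d.
  rewrite /tm -(natr1 i) mulrDl mul1r opprD addrA subrr add0r normrN.
  by rewrite ger0_norm ?invr_ge0.
suff /(_ N.+1 (leqnn _)) [L [cL FL bL]] : forall i, (i <= N.+1)%N ->
    exists L : Q -> M, [/\ continuous L, forall q, F (L q) = h (tm i, q)
    & forall q, (forall t : R, 0 <= t <= 1 -> h (t, q) = h (0, q)) -> L q = L0 q].
  by exists L; split=> // q; rewrite FL /tm divff.
elim=> [_|i IH iN]; first by exists L0; split=> // q; rewrite /tm mul0r.
have [L [cL FL bL]] := IH (ltnW iN).
have ex q : exists X, ball (L q) (e / 2) X /\ F X = h (tm i.+1, q).
  by have [X] := step (tm i) (tm i.+1) q (tm01 _ (ltnW iN)) (tmS i) _ (FL q); exists X.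
have [L' L'P] := choice ex.
have ee : e / 2 <= e by rewrite ler_pdivrMr // ler_peMr ?ltW // ltr1n.
exists L'; split=> [q0|q|q hq].
- apply/cvg_ballP => r r0.
  have r40 : 0 < Num.min r (e / 2 / 2) by rewrite lt_min r0.
  have h1 : \forall q \near q0, exists2 X, ball (L' q0) (Num.min r (e / 2 / 2)) X &
      F X = h (tm i.+1, q).
    have := near_lift (L' q0) r40; rewrite (L'P q0).2.
    have chi : continuous (fun q => h (tm i.+1, q)) by apply: (ct_comp h_ct); ct.
    exact: chi.
  have h2 : \forall q \near q0, ball (L q0) (e / 2 / 2) (L q).
    exact: (cL q0 _ (nbhsx_ballx (L q0) _ e4)).
  near=> q.
  have [X bX FX] : exists2 X, ball (L' q0) (Num.min r (e / 2 / 2)) X & F X = h (tm i.+1, q).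
    by near: q.
  have bL2 : ball (L q0) (e / 2 / 2) (L q) by near: q.
  have -> : L' q = X.
    apply: (inj (tm i) q (tm01 _ (ltnW iN)) (L q) (FL q)); last 1 first.
    + by rewrite (L'P q).2.
    + by apply: le_ball ee _ _; exact: (L'P q).1.
    + apply: (@le_ball _ _ _ (e / 2 / 2 + e / 2 + e / 2 / 2)); first lra.
      apply: ball_triangle (ball_triangle (ball_sym bL2) _) _; last first.
        apply: le_ball bX; by rewrite ge_min lexx orbT.
      apply: le_ball (L'P q0).1.
      exact: lexx.
  by apply: le_ball bX; rewrite ge_min lexx.
- exact: (L'P q).2.
- rewrite -(bL q hq); apply: (inj (tm i) q (tm01 _ (ltnW iN)) (L q) (FL q)).
  + by apply: le_ball ee _ _; exact: (L'P q).1.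
  + exact: ballxx.
  + by rewrite (L'P q).2 FL !hq ?tm01 // ltnW.
Unshelve. all: by end_near. Qed.

End Lifting.

(** * Embedded disks bound essential curves *)

Section RectangleLift.
Variables (R : realType) (M : pseudoMetricType R) (Y : topologicalType).
Variable F : M -> Y.
Hypotheses (F_open : open_map F) (F_deck : isometric_deck F).

(** The rectangle is contracted linearly to its corner, and this contraction is
    lifted. *)
Lemma rectangle_lift (S : R) (H : R * R -> Y) X0 : 0 < S -> continuous H ->
  (forall t s, 0 <= t <= 1 -> 0 <= s <= S ->
     exists2 X, F X = H (t, s) & locally_injective_at F X) ->
  F X0 = H (0, 0) ->
  exists L : R * R -> M, [/\ continuous L, L (0, 0) = X0 &
    forall t s, 0 <= t <= 1 -> 0 <= s <= S -> F (L (t, s)) = H (t, s)].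
Proof.
move=> S0 cH good FX0.
pose ret (q : R * R) : R * R := (clamp q.1, S * clamp (q.2 / S)).
pose h (x : R * (R * R)) := H (x.1 * (ret x.2).1, x.1 * (ret x.2).2).
have clS s : 0 <= S * clamp (s / S) <= S.
  have /andP[c0 c1] := clamp01 (s / S).
  apply/andP; split; first by rewrite mulr_ge0 // ltW.
  by rewrite ler_piMr // ltW.
have ret_id t s : 0 <= t <= 1 -> 0 <= s <= S -> ret (t, s) = (t, s).
  move=> t01 /andP[s0 sS]; rewrite /ret /= clamp_id // clamp_id.
    by rewrite mulrCA divff ?mulr1 // gt_eqF.
  by apply/andP; split; [rewrite divr_ge0 // ltW|rewrite ler_pdivrMr // mul1r].
have mul01 (t a b : R) : 0 <= t <= 1 -> 0 <= a <= b -> 0 <= t * a <= b.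
  move=> /andP[t0 t1] /andP[a0 ab]; rewrite mulr_ge0 //=.
  by apply: le_trans ab; rewrite ler_piMl.
have cK : compact ((`[0, 1]%classic : set R) `*` (`[0, S]%classic : set R)).
  by apply: compact_setX; exact: segment_compact.
have ch : continuous h by apply: (ct_comp cH); rewrite /ret /clamp; ct.
have retK q : ((`[0, 1]%classic : set R) `*` (`[0, S]%classic : set R)) (ret q).
  by split; rewrite /= in_itv /= ?clamp01 ?clS.
have h_ret t q : h (t, ret q) = h (t, q).
  case: q => a b; have e : ret (ret (a, b)) = ret (a, b).
    by apply: ret_id; rewrite ?clamp01 ?clS.
  by rewrite /h; change ((t, ret (a, b)).2) with (ret (a, b)); rewrite e.
have h_cov (t : R) q : 0 <= t <= 1 -> exists2 X, F X = h (t, q) & locally_injective_at F X.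
  by case: q => a b t01; apply: good; apply: mul01; rewrite ?clamp01 ?clS.
have h0 q : F X0 = h (0, q) by rewrite /h !mul0r.
have [L [cL FL bL]] := homotopy_lifting F_open F_deck cK ch retK h_ret h_cov
  (@ct_cst _ _ X0) h0.
exists L; split=> //.
  apply: bL => t t01; rewrite /h ret_id ?lexx ?ler01 ?(ltW S0) //=.
  by rewrite !mulr0.
by move=> t s t01 sS; rewrite FL /h ret_id // !mul1r.
Qed.

End RectangleLift.

Section NoRetraction.
Variable R : realType.

Lemma E_deck : isometric_deck (@E R).
Proof.
move=> X X' /E_eq [k ->]; exists (fun x => x + 2 * pi * k%:~R); split=> //.
- exact: addIr.
- by move=> Z; rewrite E_per.
- by move=> Z Z' e; rewrite -ball_normE /ball_ /= opprD addrACA subrr addr0.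
Qed.

Lemma E_locally_injective X : locally_injective_at (@E R) X.
Proof.
have p0 := @pi_gt0 R.
exists pi => // Z Z'; rewrite -ball_normE /ball_ /= => Z1 Z2 /E_eq [k kE].
have : `|k%:~R| < 1 :> R.
  rewrite -(ltr_pM2l (pi2_gt0 R)) mulr1 -{1}(gtr0_norm (pi2_gt0 R)) -normrM.
  have -> : 2 * pi * k%:~R = (X - Z) - (X - Z') by rewrite kE; ring.
  by apply: le_lt_trans (ler_normB _ _) _; lra.
rewrite -intr_norm -[X in _ < X]/(1%:~R) ltr_int => k1.
have k0 : k = 0 by lia.
by rewrite kE k0 mulr0 addr0.
Qed.

(** In a lift of the homotopy to the line, the increment over one turn is
    constant in time; it is 0 for a constant loop and 2 pi for the identity. *)
Lemma E_not_null (K : R * S1 R -> S1 R) c : continuous K ->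
  (forall z, K (0, z) = c) -> ~ (forall z, K (1, z) = z).
Proof.
move=> cK K0 K1.
have p2 := pi2_gt0 R.
have cH : continuous (fun x : R * R => K (x.1, E x.2)) by apply: (ct_comp cK); ct.
have [L [cL _ LH]] := rectangle_lift (@E_open R) E_deck p2 cH
  (fun t s _ _ => ex_intro2 _ _ (arg (K (t, E s))) (argK _) (E_locally_injective _))
  (argK _).
have ul (a b : R) (f g : R -> R) t0 t1 : continuous f -> continuous g ->
    (forall t, a <= t <= b -> E (f t) = E (g t)) -> a <= t0 <= b -> a <= t1 <= b ->
    f t0 = g t0 -> f t1 = g t1.
  move=> cf cg fg t0ab t1ab e0.
  apply: (@unique_lift R R _ (@E R) a b f g t0) => //.
  - exact: continuous_subspaceT.
  - exact: continuous_subspaceT.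
  - by move=> t tab; split; [exact: fg|exact: E_locally_injective].
have z01 : 0 <= (0 : R) <= 1 by rewrite lexx ler01.
have o01 : 0 <= (1 : R) <= 1 by rewrite lexx ler01.
have s0 : 0 <= (0 : R) <= 2 * pi by rewrite lexx /= ltW.
have s1 : 0 <= 2 * (pi : R) <= 2 * pi by rewrite lexx andbT ltW.
have e0 : L (0, 2 * pi) = L (0, 0).
  apply: (ul 0 (2 * pi) (fun s => L (0, s)) (fun=> L (0, 0)) 0) => //.
  - by apply: (ct_comp cL); ct.
  - exact: ct_cst.
  - by move=> s sS; rewrite !LH //= !K0.
have e1 : L (1, 2 * pi) = L (1, 0).
  apply: (ul 0 1 (fun t => L (t, 2 * pi)) (fun t => L (t, 0)) 0) => //.
  - by apply: (ct_comp cL); ct.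
  - by apply: (ct_comp cL); ct.
  - by move=> t t01; rewrite !LH //= -[2 * pi]add0r E_per1.
have E10 : E (L (1, 0)) = E 0 by rewrite LH //= K1.
have : L (1, 2 * pi) = 2 * pi + L (1, 0).
  apply: (ul 0 (2 * pi) (fun s => L (1, s)) (fun s => s + L (1, 0)) 0) => //.
  - by apply: (ct_comp cL); ct.
  - by apply: (@ct_add R _ (fun s => s)); ct.
  - move=> s sS; rewrite LH //= K1.
    by have /E_eq [k kE] := E10; apply/E_eq; exists (- k); rewrite mulrNz mulrN; lra.
  - by rewrite add0r.
rewrite e1; lra.
Qed.

(** Otherwise the directions of r v - x0 on large circles around x0 would give a
    contraction of the identity of the circle. *)
Lemma no_planar_retraction (r : R * R -> R * R) (M : R) x0 : continuous r ->
  (forall v, M <= v.1 ^+ 2 + v.2 ^+ 2 -> r v = v) -> ~ (forall v, r v <> x0).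
Proof.
move=> cr rid rx0.
case: x0 rx0 => a b rx0.
pose N := 2 * (`|a| + `|b|) + `|M| + 1.
have N1 : 1 <= N.
  rewrite /N; have := normr_ge0 a; have := normr_ge0 b; have := normr_ge0 M; lra.
pose u (x : R * S1 R) := r (x.1 * N * zx x.2 + a, x.1 * N * zy x.2 + b).
pose K x := dir ((u x).1 - a, (u x).2 - b).
apply: (@E_not_null K (dir ((u (0, E 0)).1 - a, (u (0, E 0)).2 - b))).
- apply: ct_dir => [x|].
    apply/eqP => -[/eqP]; rewrite subr_eq0 => /eqP u1 /eqP; rewrite subr_eq0 => /eqP u2.
    by apply: (rx0 (x.1 * N * zx x.2 + a, x.1 * N * zy x.2 + b)); rewrite -/(u x) -u1 -u2; case: (u x).
  have cu : continuous u by apply: (ct_comp cr); ct.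
  by ct.
- by move=> z; rewrite /K /u /= !mul0r.
- move=> z; rewrite /K /u /= !mul1r rid /=.
    rewrite !addrK; rewrite (dir_scale (zx z, zy z)) ?dir_zxy //.
    exact: lt_le_trans N1.
  have zP := zxyP z.
  have x1 : `|zx z| <= 1 by rewrite ler_norml; exact: zx_bound.
  have y1 : `|zy z| <= 1.
    by rewrite -(ler_pXn2r (ltn0Sn 1)) ?nnegrE // real_normK ?num_real // expr1n -zP lerDr sqr_ge0.
  have xa : - `|a| <= zx z * a.
    apply: lerNnormlW; rewrite normrM; by apply: ler_piMl.
  have yb : - `|b| <= zy z * b.
    apply: lerNnormlW; rewrite normrM; by apply: ler_piMl.
  have -> : (N * zx z + a) ^+ 2 + (N * zy z + b) ^+ 2 =
      N ^+ 2 * (zx z ^+ 2 + zy z ^+ 2) + 2 * N * (zx z * a + zy z * b) + a ^+ 2 + b ^+ 2 by ring.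
  rewrite zP mulr1.
  have h1 : 2 * N * (- `|a| - `|b|) <= 2 * N * (zx z * a + zy z * b).
    by rewrite ler_wpM2l //; lra.
  have h2 : `|M| + 1 <= N * (`|M| + 1).
    by rewrite ler_peMl // addr_ge0.
  have := ler_norm M; have := sqr_ge0 a; have := sqr_ge0 b.
  have -> : N ^+ 2 = N * (2 * (`|a| + `|b|)) + N * (`|M| + 1).
    by rewrite /N; ring.
  move: h1 h2; lra.
Qed.

End NoRetraction.

(** ** Degree on the sphere *)

Section Sphere.
Variable R : realType.

Definition vec3 (a b c : R) : 'rV[R]_3 := \row_(i < 3) [:: a; b; c]`_i.

Definition i1 : 'I_3 := inord 1.

Lemma vec3_0 a b c : vec3 a b c ord0 ord0 = a. Proof. by rewrite mxE. Qed.
Lemma vec3_1 a b c : vec3 a b c ord0 i1 = b. Proof. by rewrite mxE inordK. Qed.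
Lemma vec3_2 a b c : vec3 a b c ord0 ord_max = c. Proof. by rewrite mxE. Qed.

Lemma ord3P (i : 'I_3) : [\/ i = ord0, i = i1 | i = ord_max].
Proof.
case: i => -[|[|[|//]]] lt3; [apply: Or31|apply: Or32|apply: Or33]; apply/val_inj => //=.
by rewrite inordK.
Qed.

Lemma vec3_eq (u v : 'rV[R]_3) : u ord0 ord0 = v ord0 ord0 ->
  u ord0 i1 = v ord0 i1 -> u ord0 ord_max = v ord0 ord_max -> u = v.
Proof. by move=> e0 e1 e2; apply/rowP => i; case: (ord3P i) => ->. Qed.

Lemma ct_vec3 (X : topologicalType) (f g h : X -> R) : continuous f ->
  continuous g -> continuous h -> continuous (fun x => vec3 (f x) (g x) (h x)).
Proof.
move=> cf cg ch; apply: ct_row => i; case: (ord3P i) => ->.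
- by under eq_fun do rewrite vec3_0.
- by under eq_fun do rewrite vec3_1.
- by under eq_fun do rewrite vec3_2.
Qed.

Lemma sphere2P (u : 'rV[R]_3) : sphere R 2 u <->
  u ord0 ord0 ^+ 2 + u ord0 i1 ^+ 2 + u ord0 ord_max ^+ 2 = 1.
Proof.
rewrite /sphere /= big_ord_recr big_ord_recr big_ord1 /=.
have -> : widen_ord (leqnSn 2) (widen_ord (leqnSn 1) ord0) = ord0 by exact/val_inj.
have -> // : widen_ord (leqnSn 2) ord_max = i1 by apply/val_inj; rewrite /= inordK.
Qed.

Fact north_subproof : vec3 0 0 1 \in sphere R 2.
Proof. by apply/mem_set/sphere2P; rewrite vec3_0 vec3_1 vec3_2 expr1n expr0n !add0r. Qed.

Definition north : S2 R := exist (fun u => u \in sphere R 2) _ north_subproof.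

Definition mk2 (u : 'rV[R]_3) : S2 R := insubd north u.

Lemma val_mk2 u : sphere R 2 u -> \val (mk2 u) = u.
Proof. by move=> su; rewrite val_insubd mem_set. Qed.

Definition sx (w : S2 R) := \val w ord0 ord0.
Definition sy (w : S2 R) := \val w ord0 i1.
Definition sz (w : S2 R) := \val w ord0 ord_max.

Lemma sxyzP w : sx w ^+ 2 + sy w ^+ 2 + sz w ^+ 2 = 1.
Proof. by apply/sphere2P; exact/set_mem/(valP w). Qed.

Lemma S2_eq w w' : sx w = sx w' -> sy w = sy w' -> sz w = sz w' -> w = w'.
Proof. by move=> *; apply/val_inj/vec3_eq. Qed.

Lemma ct_mk2 (X : topologicalType) (f : X -> 'rV[R]_3) :
  (forall x, sphere R 2 (f x)) -> continuous f -> continuous (fun x => mk2 (f x)).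
Proof.
move=> fs cf; apply: ct_set_type.
by rewrite (_ : (fun _ => _) = f) //; apply/funext => x; rewrite val_mk2.
Qed.

Lemma ct_sx (X : topologicalType) (f : X -> S2 R) : continuous f -> continuous (fun x => sx (f x)).
Proof. by move=> cf; apply: ct_coord; apply: ct_val. Qed.
Lemma ct_sy (X : topologicalType) (f : X -> S2 R) : continuous f -> continuous (fun x => sy (f x)).
Proof. by move=> cf; apply: ct_coord; apply: ct_val. Qed.
Lemma ct_sz (X : topologicalType) (f : X -> S2 R) : continuous f -> continuous (fun x => sz (f x)).
Proof. by move=> cf; apply: ct_coord; apply: ct_val. Qed.

Lemma sz1_north w : sz w = 1 -> w = north.
Proof.
move=> z1; have := sxyzP w; rewrite z1 expr1n -[RHS]add0r => /addIr /eqP.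
rewrite paddr_eq0 ?sqr_ge0 // !sqrf_eq0 => /andP[/eqP x0 /eqP y0].
by apply: S2_eq; rewrite ?x0 ?y0 ?z1 /sx /sy /sz /= ?vec3_0 ?vec3_1 ?vec3_2.
Qed.

(** The inverse stereographic projection from the north pole. *)
Definition ist (v : R * R) : 'rV[R]_3 :=
  let n := (v.1 ^+ 2 + v.2 ^+ 2 + 1)^-1 in
  vec3 (2 * v.1 * n) (2 * v.2 * n) ((v.1 ^+ 2 + v.2 ^+ 2 - 1) * n).

Lemma ist_den (v : R * R) : 0 < v.1 ^+ 2 + v.2 ^+ 2 + 1.
Proof. by rewrite ltr_wpDl ?addr_ge0 ?sqr_ge0. Qed.

Lemma ist_sphere v : sphere R 2 (ist v).
Proof.
apply/sphere2P; rewrite vec3_0 vec3_1 vec3_2.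
have := ist_den v; set n := _ + 1 => n0.
by apply: (mulIf (lt0r_neq0 (mulr_gt0 n0 n0))); rewrite /n; field; rewrite lt0r_neq0.
Qed.

Definition st (w : S2 R) : R * R := (sx w / (1 - sz w), sy w / (1 - sz w)).

Lemma st_ist v : st (mk2 (ist v)) = v.
Proof.
rewrite /st /sx /sy /sz val_mk2; last exact: ist_sphere.
rewrite vec3_0 vec3_1 vec3_2; have := ist_den v; case: v => a b /= n0.
by congr pair; field; rewrite lt0r_neq0 //=; apply/eqP; lra.
Qed.

Lemma st_inj w w' : w <> north -> w' <> north -> st w = st w' -> w = w'.
Proof.
move=> wN w'N [].
have d0 u : u <> north -> 1 - sz u != 0.
  by move=> uN; apply/eqP => u0; apply/uN/sz1_north; lra.
have := d0 _ wN; have := d0 _ w'N; have := sxyzP w; have := sxyzP w'.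
set a' := sx w'; set b' := sy w'; set c' := sz w'.
set a := sx w; set b := sy w; set c := sz w => s' s d' d ea eb.
have {}ea : a = a' / (1 - c') * (1 - c) by rewrite -ea divfK.
have {}eb : b = b' / (1 - c') * (1 - c) by rewrite -eb divfK.
have q : (a' / (1 - c')) ^+ 2 + (b' / (1 - c')) ^+ 2 = (1 + c') / (1 - c').
  apply: (mulIf (expf_neq0 2 d')); rewrite mulrDl -!exprMn !divfK //.
  rewrite expr2 mulrA divfK //; move: s'; rewrite -/a' -/b' -/c'; lra.
have q' : (a' / (1 - c')) ^+ 2 + (b' / (1 - c')) ^+ 2 = (1 + c) / (1 - c).
  apply: (mulIf (expf_neq0 2 d)); rewrite mulrDl -!exprMn -ea -eb.
  by rewrite expr2 mulrA divfK //; lra.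
have cc : c = c'.
  have : (1 + c) * (1 - c') = (1 + c') * (1 - c).
    by move: q'; rewrite q => /(congr1 (fun x => x * ((1 - c') * (1 - c)))); rewrite mulrA divfK // [(_ - _) * _ in RHS]mulrC mulrA divfK.
  lra.
by apply: S2_eq; rewrite -/a -/b -/c -/a' -/b' -/c' // (ea, eb) cc divfK.
Qed.

(** Stereographic projection turns a neighborhood of the north pole into the
    complement of a large disk, and r into a self-map of the plane. *)
Lemma no_sphere_retraction_north (r : S2 R -> S2 R) x : continuous r ->
  (forall w, r w <> x) -> (forall w, r w = north -> w = north) ->
  (\forall w \near north, r w = w) -> False.
Proof.
move=> cr rx rN rid.
have xN : x <> north by move=> xN; apply: (rx north); rewrite xN; exact: nbhs_singleton rid.
have iN v : mk2 (ist v) <> north.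
  move=> /(congr1 sz); rewrite /sz val_mk2; last exact: ist_sphere.
  rewrite /north /= !vec3_2 => /eqP; rewrite -subr_eq0 => /eqP e.
  have n0 := ist_den v; move: e.
  rewrite -[X in _ - X](divff (lt0r_neq0 n0)) -mulrBl => /eqP.
  rewrite mulf_eq0 invr_eq0 (negbTE (lt0r_neq0 n0)) orbF => /eqP; lra.
have cist : continuous (fun v => mk2 (ist v)).
  apply: ct_mk2; first exact: ist_sphere.
  have cn : continuous (fun v : R * R => (v.1 ^+ 2 + v.2 ^+ 2 + 1)^-1).
    by ct => v; rewrite lt0r_neq0 // ist_den.
  by apply: ct_vec3; ct.
have [e e0 He] : exists2 e : R, 0 < e & forall w, 2 - 2 * sz w < e -> r w = w.
  move: rid => [U [[V oV <-] VN] UH].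
  have /nbhs_ballP [d /= d0 dV] : nbhs (\val north) V by apply: open_nbhs_nbhs.
  exists (d ^+ 2); first by rewrite exprn_gt0.
  move=> w wd; apply: UH => /=; apply: dV; split=> // i j; rewrite (ord1 i).
  have sq : sx w ^+ 2 + sy w ^+ 2 + (1 - sz w) ^+ 2 < d ^+ 2.
    by have := sxyzP w; move: wd; set a := sx w; set b := sy w; set c := sz w; lra.
  have lt_of (t : R) : t ^+ 2 < d ^+ 2 -> `|t| < d.
    by move=> td; rewrite -(ltr_pXn2r (ltn0Sn 1)) ?nnegrE ?(ltW d0) // real_normK ?num_real.
  have := sqr_ge0 (sx w); have := sqr_ge0 (sy w); have := sqr_ge0 (1 - sz w) => h1 h2 h3.
  rewrite -ball_normE /ball_ /=; apply: lt_of.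
  case: (ord3P j) => ->.
  - by rewrite vec3_0 sub0r sqrrN -/(sx w); lra.
  - by rewrite vec3_1 sub0r sqrrN -/(sy w); lra.
  - by rewrite vec3_2 -/(sz w); lra.
apply: (@no_planar_retraction R (fun v => st (r (mk2 (ist v)))) (4 / e) (st x)).
- have crr : continuous (fun v => r (mk2 (ist v))) by apply: (ct_comp cr).
  have d0 v : 1 - sz (r (mk2 (ist v))) != 0.
    by apply/eqP => u0; apply/(iN v)/rN/sz1_north; lra.
  by rewrite /st; ct => //; (apply: ct_sx || apply: ct_sy || apply: ct_sz).
- move=> v vM; rewrite He ?st_ist // /sz val_mk2; last exact: ist_sphere.
  rewrite vec3_2; have n0 := ist_den v.
  have -> : 2 - 2 * ((v.1 ^+ 2 + v.2 ^+ 2 - 1) * (v.1 ^+ 2 + v.2 ^+ 2 + 1)^-1) =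
      4 / (v.1 ^+ 2 + v.2 ^+ 2 + 1) by field; rewrite lt0r_neq0.
  rewrite ltr_pdivrMr // mulrC -ltr_pdivrMr //; lra.
- move=> v /st_inj e1; apply: (rx (mk2 (ist v))); apply: e1 => //.
  by move=> /rN /iN.
Qed.

(** The reflection exchanging y and the north pole reduces this to the previous
    case. *)
Lemma no_sphere_retraction (r : S2 R -> S2 R) x y : continuous r ->
  (forall w, r w <> x) -> (forall w, r w = y -> w = y) ->
  (\forall w \near y, r w = w) -> False.
Proof.
move=> cr rx ry rid.
have [yN|yN] := pselect (y = north).
  by apply: (@no_sphere_retraction_north r x) => //; rewrite -yN.
have d0 : 1 - sz y != 0 by apply/eqP => u0; apply/yN/sz1_north; lra.
pose k (w : S2 R) := (sx w * sx y + sy w * sy y + sz w * (sz y - 1)) / (1 - sz y).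
pose H w := mk2 (vec3 (sx w - k w * sx y) (sy w - k w * sy y) (sz w - k w * (sz y - 1))).
have Hs w : sphere R 2 (vec3 (sx w - k w * sx y) (sy w - k w * sy y) (sz w - k w * (sz y - 1))).
  apply/sphere2P; rewrite vec3_0 vec3_1 vec3_2 -[RHS](sxyzP w).
  have := sxyzP y.
  have kE : sx w * sx y + sy w * sy y + sz w * (sz y - 1) = k w * (1 - sz y) by rewrite /k divfK.
  move: kE; set K := k w; set a := sx w; set b := sy w; set c := sz w.
  set a' := sx y; set b' := sy y; set c' := sz y => kE s'.
  have -> : (a - K * a') ^+ 2 + (b - K * b') ^+ 2 + (c - K * (c' - 1)) ^+ 2 =
    a ^+ 2 + b ^+ 2 + c ^+ 2 - 2 * K * (a * a' + b * b' + c * (c' - 1)) +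
    K ^+ 2 * (a' ^+ 2 + b' ^+ 2 + c' ^+ 2 - 2 * c' + 1) by ring.
  by rewrite kE s'; ring.
have Hx w : sx (H w) = sx w - k w * sx y by rewrite /sx /H val_mk2 // vec3_0.
have Hy w : sy (H w) = sy w - k w * sy y by rewrite /sy /H val_mk2 // vec3_1.
have Hz w : sz (H w) = sz w - k w * (sz y - 1) by rewrite /sz /H val_mk2 // vec3_2.
have HK w : H (H w) = w.
  have kH : k (H w) = - k w.
    rewrite {1}/k Hx Hy Hz; apply: (mulIf d0); rewrite divfK //.
    have := sxyzP y.
    have kE : sx w * sx y + sy w * sy y + sz w * (sz y - 1) = k w * (1 - sz y) by rewrite /k divfK.
    move: kE; set K := k w; set a := sx w; set b := sy w; set c := sz w.
    set a' := sx y; set b' := sy y; set c' := sz y => kE s'.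
    have -> : (a - K * a') * a' + (b - K * b') * b' + (c - K * (c' - 1)) * (c' - 1) =
      (a * a' + b * b' + c * (c' - 1)) - K * (a' ^+ 2 + b' ^+ 2 + c' ^+ 2 - 2 * c' + 1) by ring.
    by rewrite kE s'; ring.
  by apply: S2_eq; rewrite !(Hx, Hy, Hz) kH mulNr opprK subrK.
have Hn : H north = y.
  have kn : k north = - 1.
    rewrite /k /sx /sy /sz /= vec3_0 vec3_1 vec3_2 -!/(sz y) !mul0r !add0r mul1r.
    by rewrite -opprB mulNr divff.
  apply: S2_eq; rewrite ?Hx ?Hy ?Hz kn mulN1r opprK /sx /sy /sz /= ?vec3_0 ?vec3_1 ?vec3_2 ?add0r //.
  by rewrite addrC subrK.
have cH : continuous H.
  apply: ct_mk2 => //; rewrite /k.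
  have cx : continuous (@sx) by apply: ct_sx; exact: ct_id.
  have cy : continuous (@sy) by apply: ct_sy; exact: ct_id.
  have cz : continuous (@sz) by apply: ct_sz; exact: ct_id.
  by apply: ct_vec3; ct.
apply: (@no_sphere_retraction_north (H \o r \o H) (H x)).
- by have : continuous (fun w => H (r (H w))) by ct.
- by move=> w /= /(congr1 H); rewrite !HK; exact: rx.
- by move=> w /= /(congr1 H); rewrite HK Hn => /ry /(congr1 H); rewrite HK -Hn HK.
- have := cH north; rewrite /continuous_at Hn => /(_ _ rid) rH.
  change (nbhs north [set w | r (H w) = H w]) in rH.
  by move: rH; apply: filterS => w /= ->; rewrite HK.
Qed.

(** The disk k is given in polar coordinates around a center that may be an arc.
    A contraction of its boundary off x and y, spread over the disk and extended
    by the identity outside, would be a self-map of the sphere that misses x and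
    is the identity near y. *)
Lemma disk_boundary_essential (k : R * S1 R -> S2 R) x y : continuous k ->
  (forall a b z w, 0 <= a <= 1 -> 0 <= b <= 1 -> k (a, z) = k (b, w) ->
     a = b /\ (0 < a -> z = w)) ->
  open (k @` [set p | 0 <= p.1 < 1]) ->
  (k @` [set p | 0 <= p.1 < 1]) x -> ~ (k @` [set p | 0 <= p.1 <= 1]) y ->
  ~ exists c, freely_homotopic [set x; y] (fun z => k (1, z)) (fun=> c).
Proof.
move=> ck ik ok xin yout [c /freely_homotopicP[H [cH HP H0 H1]]].
pose D := [set p : R * S1 R | 0 <= p.1 <= 1].
have DE : D = `[0, 1]%classic `*` setT.
  by apply/seteqP; split=> [[a z] /= ?|[a z] [/= + _]]; rewrite ?in_itv //; split=> //=; rewrite in_itv.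
have cD : compact D.
  by rewrite DE; apply: compact_setX; [exact: segment_compact|exact: S1_compact].
pose cf w := if pselect ((k @` D) w) is left _ then
  let p := xget (0, E 0) [set p | D p /\ k p = w] in H (1 - p.1, p.2) else w.
have cf_in p : D p -> cf (k p) = H (1 - p.1, p.2).
  move=> Dp; rewrite /cf; case: pselect => [_|[]]; last by exists p.
  case: xgetP => [[a z] _ [/= Daz]|/(_ p)]; last by case.
  case: p Dp => b w /= Dp kk; have [ab] := ik a b z w Daz Dp kk.
  move=> zw; have [b0|b0] := eqVneq a 0; first by rewrite -ab b0 /= subr0 !H1.
  rewrite zw ?ab // -ab lt_neqAle eq_sym b0.
  by case/andP: Daz.
have cf_out w : ~ (k @` D) w -> cf w = w by rewrite /cf; case: pselect.
have cA : closed (k @` D).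
  apply: compact_closed; first exact: S2_hausdorff.
  by apply: continuous_compact => //; exact: continuous_subspaceT.
have D0D : k @` [set p | 0 <= p.1 < 1] `<=` k @` D.
  by move=> _ [p /andP[p0 /ltW p1] <-]; exists p => //; rewrite /D /= p0.
apply: (@no_sphere_retraction cf x y).
- apply: (@closed_glue _ _ (k @` D) (~` (k @` [set p | 0 <= p.1 < 1])) cf id) => //.
  + exact: open_closedC.
  + apply/seteqP; split=> // w _; have [?|?] := pselect ((k @` D) w); [by left|right].
    by move/D0D.
  + apply: (compact_quotient (p := k) (K := D)) => //.
    * exact: S2_hausdorff.
    * exact: continuous_subspaceT.
    * apply: (@subspace_eq_continuous _ D _ (fun p => H (1 - p.1, p.2))).
        by move=> p; rewrite inE => Dp; exact: esym (cf_in p Dp).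
      by apply: continuous_subspaceT; apply: (ct_comp cH); ct.
  + by apply: continuous_subspaceT => w; exact: cvg_id.
  + move=> w nw; have [[[a z] /= Da kw]|/cf_out //] := pselect ((k @` D) w).
    have a1 : a = 1.
      apply: contrapT => a1; apply: nw; exists (a, z) => //=.
      move: Da; rewrite /D /= => /andP[-> /=]; rewrite le_eqVlt => /orP[/eqP //|//].
    by rewrite -kw cf_in // a1 /= subrr H0.
- move=> w; have [[p Dp <-]|nw] := pselect ((k @` D) w).
    by rewrite cf_in // => e; apply: (HP (1 - p.1, p.2)); left.
  by rewrite cf_out // => wx; apply: nw; rewrite wx; exact: D0D.
- move=> w; have [[p Dp <-]|nw] := pselect ((k @` D) w).
    by rewrite cf_in // => e; case: (HP (1 - p.1, p.2)); right.
  by rewrite cf_out.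
- have : nbhs y (~` (k @` D)) by apply: open_nbhs_nbhs; split=> //; exact: closed_openC.
  by apply: filterS => w /cf_out.
Qed.

End Sphere.

(** * The pillow *)

Section Pillow.
Variable R : realType.

(** The group generated by the translations by even integer vectors and the
    half-turn about the origin. *)
Definition even_shift (x y : R * R) : Prop := exists m n : int,
  y = (x.1 + 2 * m%:~R, x.2 + 2 * n%:~R) \/
  y = (- x.1 + 2 * m%:~R, - x.2 + 2 * n%:~R).

(** The quotient of the plane by that group is a sphere, the pillowcase. *)
Definition pillow (F : R * R -> S2 R) : Prop :=
  [/\ continuous F, forall w, exists x, F x = w
    & forall x y, F x = F y <-> even_shift x y].

Definition integral_point (x : R * R) : Prop :=
  exists m n : int, x = (m%:~R, n%:~R).

Lemma int_lt1 (k : int) : -1 < (k%:~R : R) -> (k%:~R : R) < 1 -> k = 0.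
Proof.
by rewrite (_ : -1 = (-1)%:~R) // ltr_int (_ : 1 = 1%:~R) // ltr_int; lia.
Qed.

Variable F : R * R -> S2 R.
Hypothesis pF : pillow F.

Lemma pillow_continuous : continuous F. Proof. by case: pF. Qed.

Lemma pillowP x y : F x = F y <-> even_shift x y. Proof. by case: pF. Qed.

Lemma pillow_shift x (m n : int) : F (x.1 + 2 * m%:~R, x.2 + 2 * n%:~R) = F x.
Proof. by apply/esym/pillowP; exists m, n; left. Qed.

Lemma pillow_rot x : F (- x.1, - x.2) = F x.
Proof. by apply/esym/pillowP; exists 0, 0; right; rewrite mulr0 !addr0. Qed.

Lemma mod2 (a : R) : exists2 m : int, 0 <= a + 2 * m%:~R <= 2 & True.
Proof.
exists (- Num.floor (a / 2)) => //.
have := ge_floor (a / 2); have := lt_succ_floor (a / 2).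
by rewrite intrD mulrNz; lra.
Qed.

Lemma pillow_open : open_map F.
Proof.
have [cF sF _] := pF.
apply: (@saturated_open_map _ _ _ ((`[0, 2]%classic : set R) `*` (`[0, 2]%classic : set R))).
- exact: S2_hausdorff.
- exact: cF.
- by apply: compact_setX; exact: segment_compact.
- apply/seteqP; split=> // w _; have [x <-] := sF w.
  have [m m2 _] := mod2 x.1; have [n n2 _] := mod2 x.2.
  exists (x.1 + 2 * m%:~R, x.2 + 2 * n%:~R); last exact: pillow_shift.
  by split; rewrite /= in_itv.
move=> U oU.
have -> : F @^-1` (F @` U) = \bigcup_(p in [set: int * int])
    ((fun x => (x.1 + 2 * p.1%:~R, x.2 + 2 * p.2%:~R)) @^-1` U `|`
     (fun x => (- x.1 + 2 * p.1%:~R, - x.2 + 2 * p.2%:~R)) @^-1` U).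
  apply/seteqP; split=> [x [y Uy] /= /esym/pillowP [m [n]]|x [[m n] _ [/= Ux|/= Ux]]].
  - by case=> yE; exists (m, n) => //=; rewrite -yE; [left|right].
  - by exists (x.1 + 2 * m%:~R, x.2 + 2 * n%:~R) => //; exact: pillow_shift.
  - exists (- x.1 + 2 * m%:~R, - x.2 + 2 * n%:~R) => //.
    by rewrite (pillow_shift (- x.1, - x.2)) pillow_rot.
apply: bigcup_open => -[m n] _; apply: openU.
  by apply: open_comp => // x _; apply: (_ : continuous _); ct.
by apply: open_comp => // x _; apply: (_ : continuous _); ct.
Qed.

Lemma pair_ball (X Y : R * R) e : ball X e Y <-> `|X.1 - Y.1| < e /\ `|X.2 - Y.2| < e.
Proof.
have bE (a b : R) : ball a e b <-> `|a - b| < e by rewrite -ball_normE.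
by split=> -[h1 h2]; split; apply/bE.
Qed.

Lemma pillow_deck : isometric_deck F.
Proof.
move=> X X' /pillowP [m [n [->|->]]].
- exists (fun x => (x.1 + 2 * m%:~R, x.2 + 2 * n%:~R)); split=> //.
  + by move=> [a b] [a' b'] [/= /addIr -> /addIr ->].
  + by move=> Z; exact: pillow_shift.
  + move=> Z Z' e /pair_ball[b1 b2]; apply/pair_ball => /=.
    by split; rewrite opprD addrACA subrr addr0.
- exists (fun x => (- x.1 + 2 * m%:~R, - x.2 + 2 * n%:~R)); split=> //.
  + by move=> [a b] [a' b'] [/= /addIr/oppr_inj -> /addIr/oppr_inj ->].
  + by move=> Z; rewrite (pillow_shift (- Z.1, - Z.2)) pillow_rot.
  + move=> Z Z' e /pair_ball[b1 b2]; apply/pair_ball => /=.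
    by split; rewrite opprD addrACA subrr addr0 -opprD normrN.
Qed.

(** Close points are only identified by half-turns, whose centers are the
    integral points. *)
Lemma pillow_eq_near (x y z : R * R) (e : R) : e <= 2^-1 ->
  ball x e y -> ball x e z -> F y = F z ->
  y = z \/ exists2 v, integral_point v & ball x e v.
Proof.
move=> e1 /pair_ball[y1 y2] /pair_ball[z1 z2] /pillowP [m [n [zE|zE]]].
  left; have {}zE : z.1 = y.1 + 2 * m%:~R /\ z.2 = y.2 + 2 * n%:~R by rewrite zE.
  case: zE y1 y2 z1 z2 => e2 e3; rewrite !ltr_norml => /andP[? ?] /andP[? ?] /andP[? ?] /andP[? ?].
  have m0 : m = 0 by apply: int_lt1; lra.
  have n0 : n = 0 by apply: int_lt1; lra.
  by rewrite [y]surjective_pairing [z]surjective_pairing e2 e3 m0 n0 !mulr0 !addr0.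
right; exists (m%:~R, n%:~R); first by exists m, n.
have {}zE : z.1 = - y.1 + 2 * m%:~R /\ z.2 = - y.2 + 2 * n%:~R by rewrite zE.
apply/pair_ball; case: zE y1 y2 z1 z2 => e2 e3 /=; rewrite !ltr_norml.
by move=> /andP[? ?] /andP[? ?] /andP[? ?] /andP[? ?]; split; apply/andP; split; lra.
Qed.

Lemma pillow_locally_injective x : ~ integral_point x -> locally_injective_at F x.
Proof.
move=> xI.
have dist (a : R) : exists2 e, 0 < e & forall m : int, `|a - m%:~R| < e -> a = m%:~R.
  have [[m ->]|na] := pselect (exists m : int, a = m%:~R).
    exists 1 => // n; rewrite -intrB -intr_norm -[X in _ < X]/(1%:~R) ltr_int => mn.
    by congr (_%:~R); lia.
  pose m := Num.floor a.
  have am : m%:~R <= a < m%:~R + 1.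
    by have := ge_floor a; have := lt_succ_floor a; rewrite intrD -/m => -> ->.
  have am' : m%:~R < a.
    by rewrite lt_neqAle (andP am).1 andbT; apply/eqP => e; apply: na; exists m.
  exists (Num.min (a - m%:~R) (m%:~R + 1 - a)); first by rewrite lt_min; lra.
  move=> n; rewrite lt_min => /andP[]; rewrite !ltr_norml => /andP[h1 h2] /andP[h3 h4].
  have nm : -1 < ((n - m)%:~R : R) by rewrite intrB; lra.
  have mn : ((n - m)%:~R : R) < 1 by rewrite intrB; lra.
  by have := int_lt1 nm mn; move=> /eqP; rewrite subr_eq0 => /eqP nE; move: h1 h2; rewrite nE; lra.
have [e1 e10 h1] := dist x.1; have [e2 e20 h2] := dist x.2.
pose e := Num.min 2^-1 (Num.min e1 e2).
exists e; first by rewrite !lt_min invr_gt0 ltr0n e10 e20.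
move=> Z Z' b b' ZZ'.
have [|//|[_ [m [n ->]] /pair_ball /= [m1 n1]]] := pillow_eq_near _ b b' ZZ'.
  by rewrite ge_min lexx.
case: xI; exists m, n.
rewrite -(h1 m) ?(lt_le_trans m1) ?ge_min ?lexx ?orbT //.
by rewrite -(h2 n) ?(lt_le_trans n1) ?ge_min ?lexx ?orbT //; case: (x).
Qed.

(** ** Horizontal curves *)

(** The horizontal circle at height s of the pillowcase, for 0 < s < 1; at the
    heights 0 and 1 it is folded onto an arc. *)
Definition kap (p : R * S1 R) : S2 R := F (arg p.2 / pi, p.1).

Lemma E_pi_eq (a a' : R) : E (pi * a) = E (pi * a') <-> exists m : int, a' = a + 2 * m%:~R.
Proof.
have p0 : (pi : R) != 0 by rewrite gt_eqF ?pi_gt0.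
split=> [/E_eq [k kE]|[m ->]]; last by apply/E_eq; exists m; ring.
by exists k; apply: (mulfI p0); rewrite kE; ring.
Qed.

Lemma kapE s a : kap (s, E (pi * a)) = F (a, s).
Proof.
have p0 : (pi : R) != 0 by rewrite gt_eqF ?pi_gt0.
have /E_pi_eq[m am] : E (pi * (arg (E (pi * a)) / pi)) = E (pi * a).
  by rewrite mulrC divfK // argK.
by rewrite /kap /=; apply/pillowP; exists m, 0; left; rewrite /= {1}am mulr0 addr0.
Qed.

Lemma Epi_surj (z : S1 R) : exists a, E (pi * a) = z.
Proof.
exists (arg z / pi); rewrite mulrC divfK ?argK //.
by rewrite gt_eqF ?pi_gt0.
Qed.

Lemma kap_continuous : continuous kap.
Proof.
apply: E_factor2.
have p0 : (pi : R) != 0 by rewrite gt_eqF ?pi_gt0.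
rewrite (_ : (fun _ => _) = (fun x : R * R => F (x.2 / pi, x.1))).
  by apply: (ct_comp pillow_continuous); ct.
by apply/funext => -[s t] /=; rewrite -kapE mulrC divfK.
Qed.

(** The absolute value of the height, modulo 2, is an invariant of the group. *)
Lemma kap_height s s' z z' : 0 <= s <= 1 -> 0 <= s' <= 1 ->
  kap (s, z) = kap (s', z') -> s = s'.
Proof.
have [a <-] := Epi_surj z; have [a' <-] := Epi_surj z'.
rewrite !kapE => s01 s'01 /pillowP [m [n [[_ e]|[_ e]]]].
  have n0 : n = 0 by apply: int_lt1; lra.
  by rewrite e n0 mulr0 addr0.
have [s0|s0] := eqVneq s 0.
  have n0 : n = 0 by apply: int_lt1; lra.
  by move: e; rewrite n0 s0; lra.
have [n1|n1] := eqVneq n 1; first by move: e; rewrite n1; lra.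
have n0 : n = 0.
  have h1 : (-1 : R) < n%:~R by lra.
  have h2 : (n%:~R : R) <= 1 by lra.
  move: h1 h2 n1; rewrite -[X in X < _]/((-1)%:~R) -[X in _ <= X]/(1%:~R) ltr_int ler_int; lia.
by move: e; rewrite n0; lra.
Qed.

Lemma kap_inj s s' z z' : 0 <= s < 1 -> 0 <= s' < 1 ->
  kap (s, z) = kap (s', z') -> s = s' /\ (0 < s -> z = z').
Proof.
move=> s01 s'01 e; split.
  by apply: kap_height e; lra.
move: e; have [a <-] := Epi_surj z; have [a' <-] := Epi_surj z'.
rewrite !kapE => /pillowP [m [n [[e1 e2]|[_ e]]]] s0.
  by apply/E_pi_eq; exists m.
have n0 : n = 0 by apply: int_lt1; lra.
by exfalso; move: e; rewrite n0; lra.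
Qed.

Lemma kap0_conj z : kap (0, conjS z) = kap (0, z).
Proof.
have [a <-] := Epi_surj z; rewrite conjSE -mulrN !kapE.
by rewrite -[RHS]pillow_rot oppr0.
Qed.

Lemma kap0_eq z w : kap (0, z) = kap (0, w) -> w = z \/ w = conjS z.
Proof.
have [a <-] := Epi_surj z; have [a' <-] := Epi_surj w.
rewrite !kapE conjSE -mulrN => /pillowP [m [n [[e _]|[e _]]]]; [left|right];
  by apply/esym/E_pi_eq; exists m.
Qed.

Lemma kap_disk_image b : kap @` [set p | 0 <= p.1 < b] = F @` [set x | `|x.2| < b].
Proof.
apply/seteqP; split=> [_ [[s z] /= /andP[s0 sb] <-]|_ [[a s] /= sb <-]].
  have [a <-] := Epi_surj z; exists (a, s); last by rewrite kapE.
  by rewrite /= ger0_norm.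
have [s0|s0] := leP 0 s.
  exists (s, E (pi * a)); last by rewrite kapE.
  by rewrite /= s0 -(ger0_norm s0).
exists (- s, E (pi * - a)); last by rewrite kapE -[RHS]pillow_rot.
by rewrite /= oppr_ge0 ltW //= -(ltr0_norm s0).
Qed.

(** Horizontal curves with no puncture below them contract: they slide down to
    the fold at height 0, which is an arc. *)
Lemma horizontal_null (P : set (S2 R)) b : 0 <= b ->
  (forall s z, 0 <= s <= b -> ~ P (kap (s, z))) ->
  exists c, freely_homotopic P (fun z => kap (b, z)) (fun=> c).
Proof.
move=> b0 nP; exists (kap (0, dir (1, 0))).
pose H1 (x : R * S1 R) := kap ((1 - x.1) * b, x.2).
pose X (x : R * S1 R) := (1 - clamp x.1) * zx x.2 + clamp x.1.
pose H2 (x : R * S1 R) := kap (0, dir (X x, Num.sqrt (1 - X x ^+ 2))).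
have ck := kap_continuous.
have X1 x : -1 <= X x <= 1.
  have := clamp01 x.1; have := zx_bound x.2; rewrite /X; set c := clamp _; set u := zx _ => u1 c01.
  by nra.
have X2 x : X x ^+ 2 + Num.sqrt (1 - X x ^+ 2) ^+ 2 = 1.
  have h : 0 <= 1 - X x ^+ 2.
    by rewrite subr_ge0 -real_normK ?num_real // expr_le1 // ler_norml.
  by rewrite (sqr_sqrtr h) addrCA subrr addr0.
apply: (@fh_trans R _ P (fun z => kap (0, z))).
  have c1 : continuous H1 by apply: (ct_comp ck); ct.
  apply: (fh_of c1) => [t z t01|z|z]; rewrite /H1 /= ?subr0 ?mul1r ?subrr ?mul0r //.
  apply: nP; apply/andP; split; first by rewrite mulr_ge0 //; lra.
  by rewrite ler_piMl //; lra.
have c2 : continuous H2.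
  apply: (ct_comp ck); apply: ct_pair; first exact: ct_cst.
  apply: ct_dir; last by rewrite /X /clamp; ct.
  by move=> x; apply/eqP => -[x0 y0]; have := X2 x; rewrite y0 x0 expr0n addr0 => /eqP; rewrite eq_sym oner_eq0.
have c0 : clamp 0 = 0 :> R by rewrite clamp_id // lexx ler01.
have c1' : clamp 1 = 1 :> R by rewrite clamp_id // lexx ler01.
apply: (fh_of c2) => [t z _|z|z]; first by apply: nP; rewrite lexx.
  rewrite /H2 /X /= c0 subr0 mul1r addr0.
  have zP := zxyP z; have -> : 1 - zx z ^+ 2 = zy z ^+ 2 by rewrite -[X in X - _]zP addrAC subrr add0r.
  rewrite sqrtr_sqr; have [y0|y0] := leP 0 (zy z); first by rewrite ?ger0_norm ?dir_zxy.
  by rewrite ?(ltr0_norm y0) -/(conjS z) kap0_conj.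
by rewrite /H2 /X /= c1' subrr mul0r add0r expr1n subrr sqrtr0.
Qed.

(** Such a curve bounds the disk below it, which contains x and not y. *)
Lemma horizontal_essential b x y s s' z z' : 0 < b < 1 ->
  0 <= s < b -> b < s' <= 1 -> x = kap (s, z) -> y = kap (s', z') ->
  ~ exists c, freely_homotopic [set x; y] (fun z => kap (b, z)) (fun=> c).
Proof.
move=> b01 sb s'b -> ->; have ck := kap_continuous.
have := @disk_boundary_essential R (fun p => kap (b * p.1, p.2)) (kap (s, z)) (kap (s', z')).
rewrite /= mulr1; apply.
- by apply: (ct_comp ck); ct.
- move=> u v w w' u01 v01 /kap_inj [||uv zz].
  + by apply/andP; split; nra.
  + by apply/andP; split; nra.
  + have uv' : u = v by apply: (mulfI (lt0r_neq0 (andP b01).1)).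
    by split=> // u0; apply: zz; rewrite mulr_gt0 //; lra.
- rewrite (_ : _ @` _ = kap @` [set p | 0 <= p.1 < b]).
    rewrite kap_disk_image; apply: pillow_open.
    have : continuous (fun x : R * R => `|x.2|) by ct.
    by move/continuousP/(_ [set t | t < b]); apply; exact: open_lt.
  apply/seteqP; split=> [_ [[u w] /= u01 <-]|_ [[u w] /= u01 <-]].
    by exists (b * u, w) => //=; apply/andP; split; nra.
  exists (u / b, w) => /=; last by rewrite mulrC divfK //; lra.
  by rewrite divr_ge0 /= ?ltr_pdivrMr; lra.
- exists (s / b, z) => /=; last by rewrite mulrC divfK //; lra.
  by rewrite divr_ge0 /= ?ltr_pdivrMr; lra.
- move=> [[u w] /= u01 /kap_height e].
  have : b * u = s' by apply: e; [apply/andP; split; nra|lra].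
  nra.
Qed.

End Pillow.

(** Turning the pillow upside down exchanges the two folds. *)
Lemma pillow_flip (R : realType) (F : R * R -> S2 R) :
  pillow F -> pillow (fun x => F (x.1, 1 - x.2)).
Proof.
move=> [cF sF FP]; split.
- by apply: (ct_comp cF); ct.
- by move=> w; have [[a b] ab] := sF w; exists (a, 1 - b); rewrite /= opprB addrC subrK.
- move=> x [y1 y2]; rewrite FP; split=> -[m [n]] [[e1 e2]|[e1 e2]] /=.
  + by exists m, (- n); left; congr pair; [exact: e1|move: e2; rewrite /= mulrNz; lra].
  + by exists m, (1 - n); right; congr pair; [exact: e1|move: e2; rewrite /= intrB; lra].
  + by exists m, (- n); left; rewrite e1 e2 /=; congr pair; rewrite mulrNz; lra.
  + by exists m, (1 - n); right; rewrite e1 e2 /=; congr pair; rewrite intrB; lra.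
Qed.

(** ** Elliptic coordinates around the fold *)

Section Elliptic.
Variable R : realType.
Variable h : R.
Hypothesis h0 : 0 < h.

(** The part of the pillow of height less than h is a folded half-open
    cylinder.  Confocal ellipses identify it with the plane: the fold at height
    0 goes to the segment between the foci, and the horizontal circle at height
    s to the ellipse with half-axes eA s and eB s. *)
Definition eB (s : R) := s / (h - `|s|).
Definition eA (s : R) := Num.sqrt (1 + eB s ^+ 2).
Definition ell (p : R * S1 R) : plane R := vec (eA p.1 * zx p.2) (eB p.1 * zy p.2).

Lemma eA_sqr s : eA s ^+ 2 = 1 + eB s ^+ 2.
Proof. by rewrite sqr_sqrtr // addr_ge0 ?sqr_ge0. Qed.

Lemma eA_ge1 s : 1 <= eA s.
Proof. by rewrite -[leLHS]sqrtr1 ler_sqrt ?lerDl ?sqr_ge0 // addr_ge0 ?sqr_ge0. Qed.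

Lemma eB_ge0 s : 0 <= s < h -> 0 <= eB s.
Proof. by move=> /andP[s0 sh]; rewrite divr_ge0 // subr_ge0 ger0_norm // ltW. Qed.

Lemma eB0 : eB 0 = 0. Proof. by rewrite /eB mul0r. Qed.

Lemma eBK s : 0 <= s < h -> h * eB s / (1 + eB s) = s.
Proof.
move=> /andP[s0 sh]; rewrite /eB ger0_norm //; field.
by rewrite !gt_eqF //; lra.
Qed.

Lemma eB_of (b : R) : 0 <= b -> exists2 s, 0 <= s < h & eB s = b.
Proof.
move=> b0; have b1 : 0 < 1 + b by lra.
have s0 : 0 <= h * b / (1 + b) by apply: divr_ge0; [apply: mulr_ge0 => //; exact: ltW|exact: ltW].
exists (h * b / (1 + b)).
  by rewrite s0 ltr_pdivrMr // ltr_pM2l //; lra.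
rewrite /eB ger0_norm //; field.
by rewrite gt_eqF //= gt_eqF // -mulrBr mulr_gt0 //; lra.
Qed.

Lemma eB_mono s s' : 0 <= s -> s < s' -> s' < h -> eB s < eB s'.
Proof.
move=> s0 ss' s'h; rewrite /eB !ger0_norm ?ltr_pdivrMr; try lra.
rewrite mulrAC ltr_pdivlMr; try lra.
nra.
Qed.

Lemma eA_mono s s' : 0 <= s -> s < s' -> s' < h -> eA s < eA s'.
Proof.
move=> s0 ss' s'h; have := eB_mono s0 ss' s'h; have := @eB_ge0 s.
rewrite s0 (lt_trans ss') // => /(_ isT) b0 bb'.
rewrite /eA ltr_sqrt; last by rewrite ltr_pwDl ?sqr_ge0.
by rewrite ltrD2l ltr_pXn2r // nnegrE // (le_trans b0) // ltW.
Qed.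

(** The half-axis is half the sum of the distances to the foci. *)
Lemma ell_surj v : exists s z, 0 <= s < h /\ ell (s, z) = v.
Proof.
set X := v ord0 ord0; set Y := v ord0 ord_max.
pose d1 := Num.sqrt ((X - 1) ^+ 2 + Y ^+ 2).
pose d2 := Num.sqrt ((X + 1) ^+ 2 + Y ^+ 2).
have d1q : d1 ^+ 2 = (X - 1) ^+ 2 + Y ^+ 2 by rewrite sqr_sqrtr // addr_ge0 ?sqr_ge0.
have d2q : d2 ^+ 2 = (X + 1) ^+ 2 + Y ^+ 2 by rewrite sqr_sqrtr // addr_ge0 ?sqr_ge0.
have n1 : `|X - 1| <= d1 by rewrite -sqrtr_sqr ler_sqrt ?lerDl ?sqr_ge0 // addr_ge0 ?sqr_ge0.
have n2 : `|X + 1| <= d2 by rewrite -sqrtr_sqr ler_sqrt ?lerDl ?sqr_ge0 // addr_ge0 ?sqr_ge0.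
move: n1 n2; rewrite !ler_norml => /andP[n1 n1'] /andP[n2 n2'].
pose A := (d1 + d2) / 2; pose C := (d2 - d1) / 2.
have AC : A * C = X by rewrite /A /C; nra.
have A1 : 1 <= A by rewrite /A; lra.
have C1 : C <= 1 by rewrite /C; nra.
have C2 : -1 <= C by rewrite /C; nra.
have YY : (A ^+ 2 - 1) * (1 - C ^+ 2) = Y ^+ 2.
  have -> : (A ^+ 2 - 1) * (1 - C ^+ 2) = A ^+ 2 + C ^+ 2 - (A * C) ^+ 2 - 1 by ring.
  rewrite AC; have -> : A ^+ 2 + C ^+ 2 = (d1 ^+ 2 + d2 ^+ 2) / 2 by rewrite /A /C; field.
  by rewrite d1q d2q; field.
have A20 : 0 <= A ^+ 2 - 1 by nra.
have C20 : 0 <= 1 - C ^+ 2 by nra.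
have [s sh sB] := eB_of (sqrtr_ge0 (A ^+ 2 - 1)).
have sA : eA s = A.
  by rewrite /eA sB sqr_sqrtr // addrC subrK sqrtr_sqr ger0_norm //; lra.
pose S := (if 0 <= Y then 1 else -1) * Num.sqrt (1 - C ^+ 2).
have SS : C ^+ 2 + S ^+ 2 = 1.
  have -> : S ^+ 2 = 1 - C ^+ 2.
    by rewrite [LHS]exprMn sqr_sqrtr //; case: ifP => _; ring.
  by rewrite addrC subrK.
have BS : Num.sqrt (A ^+ 2 - 1) * S = Y.
  rewrite /S mulrCA -sqrtrM // YY sqrtr_sqr.
  by have [y0|y0] := leP 0 Y; [rewrite mul1r ger0_norm|rewrite mulN1r ltr0_norm ?opprK].
exists s, (dir (C, S)); split=> //.
by apply: plane_eq; rewrite ?vec0 ?vec1 /= ?zx_dir ?zy_dir //= ?sA ?sB.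
Qed.

(** A point of an ellipse is determined by its distances A + x and A - x to the
    foci, up to the sign of its second coordinate. *)
Lemma ell_inj s s' z z' : 0 <= s < h -> 0 <= s' < h ->
  ell (s, z) = ell (s', z') ->
  s = s' /\ (z' = z \/ (s = 0 /\ z' = conjS z)).
Proof.
move=> sh s'h e.
have eX : eA s * zx z = eA s' * zx z' by have := congr1 (fun v : plane R => v ord0 ord0) e; rewrite !vec0.
have eY : eB s * zy z = eB s' * zy z' by have := congr1 (fun v : plane R => v ord0 ord_max) e; rewrite !vec1.
have {e} zP := zxyP z; have zP' := zxyP z'.
have A2 := eA_sqr s; have A2' := eA_sqr s'.
have A1 := eA_ge1 s; have A1' := eA_ge1 s'.
have B0 := eB_ge0 sh; have B0' := eB_ge0 s'h.
have /andP[x1 x2] := zx_bound z; have /andP[x1' x2'] := zx_bound z'.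
have foc (A B a b c : R) : a ^+ 2 + b ^+ 2 = 1 -> A ^+ 2 = 1 + B ^+ 2 -> c ^+ 2 = 1 ->
    (A * a + c) ^+ 2 + (B * b) ^+ 2 = (A + c * a) ^+ 2.
  move=> ab AB cc; have -> : b ^+ 2 = 1 - a ^+ 2 -> (A * a + c) ^+ 2 + (B * b) ^+ 2 =
    A ^+ 2 * a ^+ 2 + 2 * A * a * c + c ^+ 2 + B ^+ 2 * (1 - a ^+ 2) by move=> bE; rewrite exprMn bE; ring.
    by rewrite AB cc sqrrD exprMn cc AB; ring.
  by rewrite -ab addrAC subrr add0r.
have f1 : (eA s + zx z) ^+ 2 = (eA s' + zx z') ^+ 2.
  by have := foc _ _ _ _ 1 zP A2 (expr1n _ _); have := foc _ _ _ _ 1 zP' A2' (expr1n _ _);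
     rewrite !mul1r eX eY => -> ->.
have f2 : (eA s - zx z) ^+ 2 = (eA s' - zx z') ^+ 2.
  have m1 : (-1 : R) ^+ 2 = 1 by rewrite sqrrN expr1n.
  by have := foc _ _ _ _ (-1) zP A2 m1; have := foc _ _ _ _ (-1) zP' A2' m1;
     rewrite !mulN1r eX eY => -> ->.
have g1 : eA s + zx z = eA s' + zx z'.
  by apply/eqP; rewrite -(@eqrXn2 _ 2) ?f1 //; lra.
have g2 : eA s - zx z = eA s' - zx z'.
  by apply/eqP; rewrite -(@eqrXn2 _ 2) ?f2 //; lra.
have AA : eA s = eA s' by lra.
have xx : zx z = zx z' by lra.
have BB : eB s = eB s'.
  apply/eqP; rewrite -(@eqrXn2 _ 2) //; apply/eqP.
  by move: A2; rewrite AA A2'; lra.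
have ss : s = s' by rewrite -(eBK sh) BB eBK.
split=> //.
have [s0|s0] := eqVneq s 0; last first.
  left; apply: S1_eq => //; apply/esym.
  have B1 : eB s != 0.
    by apply: contra s0 => /eqP b0; rewrite -(eBK sh) b0 mulr0 mul0r.
  by apply: (mulfI B1); rewrite eY BB.
have : zy z ^+ 2 = zy z' ^+ 2 by move: zP zP'; rewrite xx; lra.
move/eqP; rewrite eqf_sqr => /orP[/eqP yy|/eqP yy]; [left|right; split=> //].
  by apply: S1_eq.
by apply: S1_eq; rewrite ?zx_dir ?zy_dir //= ?sqrrN ?zxyP // yy opprK.
Qed.

Lemma ell_norm s z : 0 <= s < h ->
  eB s ^+ 2 <= ell (s, z) ord0 ord0 ^+ 2 + ell (s, z) ord0 ord_max ^+ 2.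
Proof.
move=> sh; rewrite vec0 vec1 /=; have := eA_sqr s; have := zxyP z.
set A := eA s; set B := eB s => zP AB.
have -> : (A * zx z) ^+ 2 + (B * zy z) ^+ 2 =
    A ^+ 2 * zx z ^+ 2 + B ^+ 2 * zy z ^+ 2 by ring.
rewrite AB; have -> : (1 + B ^+ 2) * zx z ^+ 2 + B ^+ 2 * zy z ^+ 2 =
    B ^+ 2 * (zx z ^+ 2 + zy z ^+ 2) + zx z ^+ 2 by ring.
by rewrite zP mulr1 lerDl sqr_ge0.
Qed.

(** Negative heights are included: there the cylinder is continued through the
    fold. *)
Lemma eB_continuous s : `|s| < h -> {for s, continuous eB}.
Proof.
move=> sh; apply: cvgM; first exact: cvg_id.
apply: cvgV; first by rewrite gt_eqF // subr_gt0.
apply: cvgB; first exact: cvg_cst.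
by apply: cvg_norm; exact: cvg_id.
Qed.

End Elliptic.

(** ** Peripheral horizontal curves *)

Section FoldChart.
Variables (R : realType) (F : R * R -> S2 R) (h : R).
Hypotheses (pF : pillow F) (h01 : 0 < h <= 1).

Let h0 : 0 < h. Proof. by case/andP: h01. Qed.
Let h1 s : 0 <= s < h -> 0 <= s < 1.
Proof. by move=> /andP[-> sh]; rewrite (lt_le_trans sh) //; case/andP: h01. Qed.

(** The inverse of elliptic coordinates, read on the sphere. *)
Definition fold_chart (v : plane R) : S2 R :=
  kap F (xget (0, E 0) [set p | 0 <= p.1 < h /\ ell h p = v]).

Lemma fold_chart_ell s z : 0 <= s < h -> fold_chart (ell h (s, z)) = kap F (s, z).
Proof.
move=> sh; rewrite /fold_chart; case: xgetP => [[s' z'] _ [/= s'h e]|/(_ (s, z))]; last by case.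
have [-> [->//|[s0 ->]]] := ell_inj s'h sh e.
by rewrite s0 in e *; rewrite (kap0_conj pF).
Qed.

Lemma fold_chart_inj : injective fold_chart.
Proof.
move=> v w; have [s [z [sh <-]]] := ell_surj h0 v; have [s' [z' [s'h <-]]] := ell_surj h0 w.
rewrite !fold_chart_ell // => e.
have [ss zz] := kap_inj pF (h1 sh) (h1 s'h) e.
have [s0|s0] := eqVneq s 0; last first.
  by rewrite -ss zz // lt_neqAle eq_sym s0; case/andP: sh.
move: e; rewrite -ss s0 => /(kap0_eq pF) [->//|->].
apply: plane_eq; rewrite ?vec0 ?vec1 /= ?zx_dir ?zy_dir //= ?sqrrN ?zxyP //.
by rewrite /eB !mul0r.
Qed.

Lemma ell_within (s1 : R) : s1 < h ->
  {within [set p : R * S1 R | 0 <= p.1 <= s1], continuous (ell h)}.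
Proof.
move=> s1h; set K := [set p : R * S1 R | _].
(* Truncating the denominator makes the formula continuous everywhere. *)
pose B (s : R) := s / Num.max (h - s1) (h - `|s|).
pose g (p : R * S1 R) := vec (Num.sqrt (1 + B p.1 ^+ 2) * zx p.2) (B p.1 * zy p.2).
apply: (@subspace_eq_continuous _ K _ g).
  move=> p; rewrite inE /K /= => /andP[p0 p1].
  have BE : B p.1 = eB h p.1.
    by rewrite /B /eB (max_idPr _) // ger0_norm //; lra.
  by rewrite /g /from_subspace BE.
apply: continuous_subspaceT.
have cB : continuous (fun p : R * S1 R => B p.1).
  rewrite /B; ct => p; rewrite gt_eqF // lt_max; apply/orP; left; lra.
by rewrite /g; ct.
Qed.

(** Near v it is the inverse of a continuous map on a compact annulus, followed by
    kap. *)
Lemma fold_chart_continuous : continuous fold_chart.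
Proof.
move=> v.
pose q (u : plane R) := u ord0 ord0 ^+ 2 + u ord0 ord_max ^+ 2.
have cq : continuous q by rewrite /q; ct.
pose b := Num.sqrt (q v + 1).
have qv : 0 <= q v by rewrite addr_ge0 ?sqr_ge0.
have [s1 s1h s1b] := eB_of h0 (sqrtr_ge0 (q v + 1)).
pose K := [set p : R * S1 R | 0 <= p.1 <= s1].
have KE : K = `[0, s1]%classic `*` setT.
  by apply/seteqP; split=> [[a z] /= ?|[a z] [/= + _]]; rewrite ?in_itv //; split=> //=; rewrite in_itv.
have cK : compact K.
  by rewrite KE; apply: compact_setX; [exact: segment_compact|exact: S1_compact].
have K1 p : K p -> 0 <= p.1 < h.
  by rewrite /K /= => /andP[-> /le_lt_trans]; apply; case/andP: s1h.
have cell : {within K, continuous (ell h)} by apply: ell_within; case/andP: s1h.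
have : {within ell h @` K, continuous fold_chart}.
  apply: compact_quotient => //.
  apply: (@subspace_eq_continuous _ K _ (kap F)).
    by move=> [s z]; rewrite inE => Kp; rewrite /from_subspace /= fold_chart_ell //; exact: (K1 _ Kp).
  by apply: continuous_subspaceT; exact: kap_continuous.
pose O := [set u | q u < q v + 1].
have oO : open O by have /continuousP/(_ [set t | t < q v + 1]) := cq; apply; exact: open_lt.
have OK : O `<=` ell h @` K.
  move=> u Ou; have [s [z [sh e]]] := ell_surj h0 u; exists (s, z) => //.
  rewrite /K /=; apply/andP; split; first by case/andP: sh.
  rewrite leNgt; apply/negP => s1s.
  have s10 : 0 <= s1 by case/andP: s1h.
  have := eB_mono s10 s1s (andP sh).2; rewrite s1b => bs.
  have := ell_norm z sh; rewrite e -/(q u).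
  have : q v + 1 < eB h s ^+ 2.
    rewrite -[ltLHS]sqr_sqrtr; last by lra.
    by rewrite ltr_pXn2r // nnegrE ?sqrtr_ge0 // eB_ge0.
  by move: Ou; rewrite /O /=; lra.
move=> /(continuous_subspaceW OK); rewrite continuous_open_subspace // => /(_ v).
by apply; rewrite inE /O /=; lra.
Qed.

(** The elliptic coordinates lift to a continuous map on a strip of the plane,
    and pillow maps are open. *)
Lemma fold_chart_open : open_map fold_chart.
Proof.
move=> U oU.
pose G (x : R * R) := vec (eA h x.2 * cos (pi * x.1)) (eB h x.2 * sin (pi * x.1)).
have GE x : `|x.2| < h -> fold_chart (G x) = F x.
  case: x => a s /= sh; have [s0|s0] := leP 0 s.
    have -> : G (a, s) = ell h (s, E (pi * a)) by rewrite /ell /= zxE zyE.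
    by rewrite fold_chart_ell ?kapE // s0 -(ger0_norm s0).
  have -> : G (a, s) = ell h (- s, E (pi * - a)).
    rewrite /ell /= zxE zyE mulrN cosN sinN /G /= /eA /eB normrN mulNr sqrrN.
    by rewrite mulrNN.
  rewrite fold_chart_ell ?kapE //; first by rewrite -[RHS]pillow_rot.
  by rewrite oppr_ge0 ltW //= -ltr0_norm.
have -> : fold_chart @` U = F @` [set x | `|x.2| < h /\ U (G x)].
  apply/seteqP; split=> [_ [v Uv <-]|_ [x [xh Ux] <-]]; last first.
    by exists (G x) => //; exact: GE.
  have [s [z [sh e]]] := ell_surj h0 v; have [a az] := Epi_surj z.
  have Ge : G (a, s) = v by rewrite -e -az /ell /= zxE zyE.
  have sh' : `|(a, s).2| < h by rewrite /= ger0_norm; case/andP: sh.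
  by exists (a, s); [split=> //; rewrite Ge|rewrite -(GE _ sh') Ge].
apply: (pillow_open pF); rewrite openE => x [xh Ux].
have cB : {for x, continuous (fun y : R * R => eB h y.2)}.
  by apply: (@continuous_comp _ _ _ snd (eB h)); [exact: cvg_snd|exact: eB_continuous].
have cA : {for x, continuous (fun y : R * R => eA h y.2)}.
  apply: (@continuous_comp _ _ _ (fun y : R * R => 1 + eB h y.2 ^+ 2) Num.sqrt); last exact: sqrt_continuous.
  by apply: cvgD; [exact: cvg_cst|apply: cvgM].
have cc : continuous (fun y : R * R => cos (pi * y.1)) by ct.
have cs : continuous (fun y : R * R => sin (pi * y.1)) by ct.
have cG : {for x, continuous G}.
  move=> A [P Px PA].
  have n0 : nbhs x [set y | P ord0 ord0 (G y ord0 ord0)].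
    have c : {for x, continuous (fun y : R * R => eA h y.2 * cos (pi * y.1))}.
      by apply: cvgM; [exact: cA|exact: cc].
    have := c (P ord0 ord0); rewrite -(vec0 (eA h x.2 * cos (pi * x.1)) (eB h x.2 * sin (pi * x.1))).
    move=> /(_ (Px _ _)) nP; change (nbhs x [set y : R * R | P ord0 ord0 (eA h y.2 * cos (pi * y.1))]) in nP.
    by move: nP; apply: filterS => y /=; rewrite vec0.
  have n1 : nbhs x [set y | P ord0 ord_max (G y ord0 ord_max)].
    have c : {for x, continuous (fun y : R * R => eB h y.2 * sin (pi * y.1))}.
      by apply: cvgM; [exact: cB|exact: cs].
    have := c (P ord0 ord_max); rewrite -(vec1 (eA h x.2 * cos (pi * x.1)) (eB h x.2 * sin (pi * x.1))).
    move=> /(_ (Px _ _)) nP; change (nbhs x [set y : R * R | P ord0 ord_max (eB h y.2 * sin (pi * y.1))]) in nP.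
    by move: nP; apply: filterS => y /=; rewrite vec1.
  change (nbhs x [set y | A (G y)]).
  apply: filterS (filterI n0 n1) => y [/= y0 y1]; apply: PA => i j.
  rewrite (ord1 i); case: (unliftP ord_max j) => [k ->|-> //].
  by rewrite (_ : lift _ _ = ord0) //; apply/val_inj; rewrite (ord1 k).
have nU : nbhs x [set y | U (G y)] by apply: cG; exact: open_nbhs_nbhs.
have nh : nbhs x [set y : R * R | `|y.2| < h].
  apply: open_nbhs_nbhs; split=> //.
  have : continuous (fun y : R * R => `|y.2|) by ct.
  by move/continuousP/(_ [set t | t < h]); apply; exact: open_lt.
exact: filterI nh nU.
Qed.

End FoldChart.

(** ** Small circles around a point *)

Section ChartCircles.
Variable R : realType.
Implicit Types (phi : plane R -> S2 R).

Lemma ct_scale (X : topologicalType) (f : X -> R) (g : X -> plane R) :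
  continuous f -> continuous g -> continuous (fun x => f x *: g x).
Proof.
move=> cf cg; apply: ct_row => i.
have -> : (fun x => (f x *: g x) ord0 i) = (fun x => f x * g x ord0 i).
  by apply/funext => x; rewrite mxE.
by ct.
Qed.

Lemma ct_val1 (X : topologicalType) (f : X -> S1 R) :
  continuous f -> continuous (fun x => \val (f x) : plane R).
Proof. by move=> cf; apply: (ct_comp _ cf); exact: (@initial_continuous (sphere R 1) _ set_val). Qed.

(** The circle shrinks to the center of the chart. *)
Lemma chart_circle_null (P : set (S2 R)) phi x : is_chart phi x ->
  (forall v, ~ P (phi v)) ->
  exists c, freely_homotopic P (fun z : S1 R => phi (\val z)) (fun=> c).
Proof.
move=> [cphi iphi ophi phi0] phiP; exists x.
have c : continuous (fun p : R * S1 R => phi ((1 - p.1) *: \val p.2)).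
  by apply: (ct_comp cphi); apply: ct_scale; [ct|apply: ct_val1; ct].
apply: (fh_of c) => [t z _|z|z] /=; first exact: phiP.
  by rewrite subr0 scale1r.
by rewrite subrr scale0r.
Qed.

(** The circle bounds a disk that contains x and not y. *)
Lemma chart_circle_essential phi x y : is_chart phi x -> ~ range phi y ->
  ~ exists c, freely_homotopic [set x; y] (fun z : S1 R => phi (\val z)) (fun=> c).
Proof.
move=> [cphi iphi ophi phi0] yphi.
pose k (p : R * S1 R) := phi (p.1 *: \val p.2).
have k1 : (fun z : S1 R => phi (\val z)) = (fun z : S1 R => k (1, z)).
  by apply: funext => z; rewrite /k /= scale1r.
rewrite k1; apply: disk_boundary_essential.
- by apply: (ct_comp cphi); apply: ct_scale; [ct|apply: ct_val1; ct].
- move=> a b z w a01 b01 /iphi /= e.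
  have e0 : a * zx z = b * zx w.
    by have := congr1 (fun v : plane R => v ord0 ord0) e; rewrite !mxE.
  have e1 : a * zy z = b * zy w.
    by have := congr1 (fun v : plane R => v ord0 ord_max) e; rewrite !mxE.
  have ab : a = b.
    apply/eqP; rewrite -(@eqrXn2 _ 2) //; [|lra|lra]; apply/eqP.
    rewrite -[LHS]mulr1 -[RHS]mulr1 -{1}(zxyP z) -(zxyP w) !mulrDr -!exprMn.
    by rewrite e0 e1.
  split=> // a0; apply: S1_eq; apply: (mulfI (lt0r_neq0 a0)).
    by rewrite e0 ab.
  by rewrite e1 ab.
- have -> : k @` [set p | 0 <= p.1 < 1] =
      phi @` [set v : plane R | v ord0 ord0 ^+ 2 + v ord0 ord_max ^+ 2 < 1].
    apply/seteqP; split=> [_ [[a z] /= a01 <-]|_ [v /= v1 <-]].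
      exists (a *: \val z) => //=; rewrite !mxE !exprMn -mulrDr.
      by rewrite -/(zx z) -/(zy z) zxyP mulr1; nra.
    pose r := len (v ord0 ord0, v ord0 ord_max).
    have r0 : 0 <= r := len_ge0 _.
    have rq : r ^+ 2 = v ord0 ord0 ^+ 2 + v ord0 ord_max ^+ 2 := len_sqr _.
    have r1 : r < 1 by rewrite -(ltr_pXn2r (ltn0Sn 1)) ?nnegrE // expr1n rq.
    exists (r, dir (v ord0 ord0, v ord0 ord_max)) => /=; first by rewrite r0.
    have [v0|v0] := eqVneq (v ord0 ord0, v ord0 ord_max) 0.
      have rz : r = 0 by apply/eqP; rewrite len_eq0 v0.
      case: v0 => v00 v01; rewrite rz /k /= scale0r; congr phi.
      by apply: plane_eq; rewrite mxE ?v00 ?v01.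
    have rn : r != 0 by rewrite len_eq0.
    congr phi; apply: plane_eq; rewrite mxE -?/(zx _) -?/(zy _) /=.
      by rewrite zx_dir_gen // mulrC divfK.
    by rewrite zy_dir_gen // mulrC divfK.
  apply: ophi; have : continuous (fun v : plane R => v ord0 ord0 ^+ 2 + v ord0 ord_max ^+ 2) by ct.
  by move/continuousP/(_ [set t | t < 1]); apply; exact: open_lt.
- exists (0, E 0) => /=; first by rewrite lexx ltr01.
  by rewrite /k /= scale0r.
- by move=> [p _ py]; apply: yphi; exists (p.1 *: \val p.2).
Qed.

(** The plane is mapped onto a small ball, so that a chart can be shrunk into
    any neighborhood. *)
Definition shrink (v0 : plane R) (e : R) (v : plane R) : plane R :=
  v0 + (e / (1 + `|v|)) *: v.

Lemma shrink_den (v : plane R) : 0 < 1 + `|v|.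
Proof. by rewrite ltr_pwDl. Qed.

Lemma shrink_norm v0 e v : 0 < e -> `|shrink v0 e v - v0| = e * `|v| / (1 + `|v|).
Proof.
move=> e0.
have -> : shrink v0 e v - v0 = (e / (1 + `|v|)) *: v.
  by rewrite /shrink [v0 + _]addrC addrK.
have d0 : 0 <= e / (1 + `|v|) by apply: divr_ge0; apply: ltW => //; exact: shrink_den.
by rewrite normrZ (ger0_norm d0) mulrAC.
Qed.

Lemma shrink_ball v0 e v : 0 < e -> `|shrink v0 e v - v0| < e.
Proof.
move=> e0; rewrite shrink_norm // ltr_pdivrMr ?shrink_den //.
by rewrite ltr_pM2l // ltrDr.
Qed.

Lemma shrinkK v0 e v : 0 < e ->
  (e - `|shrink v0 e v - v0|)^-1 *: (shrink v0 e v - v0) = v.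
Proof.
move=> e0; rewrite shrink_norm // /shrink [v0 + _]addrC addrK scalerA.
rewrite [X in X *: _](_ : _ = 1) ?scale1r //.
have := shrink_den v; move: `|v| => n n0; field.
by rewrite !gt_eqF // -mulrBr; lra.
Qed.

Lemma shrinkK' v0 e u : 0 < e -> `|u - v0| < e ->
  shrink v0 e ((e - `|u - v0|)^-1 *: (u - v0)) = u.
Proof.
move=> e0 ue; rewrite /shrink normrZ; set n := `|u - v0|.
rewrite ger0_norm; last by rewrite invr_ge0 subr_ge0 ltW.
have n0 : e - n != 0 by rewrite gt_eqF // subr_gt0.
rewrite scalerA [X in X *: _](_ : _ = 1); first by rewrite scale1r addrC subrK.
have e1 : e != 0 by rewrite gt_eqF.
by field; rewrite n0 /= subrK e1.
Qed.

Lemma shrink_continuous v0 e : continuous (shrink v0 e).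
Proof.
have cinv : continuous (fun v : plane R => (1 + `|v|)^-1).
  apply: ct_inv => [v|]; first by rewrite gt_eqF // shrink_den.
  by apply: ct_add; [ct|exact: norm_continuous].
apply: ct_row => i.
have -> : (fun v => shrink v0 e v ord0 i) =
          (fun v => v0 ord0 i + e * (1 + `|v|)^-1 * v ord0 i).
  by apply: funext => v; rewrite !mxE.
by ct.
Qed.

Lemma shrink_open v0 e : 0 < e -> open_map (shrink v0 e).
Proof.
move=> e0 U oU.
pose k u := (e - `|u - v0|)^-1 *: (u - v0).
have -> : shrink v0 e @` U = [set u | `|u - v0| < e /\ U (k u)].
  apply/seteqP; split=> [_ [v Uv <-]|u [ue Uu]].
    by split; [exact: shrink_ball|rewrite /k shrinkK].
  by exists (k u) => //; exact: shrinkK'.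
rewrite openE => u [ue Uu].
have cd : continuous (fun w : plane R => w - v0).
  apply: ct_row => i.
  have -> : (fun w : plane R => (w - v0) ord0 i) = (fun w => w ord0 i - v0 ord0 i).
    by apply: funext => w; rewrite !mxE.
  by ct.
have cn : continuous (fun w : plane R => `|w - v0|).
  by apply: (ct_comp _ cd); exact: norm_continuous.
have ci : {for u, continuous (fun w : plane R => (e - `|w - v0|)^-1)}.
  have d0 : e - `|u - v0| != 0 by rewrite gt_eqF // subr_gt0.
  have cdf : continuous (fun w : plane R => e - `|w - v0|) by ct.
  exact: (cvgV d0 (cdf u)).
have ck : {for u, continuous k} := cvgZ ci (cd u).
apply: filterI; last by apply: ck; exact: open_nbhs_nbhs.
by apply: (cn u [set t | t < e]); apply: open_nbhs_nbhs; split => //; exact: open_lt.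
Qed.

Lemma shrink_chart (Phi : plane R -> S2 R) v0 (U : set (S2 R)) :
  continuous Phi -> injective Phi -> open_map Phi -> nbhs (Phi v0) U ->
  exists2 e, 0 < e & is_chart (Phi \o shrink v0 e) (Phi v0) /\
    range (Phi \o shrink v0 e) `<=` U.
Proof.
move=> cP iP oP /cP /nbhs_ballP [e /= e0 eU]; exists e => //; split; first split.
- by move=> v; apply: continuous_comp; [exact: shrink_continuous|exact: cP].
- by move=> v w /iP vw; rewrite -(shrinkK v0 v e0) vw shrinkK.
- by move=> W oW; rewrite -image_comp; apply: oP; exact: shrink_open.
- by rewrite /= /shrink scaler0 addr0.
- move=> _ [v _ <-]; apply: eU; rewrite -ball_normE /ball_ /= distrC.
  exact: shrink_ball.
Qed.

End ChartCircles.

(** A homothetic image, by a factor at most 1, of a point of a smaller ellipse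
    does not lie on the larger one. *)
Lemma ellipse_inside (R : realType) (A B A' B' t x y x' y' : R) :
  1 <= A -> 0 < B -> A' < A -> B' < B -> 1 <= A' -> 0 <= B' -> 0 <= t -> t <= 1 ->
  x ^+ 2 + y ^+ 2 = 1 -> x' ^+ 2 + y' ^+ 2 = 1 ->
  A * x = (1 - t) * (A' * x') -> B * y = (1 - t) * (B' * y') -> False.
Proof.
move=> A1 B0 AA BB A1' B0' t0 t1 xy xy' ex ey.
have bound (C C' u u' : R) : 0 < C -> 0 <= C' -> C' < C -> C * u = (1 - t) * (C' * u') ->
    u ^+ 2 <= (C' / C) ^+ 2 * u' ^+ 2.
  move=> C0 C0' CC e.
  have -> : u = (1 - t) * (C' / C * u').
    by apply: (mulfI (lt0r_neq0 C0)); rewrite e; field; rewrite lt0r_neq0.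
  rewrite -exprMn [leLHS]exprMn; apply: ler_piMl; first exact: sqr_ge0.
  by rewrite expr_le1 //; lra.
have A0 : 0 < A by lra.
have q (C C' : R) : 0 < C -> 0 <= C' -> C' < C -> (C' / C) ^+ 2 < 1.
  by move=> C0 C0' CC; rewrite expr_lt1 // ?divr_ge0 ?ltr_pdivrMr ?mul1r //; lra.
have bA := bound A A' x x' A0 _ AA ex; have bB := bound B B' y y' B0 B0' BB ey.
have qA := q A A' A0 _ AA; have qB := q B B' B0 B0' BB.
have A0' : 0 <= A' by lra.
move: (bA A0') (qA A0') bB qB xy xy'; set a := (A' / A) ^+ 2; set c := (B' / B) ^+ 2.
have := sqr_ge0 x'; have := sqr_ge0 y'.
set x2 := x' ^+ 2; set y2 := y' ^+ 2 => y20 x20 h1 h2 h3 h4 h5 h6.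
have [x0|x0] := eqVneq x2 0; first by nra.
nra.
Qed.

Section HorizontalPeripheral.
Variables (R : realType) (F : R * R -> S2 R).
Hypothesis pF : pillow F.

(** In elliptic coordinates the curve is an ellipse around the puncture: it is
    first centered at the puncture, then rounded and shrunk. *)
Lemma horizontal_peripheral (P : set (S2 R)) b h s0 z0 : 0 < b < h -> h <= 1 ->
  0 <= s0 < b ->
  (forall s z, 0 <= s < h -> P (kap F (s, z)) -> kap F (s, z) = kap F (s0, z0)) ->
  forall U, nbhs (kap F (s0, z0)) U -> exists phi,
    [/\ is_chart phi (kap F (s0, z0)), range phi `<=` U &
       freely_homotopic P (fun z => kap F (b, z)) (fun z : S1 R => phi (\val z))].
Proof.
move=> /andP[b0 bh] h1 /andP[s00 s0b] hP U.
have h0 : 0 < h := lt_trans b0 bh.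
have h01 : 0 < h <= 1 by rewrite h0.
pose Phi := fold_chart F h.
have cP : continuous Phi := fold_chart_continuous pF h01.
have iP : injective Phi := fold_chart_inj pF h01.
have oP : open_map Phi := fold_chart_open pF h01.
pose v0 := ell h (s0, z0).
have s0h : 0 <= s0 < h by rewrite s00 (lt_trans s0b).
have bh' : 0 <= b < h by rewrite ltW.
have v0E : kap F (s0, z0) = Phi v0 by rewrite /Phi fold_chart_ell.
have PhiP v : P (Phi v) -> v = v0.
  have [s [z [sh <-]]] := ell_surj h0 v; rewrite {1}/Phi fold_chart_ell // => /(hP _ _ sh).
  by rewrite v0E -(fold_chart_ell pF z sh) // => /iP.
rewrite v0E => /(shrink_chart cP iP oP) [e e0 [ch rU]].
exists (Phi \o shrink v0 e); split=> //.
set A := eA h b; set B := eB h b.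
have A1 : 1 <= A := eA_ge1 h b.
have B0 : 0 < B by rewrite -(eB0 h); apply: eB_mono.
have s0z : eA h s0 < A := eA_mono s00 s0b bh.
have s0z' : eB h s0 < B := eB_mono s00 s0b bh.
have A0 : 1 <= eA h s0 := eA_ge1 h s0.
have B00 : 0 <= eB h s0 := eB_ge0 s0h.
set X0 := v0 ord0 ord0; set Y0 := v0 ord0 ord_max.
have X0E : X0 = eA h s0 * zx z0 by rewrite /X0 /v0 vec0.
have Y0E : Y0 = eB h s0 * zy z0 by rewrite /Y0 /v0 vec1.
pose H1 (p : R * S1 R) := Phi (vec (A * zx p.2 - (1 - p.1) * X0 + X0)
                                (B * zy p.2 - (1 - p.1) * Y0 + Y0)).
pose r (z : S1 R) := e / (1 + `|(\val z : plane R)|).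
have r0 z : 0 < r z by rewrite divr_gt0 // shrink_den.
pose H2 (p : R * S1 R) := Phi (vec (((1 - p.1) * A + p.1 * r p.2) * zx p.2 + X0)
                                (((1 - p.1) * B + p.1 * r p.2) * zy p.2 + Y0)).
have zne (z : S1 R) : ~ (zx z = 0 /\ zy z = 0).
  by move=> [x y]; have := zxyP z; rewrite x y expr0n addr0 => /eqP; rewrite eq_sym oner_eq0.
have cr : continuous r.
  have cinv : continuous (fun z : S1 R => (1 + `|(\val z : plane R)|)^-1).
    apply: ct_inv => [z|]; first by rewrite gt_eqF // shrink_den.
    apply: ct_add; first by ct.
    by apply: ct_comp; [exact: norm_continuous|apply: ct_val1; ct].
  by rewrite /r; ct.
apply: (@fh_trans R _ P (fun z => H1 (1, z))).
  have c1 : continuous H1 by apply: (ct_comp cP); ct.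
  apply: (fh_of c1) => [t z /andP[t0 t1]|z|//].
    rewrite /H1 /= => /PhiP e1.
    have /= := congr1 (fun v : plane R => v ord0 ord_max) e1; rewrite vec1 -/Y0.
    have /= := congr1 (fun v : plane R => v ord0 ord0) e1; rewrite vec0 -/X0 => ex ey.
    have {}ex : A * zx z = (1 - t) * (eA h s0 * zx z0) by rewrite -X0E; lra.
    have {}ey : B * zy z = (1 - t) * (eB h s0 * zy z0) by rewrite -Y0E; lra.
    exact: (ellipse_inside A1 B0 s0z s0z' A0 B00 t0 t1 (zxyP z) (zxyP z0) ex ey).
  rewrite /H1 /= subr0 !mul1r !subrK.
  by rewrite -[RHS](fold_chart_ell pF z bh').
have c2 : continuous H2 by apply: (ct_comp cP); ct.
apply: (fh_of c2) => [t z /andP[t0 t1]|z|z].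
- rewrite /H2 /= => /PhiP e1.
  have /= := congr1 (fun v : plane R => v ord0 ord_max) e1; rewrite vec1 -/Y0.
  have /= := congr1 (fun v : plane R => v ord0 ord0) e1; rewrite vec0 -/X0.
  rewrite -[RHS]add0r => /addIr/eqP; rewrite mulf_eq0 => /orP ex.
  rewrite -[RHS]add0r => /addIr/eqP; rewrite mulf_eq0 => /orP ey.
  have pos (D : R) : 0 < D -> (1 - t) * D + t * r z != 0.
    move=> D0; rewrite gt_eqF //; have := r0 z.
    have [->|tn] := eqVneq t 1; first by rewrite subrr mul0r add0r mul1r.
    have t1' : t < 1 by rewrite lt_neqAle tn.
    move=> rz; apply: ltr_pwDl; first by apply: mulr_gt0 => //; rewrite subr_gt0.
    by apply: mulr_ge0 => //; exact: ltW.
  apply: (zne z); split.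
    by case: ex => [|/eqP //]; rewrite (negbTE (pos A _)) //; lra.
  by case: ey => [|/eqP //]; rewrite (negbTE (pos B _)).
- by rewrite /H1 /H2 /= subr0 subrr !mul1r !mul0r !addr0 !subr0.
- rewrite /H2 /= subrr !mul0r !add0r !mul1r /shrink; congr Phi.
  by apply: plane_eq; rewrite ?vec0 ?vec1 [RHS]mxE [X in _ = _ + X]mxE addrC.
Qed.

End HorizontalPeripheral.

(** ** Classification of horizontal curves *)

Section Classification.
Variables (R : realType) (P : set (S2 R)).
Variables (F : R * R -> S2 R) (C : set (S2 R)) (alpha : S1 R -> S2 R) (b : R).
Variables (x1 x2 x3 x4 : S2 R).
Variables (s1 s2 s3 s4 : R) (z1 z2 z3 z4 : S1 R).
Hypotheses (pF : pillow F) (b01 : 0 < b < 1).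
Hypotheses (alphaC : parametrizes alpha C)
  (alpha_b : freely_homotopic P alpha (fun z => kap F (b, z))).
Hypothesis Pdef : forall w, P w <-> [\/ w = x1, w = x2, w = x3 | w = x4].
Hypotheses (x1E : x1 = kap F (s1, z1)) (x2E : x2 = kap F (s2, z2))
  (x3E : x3 = kap F (s3, z3)) (x4E : x4 = kap F (s4, z4)).
Hypotheses (s12 : s1 <= s2) (s23 : s2 <= s3) (s34 : s3 <= s4)
  (s1_ge0 : 0 <= s1) (s4_le1 : s4 <= 1).
Hypotheses (x12 : x1 <> x2) (x13 : x1 <> x3) (x14 : x1 <> x4)
  (x23 : x2 <> x3) (x24 : x2 <> x4) (x34 : x3 <> x4).

Let Px1 : P x1. Proof. by apply/Pdef; apply: Or41. Qed.
Let Px2 : P x2. Proof. by apply/Pdef; apply: Or42. Qed.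
Let Px3 : P x3. Proof. by apply/Pdef; apply: Or43. Qed.
Let Px4 : P x4. Proof. by apply/Pdef; apply: Or44. Qed.

(* Linear arithmetic with the order of the heights. *)
Ltac hlra := move: s12 s23 s34 s1_ge0 s4_le1 b01 => ? ? ? ? ? ?; lra.

Lemma puncture_height s z : 0 <= s <= 1 -> P (kap F (s, z)) ->
  [\/ s = s1 /\ kap F (s, z) = x1, s = s2 /\ kap F (s, z) = x2,
      s = s3 /\ kap F (s, z) = x3 | s = s4 /\ kap F (s, z) = x4].
Proof.
move=> s01 /Pdef [] e; [apply: Or41|apply: Or42|apply: Or43|apply: Or44]; split=> //;
  move: e; rewrite (x1E, x2E, x3E, x4E) => /(kap_height pF); apply=> //; hlra.
Qed.

Lemma null_horizontal : null_homotopic R P C ->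
  exists c, freely_homotopic P (fun z => kap F (b, z)) (fun=> c).
Proof.
move=> /(null_homotopic_param (@S2_hausdorff R) alphaC) [c ac].
by exists c; apply: fh_trans ac; exact: fh_sym.
Qed.

Lemma separated_not_null x y s s' z z' : P x -> P y -> x = kap F (s, z) -> y = kap F (s', z') ->
  0 <= s < b -> b < s' <= 1 -> ~ null_homotopic R P C.
Proof.
move=> Px Py xE yE sb s'b /null_horizontal [c bc].
apply: (horizontal_essential pF b01 sb s'b xE yE); exists c.
by apply: fh_sub bc => w [->|->].
Qed.

(** A peripheral curve contracts off any two punctures other than its own, and
    among these one can choose one below and one above the curve. *)
Lemma separated_not_peripheral_at x y y' s s' z z' : x <> y -> x <> y' -> P y -> P y' ->
  y = kap F (s, z) -> y' = kap F (s', z') -> 0 <= s < b -> b < s' <= 1 ->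
  ~ (forall U, nbhs x U -> exists gamma (phi : plane R -> S2 R),
     [/\ parametrizes gamma C, is_chart phi x, range phi `<=` U
    & freely_homotopic P gamma (fun z => phi (\val z))]).
Proof.
move=> xy xy' Py Py' yE yE' sb s'b per.
have /per [g [phi [gC ch rU hg]]] : nbhs x (~` [set y; y']).
  apply: open_nbhs_nbhs; split; last by case.
  apply: closed_openC; apply: closedU; apply: compact_closed; try exact: S2_hausdorff;
    exact: compact_set1.
have [c hc] : exists c, freely_homotopic [set y; y'] (fun z : S1 R => phi (\val z)) (fun=> c).
  by apply: (chart_circle_null ch) => v; apply: rU; exists v.
have [k ck ak] := parametrizes_comp (@S2_hausdorff R) gC alphaC.
have sub : [set y; y'] `<=` P by move=> w [->|->].
apply: (horizontal_essential pF b01 sb s'b yE yE'); exists c.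
apply: (fh_trans (fh_sub sub (fh_sym alpha_b))).
rewrite ak; apply: (fh_comp (g1 := fun=> c) ck).
exact: (fh_trans (fh_sub sub hg) hc).
Qed.

(** A small circle around a puncture does not contract off that puncture and
    another one. *)
Lemma null_not_peripheral : null_homotopic R P C -> ~ peripheral R P C.
Proof.
move=> nC [x Px per].
have [y Py xy] : exists2 y, P y & y <> x.
  have [->|x1x] := pselect (x = x1); first by exists x2 => //; exact: nesym.
  by exists x1 => // /esym.
have /per [g [phi [gC ch rU hg]]] : nbhs x (~` [set y]).
  apply: open_nbhs_nbhs; split; last exact: nesym.
  apply: closed_openC; apply: compact_closed; first exact: S2_hausdorff.
  exact: compact_set1.
have [c gc] := null_homotopic_param (@S2_hausdorff R) gC nC.
apply: (@chart_circle_essential R phi x y ch); first by move=> /rU; apply.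
exists c; have sub : [set x; y] `<=` P by move=> w [->|->].
exact: fh_sub sub (fh_trans (fh_sym hg) gc).
Qed.

Lemma below_all : b < s1 -> null_homotopic R P C /\ ~ peripheral R P C.
Proof.
move=> bs1; have nC : null_homotopic R P C.
  have [||c bc] := @horizontal_null R F pF P b; first hlra.
    move=> s z sb Ps; have s01 : 0 <= s <= 1 by hlra.
    by case: (puncture_height s01 Ps) => -[e _]; hlra.
  by exists alpha, c; split=> //; exact: fh_trans bc.
by split=> //; exact: null_not_peripheral.
Qed.

Lemma above_one : s1 < b -> b < s2 -> peripheral R P C /\ ~ null_homotopic R P C.
Proof.
move=> s1b bs2; split; last first.
  by apply: (separated_not_null Px1 Px2 x1E x2E); hlra.
exists x1 => // U; rewrite x1E => xU.
have hP s z : 0 <= s < s2 -> P (kap F (s, z)) -> kap F (s, z) = kap F (s1, z1).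
  move=> ss Ps; have s01 : 0 <= s <= 1 by hlra.
  by case: (puncture_height s01 Ps) => -[e e']; [rewrite e' x1E|exfalso; hlra..].
have b0 : 0 < b < s2 by hlra.
have s21 : s2 <= 1 by hlra.
have s1b' : 0 <= s1 < b by hlra.
have [phi [ch rU h]] := horizontal_peripheral pF b0 s21 s1b' hP xU.
by exists alpha, phi; split=> //; exact: fh_trans h.
Qed.

Lemma above_two : s2 < b -> b < s3 -> ~ null_homotopic R P C /\ ~ peripheral R P C.
Proof.
move=> s2b bs3; split; first by apply: (separated_not_null Px1 Px3 x1E x3E); hlra.
move=> [x /Pdef xP per]; case: xP per => ->.
- by apply: (separated_not_peripheral_at x12 x13 Px2 Px3 x2E x3E); hlra.
- by apply: (separated_not_peripheral_at (nesym x12) x23 Px1 Px3 x1E x3E); hlra.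
- by apply: (separated_not_peripheral_at (nesym x13) x34 Px1 Px4 x1E x4E); hlra.
- by apply: (separated_not_peripheral_at (nesym x14) (nesym x34) Px1 Px3 x1E x3E); hlra.
Qed.

End Classification.

(** The punctures are listed by height, so that turning the pillow upside down
    reverses the list. *)
Record punctures (R : realType) (F : R * R -> S2 R) (P : set (S2 R))
    (s1 s2 s3 s4 : R) : Prop := {
  punct : exists x1 x2 x3 x4 z1 z2 z3 z4,
   [/\ forall w, P w <-> [\/ w = x1, w = x2, w = x3 | w = x4],
     [/\ x1 = kap F (s1, z1), x2 = kap F (s2, z2), x3 = kap F (s3, z3) & x4 = kap F (s4, z4)] &
     [/\ x1 <> x2, x1 <> x3 & x1 <> x4] /\ [/\ x2 <> x3, x2 <> x4 & x3 <> x4]];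
  punct_le : [/\ 0 <= s1, s1 <= s2, s2 <= s3, s3 <= s4 & s4 <= 1] }.

Lemma punctures_flip (R : realType) (F : R * R -> S2 R) P (s1 s2 s3 s4 : R) :
  punctures F P s1 s2 s3 s4 ->
  punctures (fun x => F (x.1, 1 - x.2)) P (1 - s4) (1 - s3) (1 - s2) (1 - s1).
Proof.
move=> [[x1 [x2 [x3 [x4 [z1 [z2 [z3 [z4 H]]]]]]]] [? ? ? ? ?]].
case: H => Pdef [e1 e2 e3 e4] [[n12 n13 n14] [n23 n24 n34]].
split; last by split; lra.
exists x4, x3, x2, x1, z4, z3, z2, z1; split.
- move=> w; rewrite Pdef; split; (case=> e; [exact: Or44|exact: Or43|exact: Or42|exact: Or41]).
- by rewrite /kap /= !subKr; split.
- by split; split; exact: nesym.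
Qed.

(** The position among the punctures decides: a curve with two punctures on
    either side is neither contractible nor peripheral, as it separates two
    punctures other than any given one. *)
Lemma horizontal_type (R : realType) (F : R * R -> S2 R) P C alpha (b s1 s2 s3 s4 : R) :
  pillow F -> punctures F P s1 s2 s3 s4 -> 0 < b < 1 ->
  parametrizes alpha C -> freely_homotopic P alpha (fun z => kap F (b, z)) ->
  [/\ b < s1 \/ s4 < b -> null_homotopic R P C /\ ~ peripheral R P C,
      s1 < b < s2 \/ s3 < b < s4 -> peripheral R P C /\ ~ null_homotopic R P C
    & s2 < b < s3 -> ~ null_homotopic R P C /\ ~ peripheral R P C].
Proof.
move=> pF pu b01 aC ab; have pu' := punctures_flip pu.
have pF' := pillow_flip pF.
have b01' : 0 < 1 - b < 1 by lra.
have ab' : freely_homotopic P alpha (fun z => kap (fun x => F (x.1, 1 - x.2)) (1 - b, z)).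
  by rewrite /kap /= subKr.
case: pu => [[x1 [x2 [x3 [x4 [z1 [z2 [z3 [z4 H]]]]]]]] [? ? ? ? ?]].
case: H => Pdef [e1 e2 e3 e4] [[n12 n13 n14] [n23 n24 n34]].
case: pu' => [[y1 [y2 [y3 [y4 [w1 [w2 [w3 [w4 H]]]]]]]] [? ? ? ? ?]].
case: H => Pdef' [e1' e2' e3' e4'] [[m12 m13 m14] [m23 m24 m34]].
split.
- case=> bs.
    by apply: (below_all pF b01 aC ab Pdef e1 e2 e3 e4).
  apply: (below_all pF' b01' aC ab' Pdef' e1' e2' e3' e4') => //; lra.
- case=> /andP[bs bs'].
    by apply: (above_one pF b01 aC ab Pdef e1 e2 e3 e4).
  apply: (above_one pF' b01' aC ab' Pdef' e1' e2' e3' e4') => //; lra.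
- move=> /andP[bs bs'].
  by apply: (above_two pF b01 aC ab Pdef e1 e2 e3 e4).
Qed.

(** * Straightening a curve of given slope *)

Lemma hausdorff_pair (X Y : topologicalType) :
  hausdorff_space X -> hausdorff_space Y -> hausdorff_space (X * Y)%type.
Proof.
move=> hX hY [x y] [x' y'] c; congr pair.
- apply: hX => A B Ax Bx'.
  have [||[u v] [/= Au Bu]] := c (A `*` setT) (B `*` setT).
  + by exists (A, setT) => //; split=> //=; exact: filterT.
  + by exists (B, setT) => //; split=> //=; exact: filterT.
  by exists u; split; [case: Au|case: Bu].
- apply: hY => A B Ay By'.
  have [||[u v] [/= Au Bu]] := c (setT `*` A) (setT `*` B).
  + by exists (setT, A) => //; split=> //=; exact: filterT.
  + by exists (setT, B) => //; split=> //=; exact: filterT.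
  by exists v; split; [case: Au|case: Bu].
Qed.

Section RealLemmas.
Variable R : realType.

Lemma ivt (f : R -> R) (a b v : R) : continuous f -> a <= b ->
  (f a <= v <= f b \/ f b <= v <= f a) -> exists2 c, a <= c <= b & f c = v.
Proof.
move=> cf ab fv.
have [|c + fc] := @IVT R f a b v ab (continuous_subspaceT cf).
  rewrite /Num.min /Num.max; case: fv => /andP[h1 h2]; case: ifP => h; apply/andP; split=> //.
  - by move/negbT: h; rewrite -leNgt => h; exact: le_trans h h1.
  - by move/negbT: h; rewrite -leNgt => h; exact: le_trans h2 h.
  - by move: (lt_le_trans h h1); rewrite lt_neqAle => /andP[_ /le_trans]; apply.
  - exact: le_trans h2 (ltW h).
by rewrite in_itv => c01; exists c.
Qed.

Lemma int_le1 (k : int) : -1 <= (k%:~R : R) -> (k%:~R : R) <= 1 -> k <> 0 ->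
  k = 1 \/ k = -1.
Proof.
rewrite (_ : -1 = (-1)%:~R) // ler_int (_ : 1 = 1%:~R) // ler_int; lia.
Qed.

Lemma avoid_integers (f : R -> R) (b : R) : continuous f ->
  (forall a, 0 <= a <= b -> forall n : int, f a <> n%:~R) ->
  0 < f 0 < 1 -> forall a, 0 <= a <= b -> 0 < f a < 1.
Proof.
move=> cf fZ /andP[f0 f1] a /andP[a0 ab]; apply/andP; split.
- rewrite ltNge; apply/negP => fa.
  have [|c /andP[c0 ca] fc] := @ivt f 0 a 0 cf a0; first by right; rewrite fa ltW.
  by apply: (fZ c _ 0 fc); rewrite c0 (le_trans ca).
- rewrite ltNge; apply/negP => fa.
  have [|c /andP[c0 ca] fc] := @ivt f 0 a 1 cf a0; first by left; rewrite fa ltW.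
  by apply: (fZ c _ 1 fc); rewrite c0 (le_trans ca).
Qed.

(** With winding number 0 some value is taken twice; otherwise the value one full
    turn away from the start is met at some time, which has to be the end. *)
Lemma injective_winding (tau : R -> R) (k : int) : continuous tau ->
  (forall a a' (m : int), 0 <= a < 2 -> 0 <= a' < 2 -> tau a' = tau a + 2 * m%:~R -> a = a') ->
  tau 2 = tau 0 + 2 * k%:~R -> k = 1 \/ k = -1.
Proof.
move=> ct itau tk.
have [k0|k0] := eqVneq k 0.
  move: tk; rewrite k0 mulr0 addr0 => t2.
  have neq : tau 1 <> tau 0.
    move=> e; have : (1 : R) = 0 by apply: (itau 1 0 0); rewrite ?mulr0 ?addr0 //; lra.
    by move/eqP; rewrite oner_eq0.
  pose v := (tau 0 + tau 1) / 2.
  have v01 : tau 0 <= v <= tau 1 \/ tau 1 <= v <= tau 0.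
    by rewrite /v; have [h|h] := leP (tau 0) (tau 1); [left|right]; apply/andP; split; lra.
  have [c c01 cv] := ivt ct ler01 v01.
  have h12 : (1 : R) <= 2 by lra.
  have v12 : tau 1 <= v <= tau 2 \/ tau 2 <= v <= tau 1 by rewrite t2; case: v01; [right|left].
  have [c' c'12 c'v] := ivt ct h12 v12.
  have vne0 : v <> tau 0 by rewrite /v => e; apply: neq; lra.
  have vne1 : v <> tau 1 by rewrite /v => e; apply: neq; lra.
  have c'2 : c' <> 2 by move=> e; apply: vne0; rewrite -t2 -e.
  have c1 : c <> 1 by move=> e; apply: vne1; rewrite -e.
  have : c = c' by apply: (itau c c' 0); rewrite ?cv ?c'v ?mulr0 ?addr0 //; lra.
  by move=> cc; exfalso; apply: c1; lra.
have key (e : int) : e = 1 \/ e = -1 -> (0 < e * k)%R -> k <> e -> False.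
  move=> e1 ek ke.
  have kR : (tau 0 <= tau 0 + 2 * e%:~R <= tau 2) \/ (tau 2 <= tau 0 + 2 * e%:~R <= tau 0).
    rewrite tk; case: e1 ek ke => -> ek ke; [left|right].
      have : (1 : R) <= k%:~R by rewrite -[leLHS]/(1%:~R) ler_int; lia.
      by move=> h; apply/andP; split; lra.
    have : (k%:~R : R) <= -1 by rewrite -[leRHS]/((-1)%:~R) ler_int; lia.
    by move=> h; apply/andP; split; lra.
  have [c c02 ce] := ivt ct (ler0n R 2) kR.
  have c2 : c <> 2.
    move=> c2; move: ce; rewrite c2 tk => /addrI /(mulfI _) h.
    by apply: ke; apply/eqP; rewrite -(eqr_int R); apply/eqP/h; rewrite pnatr_eq0.
  have c0 : 0 = c by apply: (itau 0 c e) => //; lra.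
  move: ce; rewrite -c0 => /eqP; rewrite -subr_eq0 opprD addNKr oppr_eq0 mulf_eq0 pnatr_eq0 /= intr_eq0.
  by case: e1 => ->.
have [kp|kp] := ltP 0 k.
  by left; apply: contrapT => /key; apply; [left|lia].
by right; apply: contrapT => /key; apply; [right|lia].
Qed.

End RealLemmas.

Section Straighten.
Variables (R : realType) (F : R * R -> S2 R) (P : set (S2 R)) (y0 : R).
Hypotheses (pF : pillow F) (FP : forall x, integral_point x -> P (F x)).
Hypothesis y01 : 0 < y0 < 1.

Lemma off_punctures x : ~ P (F x) -> locally_injective_at F x.
Proof. by move=> nP; apply: (pillow_locally_injective pF) => /FP. Qed.

Lemma horizontal_fiber a a' : F (a, y0) = F (a', y0) ->
  exists m : int, a' = a + 2 * m%:~R.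
Proof.
move=> /(pillowP pF) [m [n [[e _]|[_ e]]]]; first by exists m.
have n0 : n = 0 by apply: (@int_lt1 R); move: y01; lra.
by exfalso; move: e y01; rewrite n0; lra.
Qed.

(** The homotopy is lifted on a rectangle. At time 0 the lift follows the line at
    height y0, as it cannot cross the folds, and advances by 2 k with k = 1 or -1
    because the curve is simple; by uniqueness of lifts it advances by 2 k at all
    times. V is the lift made periodic by subtracting k a. *)
Lemma straighten_lift (H : R * S1 R -> S2 R) (C : set (S2 R)) :
  continuous H -> (forall p, ~ P (H p)) ->
  (forall z, exists a, H (0, z) = F (a, y0)) -> injective (fun z => H (0, z)) ->
  exists (k : int) (V : R * S1 R -> R * R), [/\ k = 1 \/ k = -1, continuous V,
    forall t a, 0 <= t <= 1 ->
      H (t, E (pi * a)) = F ((V (t, E (pi * a))).1 + k%:~R * a, (V (t, E (pi * a))).2)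
  & forall z, (V (0, z)).2 = y0].
Proof.
move=> cH HP H0 iH.
have y01' := y01.
have p0 := @pi_gt0 R.
pose H' (x : R * R) := H (x.1, E (pi * x.2)).
have cH' : continuous H' by apply: (ct_comp cH); ct.
have [a0 a0E] := H0 (E (pi * 0)).
have good t s : 0 <= t <= 1 -> 0 <= s <= 2 ->
    exists2 X, F X = H' (t, s) & locally_injective_at F X.
  move=> _ _; have [_ sF _] := pF; have [X XE] := sF (H' (t, s)).
  by exists X => //; apply: off_punctures; rewrite XE; exact: HP.
have [L [cL L0 LH]] := rectangle_lift (pillow_open pF) (pillow_deck pF)
  (ltr0Sn R 1) cH' good (esym a0E).
have z01 : 0 <= (0 : R) <= 1 by lra.
have z02 : 0 <= (0 : R) <= 2 by lra.
have t02 : 0 <= (2 : R) <= 2 by lra.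
have cL2 : continuous (fun a => (L (0, a)).2) by ct.
have cL1 : continuous (fun a => (L (0, a)).1) by ct.
have hZ a : 0 <= a <= 2 -> exists n : int,
    (L (0, a)).2 = y0 + 2 * n%:~R \/ (L (0, a)).2 = - y0 + 2 * n%:~R.
  move=> a02; have [a' e] := H0 (E (pi * a)).
  have : F (a', y0) = F (L (0, a)) by rewrite LH // -e.
  by move=> /(pillowP pF) [m [n [->|->]]]; exists n; [left|right].
have hy a : 0 <= a <= 2 -> (L (0, a)).2 = y0.
  move=> a02.
  have aZ a' : 0 <= a' <= 2 -> forall n : int, (L (0, a')).2 <> n%:~R.
    move=> a'02 n nE; have [m] := hZ _ a'02; rewrite nE => mE.
    have [l lE] : exists l : int, y0 = l%:~R.
      by case: mE => mE; [exists (n - 2 * m)|exists (2 * m - n)]; rewrite intrB intrM; lra.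
    have l0 : l = 0 by apply: (@int_lt1 R); lra.
    by move: y01'; rewrite lE l0; lra.
  have h0 : 0 < (L (0, 0)).2 < 1 by rewrite L0.
  have := avoid_integers cL2 aZ h0 a02; have [n [->|->]] := hZ _ a02 => h.
    have n0 : n = 0 by apply: (@int_lt1 R); lra.
    by rewrite n0 mulr0 addr0.
  have n0 : n = 0 by apply: (@int_lt1 R); lra.
  by exfalso; move: h; rewrite n0; lra.
pose tau a := (L (0, a)).1.
have tauE a : 0 <= a <= 2 -> H (0, E (pi * a)) = F (tau a, y0).
  by move=> a02; rewrite /tau -(hy _ a02) -surjective_pairing LH.
have [k kE] : exists k : int, tau 2 = tau 0 + 2 * k%:~R.
  apply: horizontal_fiber; rewrite -!tauE //; congr (H (0, _)).
  by apply/E_pi_eq; exists 1; rewrite add0r mulr1.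
have k1 : k = 1 \/ k = -1.
  apply: injective_winding cL1 _ kE => a a' m a02 a'02 e.
  have /iH /E_pi_eq [n nE] : H (0, E (pi * a)) = H (0, E (pi * a')).
    rewrite !tauE; [|lra..]; rewrite /tau e; apply/(pillowP pF).
    by exists m, 0; left; rewrite /= mulr0 addr0.
  have n0 : n = 0 by apply: (@int_lt1 R); lra.
  by rewrite nE n0 mulr0 addr0.
have shift t : 0 <= t <= 1 -> L (t, 2) = ((L (t, 0)).1 + 2 * k%:~R, (L (t, 0)).2).
  apply: (@unique_lift R (R * R)%type _ F 0 1 (fun t => L (t, 2))
    (fun t => ((L (t, 0)).1 + 2 * k%:~R, (L (t, 0)).2)) 0) => //.
  - by apply: continuous_subspaceT; ct.
  - by apply: continuous_subspaceT; ct.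
  - move=> s s01; split.
      have := pillow_shift pF (L (s, 0)) k 0; rewrite mulr0 addr0 => ->.
      rewrite !LH // /H' /=; congr (H (_, _)).
      by apply/esym/E_pi_eq; exists 1; rewrite add0r mulr1.
    by apply: off_punctures; rewrite LH //; exact: HP.
  - by rewrite [LHS]surjective_pairing hy // hy // -/(tau 2) kE.
pose W (x : R * S1 R) : R * R :=
  let a := xget 0 [set a | 0 <= a <= 2 /\ E (pi * a) = x.2] in
  ((L (x.1, a)).1 - k%:~R * a, (L (x.1, a)).2).
have WE t a : 0 <= t <= 1 -> 0 <= a <= 2 ->
    W (t, E (pi * a)) = ((L (t, a)).1 - k%:~R * a, (L (t, a)).2).
  move=> t01 a02; rewrite /W /=; case: xgetP => [a' _ [a'02 /E_pi_eq [m mE]]|/(_ a)]; last by case.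
  have [->//|aa] := eqVneq a' a.
  have m0 : m <> 0 by move=> m0; move/eqP: aa; apply; rewrite mE m0 mulr0 addr0.
  have mR : -1 <= (m%:~R : R) <= 1 by lra.
  have m1 : m = 1 \/ m = -1.
    by case/andP: mR => h1 h2; exact: (int_le1 h1 h2 m0).
  have sh := shift _ t01.
  case: m1 => mE'; move: mE; rewrite mE' => mE.
    have [-> ->] : a' = 0 /\ a = 2 by split; lra.
    by rewrite sh /=; congr pair; ring.
  have [-> ->] : a' = 2 /\ a = 0 by split; lra.
  by rewrite sh /=; congr pair; ring.
have a_surj (z : S1 R) : exists2 a, 0 <= a <= 2 & E (pi * a) = z.
  have [t t0 tz] := E_surj z; exists (t / pi); last by rewrite mulrC divfK // gt_eqF.
  by rewrite divr_ge0 ?ler_pdivrMr //; lra.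
have cW : {within [set x : R * S1 R | 0 <= x.1 <= 1], continuous W}.
  pose K := (`[0, 1]%classic : set R) `*` (`[0, 2]%classic : set R).
  pose q (x : R * R) := (x.1, E (pi * x.2)).
  have -> : [set x : R * S1 R | 0 <= x.1 <= 1] = q @` K.
    apply/seteqP; split=> [[t z] /= t01|_ [[t a] [/= t01 _] <-]] /=; last by move: t01; rewrite in_itv.
    have [a a02 az] := a_surj z; exists (t, a); last by rewrite /q /= az.
    by split; rewrite /= in_itv.
  have cq : continuous q by rewrite /q; ct.
  have cw : continuous (fun x : R * R => ((L (x.1, x.2)).1 - k%:~R * x.2, (L (x.1, x.2)).2)) by ct.
  apply: compact_quotient.
  - by apply: hausdorff_pair; [exact: norm_hausdorff|exact: S1_hausdorff].
  - by apply: compact_setX; exact: segment_compact.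
  - exact: continuous_subspaceT.
  - apply: (@subspace_eq_continuous _ K _ (fun x => ((L (x.1, x.2)).1 - k%:~R * x.2, (L (x.1, x.2)).2))).
      move=> [t a]; rewrite inE => -[/= t01 a02]; apply: esym; apply: WE.
        by rewrite in_itv in t01.
      by rewrite in_itv in a02.
    by apply: continuous_subspaceT; exact: cw.
pose V (x : R * S1 R) := W (clamp x.1, x.2).
have VE t z : 0 <= t <= 1 -> V (t, z) = W (t, z).
  by move=> t01; congr (W (_, _)); exact: clamp_id.
exists k, V; split=> //.
- apply: (within_comp_total cW) => [|x] /=; last exact: clamp01.
  by rewrite /clamp; ct.
- move=> t a t01.
  have [a' a'02 aa] := a_surj (E (pi * a)).
  rewrite -aa VE // WE //; have /E_pi_eq [m mE] := aa.
  rewrite -[LHS]/(H' (t, a')) -LH // [L (t, a')]surjective_pairing /=.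
  apply/(pillowP pF); exists (k * m), 0; left; rewrite /= mulr0 addr0 mE intrM.
  by congr pair; ring.
- move=> z; have [a a02 <-] := a_surj z.
  by rewrite VE // WE //= hy.
Qed.

(** The curve delta lifts to a path that advances by (2, 0) in one turn, and V
    moves it to a horizontal line through paths that do the same. If the winding
    is in the negative direction, the circle is reflected. *)
Lemma straighten (delta : set (S2 R)) (gamma0 gamma1 : S1 R -> S2 R) :
  parametrizes gamma0 delta ->
  parametrizes gamma1 [set F (a, y0) | a in [set: R]] ->
  freely_homotopic P gamma0 gamma1 ->
  exists (V : R * S1 R -> R * R) (gamma : S1 R -> S2 R),
  [/\ continuous V, parametrizes gamma delta,
      forall a, gamma (E (pi * a)) = F ((V (0, E (pi * a))).1 + a, (V (0, E (pi * a))).2),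
      forall t a, 0 <= t <= 1 ->
        ~ P (F ((V (t, E (pi * a))).1 + a, (V (t, E (pi * a))).2))
    & forall z, (V (1, z)).2 = y0].
Proof.
move=> g0 [cg1 ig1 g1C] /fh_sym /freely_homotopicP [H [cH HP H0 H1]].
have [||k [V [k1 cV VH V0]]] := straighten_lift delta cH HP.
- move=> z; have : range gamma1 (gamma1 z) by exists z.
  by rewrite g1C => -[a _ aE]; exists a; rewrite H0.
- by move=> z w; rewrite !H0 => /ig1.
have o01 : 0 <= (1 : R) <= 1 by lra.
case: k1 VH => -> VH.
- exists (fun x => V (1 - x.1, x.2)), gamma0; split=> //.
  + by ct.
  + by move=> a; rewrite -H1 VH //= subr0 mul1r.
  + move=> t a t01; have t01' : 0 <= 1 - t <= 1 by lra.
    by have := VH _ a t01'; rewrite mul1r /= => <-; exact: HP.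
  + by move=> z; rewrite /= subrr.
- exists (fun x => V (1 - x.1, conjS x.2)), (gamma0 \o @conjS R).
  have cc := @conjS_continuous R.
  split=> //.
  + by ct.
  + case: g0 => cg ig gd; split.
    * by apply: ct_comp.
    * by move=> z w /ig /(congr1 (@conjS R)); rewrite !conjSK.
    * rewrite -gd; apply/seteqP; split=> [_ [z _ <-]|_ [z _ <-]]; first by exists (conjS z).
      by exists (conjS z) => //=; rewrite conjSK.
  + move=> a; rewrite /= conjSE -mulrN -H1 VH //= subr0.
    by rewrite mulrNN mul1r.
  + move=> t a t01; have t01' : 0 <= 1 - t <= 1 by lra.
    by have := VH _ (- a) t01'; rewrite mulrNN mul1r /= conjSE -mulrN => <-; exact: HP.
  + by move=> z; rewrite /= subrr.
Qed.

End Straighten.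

(** * Power maps of the circle *)

Lemma E_inj_near (R : realType) (s t : R) : `|s - t| < 2 * pi -> E s = E t -> s = t.
Proof.
move=> st /E_eq [m mE]; suff m0 : m = 0 by rewrite mE m0 mulr0 addr0.
have h : `|m%:~R : R| < 1.
  rewrite -(ltr_pM2l (pi2_gt0 R)) mulr1 -{1}(gtr0_norm (pi2_gt0 R)) -normrM.
  by rewrite (_ : 2 * pi * m%:~R = t - s) 1?distrC // mE addrAC subrr add0r.
by move: h; rewrite ltr_norml => /andP[h1 h2]; exact: int_lt1 h1 h2.
Qed.

Section Power.
Variables (R : realType) (d : nat).
Hypothesis d0 : (0 < d)%N.

Let dR : 0 < (d%:R : R). Proof. by rewrite ltr0n. Qed.

Definition powS (z : S1 R) : S1 R := E (d%:R * arg z).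

Lemma powSE t : powS (E t) = E (d%:R * t).
Proof.
rewrite /powS; have /E_eq [k {2}->] := argK (E t).
by rewrite mulrDr; apply/E_eq; exists (d%:Z * k); rewrite intrM; ring.
Qed.

Lemma powS_continuous : continuous powS.
Proof.
apply: E_factor; have -> : powS \o @E R = (fun t => E (d%:R * t)).
  by apply/funext => t; rewrite /= powSE.
by ct.
Qed.

Lemma powS_open : open_map powS.
Proof.
move=> U oU.
have -> : powS @` U = @E R @` [set s | U (E (s / d%:R))].
  apply/seteqP; split=> [_ [z Uz <-]|_ [s Us <-]].
    by exists (d%:R * arg z) => //=; rewrite [d%:R * _]mulrC mulfK ?gt_eqF // argK.
  by exists (E (s / d%:R)) => //; rewrite powSE [d%:R * _]mulrC divfK // gt_eqF.
apply: E_open.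
have c : continuous (fun s : R => E (s / d%:R)) by ct.
by move/continuousP: c; apply.
Qed.

Let root (t : R) (k : nat) : S1 R := E ((t + 2 * pi * k%:R) / d%:R).

Let root_eq s t (k l : nat) : (k < d)%N -> (l < d)%N -> `|s - t| < 2 * pi ->
  root s k = root t l -> s = t /\ k = l.
Proof.
move=> kd ld st /E_eq [m mE].
have dn : (d%:R : R) != 0 by rewrite gt_eqF.
have e : t - s = 2 * pi * ((k%:Z - l%:Z + d%:Z * m)%:~R).
  have /= := congr1 (fun x => x * d%:R) mE; rewrite [RHS]mulrDl !divfK // => h.
  rewrite intrD intrB intrM -!pmulrn.
  have -> : t = s + 2 * pi * k%:R + 2 * pi * m%:~R * d%:R - 2 * pi * l%:R by lra.
  by ring.
have n0 : k%:Z - l%:Z + d%:Z * m = 0.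
  have h : `|(k%:Z - l%:Z + d%:Z * m)%:~R : R| < 1.
    by rewrite -(ltr_pM2l (pi2_gt0 R)) mulr1 -{1}(gtr0_norm (pi2_gt0 R)) -normrM -e distrC.
  by move: h; rewrite ltr_norml => /andP[h1 h2]; exact: int_lt1 h1 h2.
split; first by move: e; rewrite n0 mulr0; lra.
have : m = 0 by nia.
by move=> m0; move: n0; rewrite m0 mulr0; lia.
Qed.

Let root_surj s z : powS z = E s -> exists2 k : nat, (k < d)%N & z = root s k.
Proof.
move=> zs; have /esym/E_eq [m mE] : E (d%:R * arg z) = E s by [].
have dn : (d%:R : R) != 0 by rewrite gt_eqF.
pose k := (m %% d%:Z)%Z.
have k0 : (0 <= k)%R by apply: modz_ge0; lia.
have kd : (k < d%:Z)%R by apply: ltz_pmod; lia.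
exists `|k|%N; first by lia.
rewrite -(argK z) /root; apply/E_eq; exists (- (m %/ d%:Z)%Z).
have mdiv : m = (m %/ d%:Z)%Z * d%:Z + k by exact: divz_eq.
have -> : (`|k|%N%:R : R) = k%:~R by rewrite -[in RHS](gez0_abs k0) -pmulrn.
have -> : arg z = (s + 2 * pi * m%:~R) / d%:R by rewrite -mE mulrC mulKf.
have -> : (m%:~R : R) = (m %/ d%:Z)%Z%:~R * d%:R + k%:~R by rewrite {1}mdiv intrD intrM.
by rewrite mulrNz; field.
Qed.

Let powS_root s k : powS (root s k) = E s.
Proof.
by rewrite /root powSE [d%:R * _]mulrC divfK ?gt_eqF //; apply/esym/E_eq; exists k%:Z; rewrite -pmulrn.
Qed.

Lemma powS_fiber w : powS @^-1` [set w] #= `I_d.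
Proof.
have -> : powS @^-1` [set w] = root (arg w) @` `I_d.
  apply/seteqP; split=> [z /= zw|_ [k _ <-]] /=.
    have [|k kd ->] := @root_surj (arg w) z; first by rewrite zw argK.
    by exists k.
  by rewrite powS_root argK.
apply: inj_card_eq => k l; rewrite !inE /= => kd ld e.
by have [] := root_eq kd ld _ e; rewrite ?subrr ?normr0 ?pi2_gt0.
Qed.

(** Over an arc of length less than one turn, each of the d roots is a section. *)
Lemma powS_covering : covering_map powS.
Proof.
split; first exact: powS_continuous.
- apply/seteqP; split=> // z _; exists (root (arg z) 0) => //.
  by rewrite powS_root argK.
move=> y; pose t0 := arg y.
pose I := [set s : R | `|s - t0| < pi].
have oI : open I.
  have c : continuous (fun s : R => `|s - t0|) by ct.
  by move/continuousP/(_ [set t | t < pi]) : c; apply; exact: open_lt.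
have It0 : I t0 by rewrite /I /= subrr normr0 pi_gt0.
have I2 s t : I s -> I t -> `|s - t| < 2 * pi.
  rewrite /I /= => h1 h2; have -> : s - t = (s - t0) - (t - t0) by ring.
  by apply: le_lt_trans (ler_normB _ _) _; lra.
exists (@E R @` I); split; first exact: E_open.
  by exists t0 => //; exact: argK.
pose U k := (fun s => root s k) @` I.
exists [set U k | k in `I_d]; split.
- apply/seteqP; split=> [z [_ [k kd <-] [s Is <-]]|z [s Is zs]] /=.
    by exists s => //; rewrite powS_root.
  by have [k kd ->] := root_surj (esym zs); exists (U k); [exists k|exists s].
- move=> _ _ [k kd <-] [l ld <-] [z [[s Is sz] [t It tz]]].
  have [|_ ->//] := @root_eq s t k l kd ld (I2 _ _ Is It).
  by rewrite sz tz.
- move=> _ [k kd <-]; split.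
  + have -> : U k = @E R @` [set u | I (d%:R * u - 2 * pi * k%:R)].
      apply/seteqP; split=> [_ [s Is <-]|_ [u Iu <-]].
        by exists ((s + 2 * pi * k%:R) / d%:R) => //=; rewrite mulrC divfK ?gt_eqF // addrK.
      exists (d%:R * u - 2 * pi * k%:R) => //.
      by rewrite /root subrK mulrC mulKf // gt_eqF.
    apply: E_open.
    have c : continuous (fun u : R => d%:R * u - 2 * pi * k%:R) by ct.
    by move/continuousP: c; apply.
  + move=> z w /set_mem [s Is <-] /set_mem [t It <-]; rewrite !powS_root => st.
    by rewrite (E_inj_near (I2 _ _ Is It) st).
  + apply/seteqP; split=> [_ [_ [s Is <-] <-]|_ [s Is <-]]; first by exists s => //; rewrite powS_root.
    by exists (root s k); [exists s|rewrite powS_root].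
  + by move=> W _; exact: powS_open.
Qed.

End Power.

(** * Components of a finite disjoint union of compact connected sets *)

(** Each K i is open and closed in A. *)
Lemma components_finite (X : topologicalType) (A : set X) (n : nat) (K : nat -> set X) :
  A = \bigcup_(i in `I_n) K i ->
  (forall i, (i < n)%N -> closed (K i)) ->
  (forall i, (i < n)%N -> connected (K i)) ->
  (forall i, (i < n)%N -> K i !=set0) ->
  (forall i j, (i < n)%N -> (j < n)%N -> K i `&` K j !=set0 -> i = j) ->
  components A = K @` `I_n.
Proof.
move=> AE Kcl Kco K0 Kdis.
have comp i x : (i < n)%N -> K i x -> connected_component A x = K i.
  move=> ni Kx; have KA : K i `<=` A by rewrite AE => y Ky; exists i.
  have Ax : A x by exact: KA.
  apply/seteqP; split; last first.
    by apply: connected_component_max => //; exact: Kco.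
  have conn := @component_connected X A x.
  set C := connected_component A x in conn *.
  have Cx : C x by exact: connected_component_refl.
  suff <- : C `&` K i = C by exact: subIsetr.
  apply: conn.
  - by exists x.
  - exists (~` \bigcup_(j in [set j | (j < n)%N /\ j <> i]) K j).
      apply: closed_openC; apply: closed_bigcup; last by move=> j [nj _]; exact: Kcl.
      by apply: (sub_finite_set _ (finite_II n)) => j [].
    apply/seteqP; split=> [y [Cy Kiy]|y [Cy nKy]]; split=> //.
      move=> [j [nj ji] Kjy]; apply: ji; apply: Kdis => //.
      by exists y.
    have : A y by exact: connected_component_sub Cy.
    rewrite AE => -[j nj Kjy]; have [<-//|/eqP ji] := eqVneq j i.
    by case: nKy; exists j.
  - by exists (K i) => //; exact: Kcl.
apply/seteqP; split=> [_ [x Ax ->]|_ [i ni <-]].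
  move: (Ax); rewrite {1}AE => -[i ni Kx]; exists i => //.
  by rewrite (comp i x).
have [x Kx] := K0 i ni; exists x; last by rewrite (comp i x).
by rewrite AE; exists i.
Qed.

(** * Counting indices *)

Lemma card_two_blocks (a b c e : nat) : (a <= b)%N -> (b <= c)%N -> (c <= e)%N ->
  [set i | (a <= i < b)%N \/ (c <= i < e)%N] #= `I_(b - a + (e - c)).
Proof.
move=> ab bc ce.
pose g k := if (k < b - a)%N then (a + k)%N else (c + (k - (b - a)))%N.
have -> : [set i | (a <= i < b)%N \/ (c <= i < e)%N] = g @` `I_(b - a + (e - c)).
  apply/seteqP; split=> [i /= [h|h]|_ [k /= h <-]] /=.
  - exists (i - a)%N; rewrite /g /=; first by lia.
    by rewrite ifT; lia.
  - exists (i - c + (b - a))%N; rewrite /g /=; first by lia.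
    by rewrite ifF; [lia|apply/negbTE; rewrite -leqNgt; lia].
  - by rewrite /g; case: ifP => h'; [left|right]; lia.
apply: inj_card_eq => k l; rewrite !inE /= /g => h1 h2.
by case: ifP; case: ifP; lia.
Qed.

(** ** The folds *)

Section Fold.
Variables (R : realType) (F : R * R -> S2 R) (P : set (S2 R)).
Hypothesis pF : pillow F.

Let fold (x : R) : S2 R := kap F (0, dir (x, Num.sqrt (1 - x ^+ 2))).

Let circle_point (x : R) : -1 <= x <= 1 -> x ^+ 2 + Num.sqrt (1 - x ^+ 2) ^+ 2 = 1.
Proof.
move=> x1; have h : 0 <= 1 - x ^+ 2.
  by rewrite subr_ge0 -real_normK ?num_real // expr_le1 // ler_norml.
by rewrite (sqr_sqrtr h) addrCA subrr addr0.
Qed.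

Let fold_continuous : continuous fold.
Proof.
apply: (ct_comp (kap_continuous pF)); apply: ct_pair; first exact: ct_cst.
apply: ct_dir; last by ct.
move=> x; apply/eqP => -[x0]; rewrite x0 expr0n subr0 sqrtr1 => /eqP.
by rewrite oner_eq0.
Qed.

Let fold_inj x x' : -1 <= x <= 1 -> -1 <= x' <= 1 -> fold x = fold x' -> x = x'.
Proof.
have zxd (u : R) : -1 <= u <= 1 -> zx (dir (u, Num.sqrt (1 - u ^+ 2))) = u.
  by move=> u1; rewrite zx_dir //=; exact: circle_point.
have zc (z : S1 R) : zx (conjS z) = zx z by rewrite zx_dir //= sqrrN zxyP.
by move=> x1 x'1 /(kap0_eq pF) [] /(congr1 (@zx R)); rewrite ?zc !zxd.
Qed.

Let fold_surj z : exists2 x, -1 <= x <= 1 & fold x = kap F (0, z).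
Proof.
have zP := zxyP z; exists (zx z); first exact: zx_bound.
rewrite /fold; have -> : 1 - zx z ^+ 2 = zy z ^+ 2 by rewrite -[X in X - _]zP addrAC subrr add0r.
rewrite sqrtr_sqr; have [y0|y0] := leP 0 (zy z); first by rewrite ?ger0_norm ?dir_zxy.
by rewrite ?(ltr0_norm y0) -/(conjS z) (kap0_conj pF).
Qed.

(** The horizontal line at height 0 is folded onto an arc, so that every loop
    in its image contracts. *)
Lemma fold_null (C : set (S2 R)) (g : S1 R -> S2 R) :
  C = range (fun z => kap F (0, z)) -> C `&` P = set0 -> parametrizes g C ->
  null_homotopic R P C.
Proof.
move=> CE CP gC; have [cg ig gr] := gC.
have ex z : exists x, -1 <= x <= 1 /\ fold x = g z.
  have : C (g z) by rewrite -gr; exists z.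
  rewrite CE => -[w _ <-]; have [x x1 xw] := fold_surj w.
  by exists x.
have [w wP] := choice ex.
have cw : continuous w.
  apply/continuous_closedP => D cD.
  have -> : w @^-1` D = g @^-1` (fold @` (`[-1, 1] `&` D)).
    apply/seteqP; split=> [z Dz|z [x [/= x1 Dx] xz]] /=.
      by exists (w z); [split=> //=; rewrite in_itv; case: (wP z)|case: (wP z)].
    have -> // : w z = x.
    by have [w1 wz] := wP z; apply: fold_inj => //; rewrite wz.
  apply: ((continuous_closedP _).1 cg); apply: compact_closed; first exact: S2_hausdorff.
  apply: continuous_compact; first exact: continuous_subspaceT.
  by apply: compact_closedI => //; exact: segment_compact.
exists g, (fold 1); split=> //.
have cH : continuous (fun p : R * S1 R => fold ((1 - p.1) * w p.2 + p.1)).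
  by apply: (ct_comp fold_continuous); ct.
apply: (fh_of cH) => [t z /andP[t0 t1]|z|z] /=.
- move=> Px; have : (C `&` P) (fold ((1 - t) * w z + t)) by split=> //;
    rewrite CE; exists (dir ((1 - t) * w z + t, Num.sqrt (1 - ((1 - t) * w z + t) ^+ 2))).
  by rewrite CP.
- by rewrite subr0 mul1r addr0; case: (wP z).
- by rewrite subrr mul0r add0r.
Qed.

End Fold.

(** * The components of the preimage of a curve *)

Section Components.
Variables (R : realType) (f : S2 R -> S2 R) (G F2 : R * R -> S2 R).
Variables (d d' : nat) (j : int) (P : set (S2 R)).
Hypotheses (d0 : (0 < d)%N) (d'0 : (0 < d')%N).
Hypotheses (G_ct : continuous G) (G_surj : forall w, exists x, G x = w).

(** The analogue of the pillow group for the lattice with basis (d, 0), (j, d'). *)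
Definition sub_shift (x y : R * R) : Prop := exists m n : int,
  let v := (2 * (d%:R * m%:~R + j%:~R * n%:~R), 2 * (d'%:R * n%:~R)) in
  y = (x.1 + v.1, x.2 + v.2) \/ y = (- x.1 + v.1, - x.2 + v.2).

Hypothesis GP : forall x y, G x = G y <-> sub_shift x y.
Hypothesis fG : forall x, f (G x) = F2 x.
Hypotheses (pF2 : pillow F2) (F2P : forall x, integral_point x -> P (F2 x)).
Hypothesis fP : forall w, P w -> P (f w).

Let dR : 0 < (d%:R : R). Proof. by rewrite ltr0n. Qed.
Let d'R : 0 < (d'%:R : R). Proof. by rewrite ltr0n. Qed.

(** A shear and a rescaling turn that lattice into the integral one, and heights
    h into h / d'. *)
Definition F1 (x : R * R) : S2 R := G (d%:R * x.1 + j%:~R * x.2, d'%:R * x.2).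

Lemma F1_pillow : pillow F1.
Proof.
have dn : (d%:R : R) != 0 by rewrite gt_eqF.
have dn' : (d'%:R : R) != 0 by rewrite gt_eqF.
split.
- by apply: (ct_comp G_ct); ct.
- move=> w; have [[a b] ab] := G_surj w.
  exists ((a - j%:~R * (b / d'%:R)) / d%:R, b / d'%:R); rewrite -ab /F1 /=.
  by congr (G (_, _)); field; rewrite ?dn ?dn'.
- move=> [a b] [a' b']; rewrite /F1 GP /=; split=> -[m [n]] /= [[e1 e2]|[e1 e2]]; exists m, n; [left|right|left|right].
  + have b'E : b' = b + 2 * n%:~R by apply: (mulfI dn'); rewrite e2; ring.
    congr pair => //; apply: (mulfI dn).
    by rewrite -[LHS](addrK (j%:~R * b')) e1 b'E /=; ring.
  + have b'E : b' = - b + 2 * n%:~R by apply: (mulfI dn'); rewrite e2; ring.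
    congr pair => //; apply: (mulfI dn).
    by rewrite -[LHS](addrK (j%:~R * b')) e1 b'E /=; ring.
  + by rewrite e1 e2 /=; congr pair; ring.
  + by rewrite e1 e2 /=; congr pair; ring.
Qed.

(** A map out of the circle is given by a function on the line that advances by
    (d, 0) times the angle over pi. *)
Definition turn (A B : R * S1 R -> R) (x : R * S1 R) : S2 R :=
  G (A x + d%:R * (arg x.2 / pi), B x).

Lemma G_shift x (m : int) : G (x.1 + 2 * (d%:R * m%:~R), x.2) = G x.
Proof. by apply/esym/GP; exists m, 0; left; rewrite /= !mulr0 !addr0. Qed.

Lemma turnE A B t a : turn A B (t, E (pi * a)) =
  G (A (t, E (pi * a)) + d%:R * a, B (t, E (pi * a))).
Proof.
have p0 : (pi : R) != 0 by rewrite gt_eqF ?pi_gt0.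
have /E_pi_eq[m am] : E (pi * (arg (E (pi * a)) / pi)) = E (pi * a).
  by rewrite mulrC divfK // argK.
rewrite /turn /=; move: am; set z := E (pi * a) => am.
by rewrite [in RHS]am -[LHS](G_shift _ m) /=; congr (G (_, _)); ring.
Qed.

Lemma turn_continuous A B : continuous A -> continuous B -> continuous (turn A B).
Proof.
move=> cA cB; apply: E_factor2.
have p0 : (pi : R) != 0 by rewrite gt_eqF ?pi_gt0.
rewrite (_ : (fun _ => _) =
    (fun x : R * R => G (A (x.1, E x.2) + d%:R * (x.2 / pi), B (x.1, E x.2)))).
  by apply: (ct_comp G_ct); ct.
apply/funext => -[t s] /=; have {1}-> : s = pi * (s / pi) by rewrite mulrC divfK.
by rewrite turnE mulrC divfK // mulrC divfK.
Qed.

Variables (delta : set (S2 R)) (y0 : R) (V : R * S1 R -> R * R) (gamma : S1 R -> S2 R).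
Hypotheses (y01 : 0 < y0 < 1) (V_ct : continuous V).
Hypothesis gammaP : parametrizes gamma delta.
Hypothesis gammaE : forall a,
  gamma (E (pi * a)) = F2 ((V (0, E (pi * a))).1 + a, (V (0, E (pi * a))).2).
Hypothesis V_off : forall t a, 0 <= t <= 1 ->
  ~ P (F2 ((V (t, E (pi * a))).1 + a, (V (t, E (pi * a))).2)).
Hypothesis V1 : forall z, (V (1, z)).2 = y0.

(** The lifts of delta to the plane are translates of the path given by V and of
    its half-turn; the i-th one is isotopic to a line whose height lies between
    i and i + 1. *)
Definition shift_of (i : nat) : nat := i + odd i.
Definition flip (o : bool) (z : S1 R) : S1 R := if o then conjS z else z.
Definition liftA (i : nat) (x : R * S1 R) : R :=
  (-1) ^+ odd i * (V (x.1, flip (odd i) x.2)).1.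
Definition liftB (i : nat) (x : R * S1 R) : R :=
  (-1) ^+ odd i * (V (x.1, flip (odd i) x.2)).2 + (shift_of i)%:R.
Definition lift (i : nat) (t a : R) : R * R :=
  (liftA i (t, E (pi * a)) + a, liftB i (t, E (pi * a))).

Definition level (i : nat) : R := (-1) ^+ odd i * y0 + (shift_of i)%:R.

Lemma level_bounds i : i%:R < level i < i.+1%:R.
Proof.
have y01' := y01; rewrite /level /shift_of -(natr1 i).
by case: (odd i); rewrite ?addn0 ?addn1 -?(natr1 i) ?expr1 ?expr0; lra.
Qed.

Lemma flipE o a : flip o (E (pi * a)) = E (pi * ((-1) ^+ o * a)).
Proof. by case: o; rewrite /flip ?conjSE ?mulN1r ?mul1r ?mulrN. Qed.

Lemma flipK o z : flip o (flip o z) = z.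
Proof. by case: o => //=; exact: conjSK. Qed.

Lemma flip_continuous o : continuous (flip o).
Proof. by case: o; [exact: conjS_continuous|exact: ct_id]. Qed.

Lemma F2_lift i t a : F2 (lift i t a) =
  F2 ((V (t, E (pi * ((-1) ^+ odd i * a)))).1 + (-1) ^+ odd i * a,
      (V (t, E (pi * ((-1) ^+ odd i * a)))).2).
Proof.
rewrite /lift /liftA /liftB /= flipE; set v := V _.
have [k kE] : exists k : int, (shift_of i)%:R = 2 * k%:~R :> R.
  exists (shift_of i)./2%:Z.
  have /even_halfK {1}<- : ~~ odd (shift_of i) by rewrite /shift_of oddD oddb addbb.
  by rewrite -muln2 natrM mulrC -pmulrn.
apply/(pillowP pF2); case: (odd i); [exists 0, k; right|exists 0, (- k); left];
  rewrite /= ?expr1 ?expr0 kE mulr0 addr0 ?mulrNz; congr pair; ring.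
Qed.

Lemma gamma_lift i a : gamma (flip (odd i) (E (pi * a))) = F2 (lift i 0 a).
Proof. by rewrite F2_lift flipE gammaE. Qed.

Lemma lift_not_integral i a : ~ integral_point (lift i 0 a).
Proof.
move=> /F2P; rewrite F2_lift; apply: V_off; by rewrite lexx ler01.
Qed.

Lemma lift_period i (k : int) a : lift i 0 (a + 2 * k%:~R) =
  ((lift i 0 a).1 + 2 * k%:~R, (lift i 0 a).2).
Proof.
have e : E (pi * (a + 2 * k%:~R)) = E (pi * a) by apply/esym/E_pi_eq; exists k.
by rewrite /lift /= e addrA.
Qed.

(** As delta is simple, two points of a lift over the same point of delta differ
    by an even shift along the lift. *)
Lemma lift_same i a a' : F2 (lift i 0 a) = F2 (lift i 0 a') ->
  exists k : int, lift i 0 a' = ((lift i 0 a).1 + 2 * k%:~R, (lift i 0 a).2) /\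
    a' = a + 2 * k%:~R.
Proof.
have [_ ig _] := gammaP.
rewrite -!gamma_lift => /ig /(congr1 (flip (odd i))); rewrite !flipK => /E_pi_eq [k ->].
by exists k; rewrite lift_period.
Qed.

Lemma lift_parity i i' a : odd i = odd i' ->
  lift i' 0 a = ((lift i 0 a).1, (lift i 0 a).2 + (i'%:R - i%:R)).
Proof.
move=> oi; rewrite /lift /liftA /liftB /= -oi; congr pair.
by rewrite /shift_of -oi !natrD; ring.
Qed.

(** The half-turn exchanges lifts of opposite parities. *)
Lemma lift_opposite i i' a : odd i != odd i' ->
  lift i' 0 (- a) = (- (lift i 0 a).1, - (lift i 0 a).2 + (i%:R + i'%:R + 1)).
Proof.
move=> oi; have oi' : odd i' = ~~ odd i by case: (odd i) (odd i') oi => -[].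
rewrite /lift /liftA /liftB /= !flipE oi' /shift_of oi' !natrD.
by case: (odd i); rewrite /= ?expr1 ?expr0 ?mulN1r ?mul1r ?mulrN ?mulN1r ?opprK; congr pair; ring.
Qed.

(** The i-th lift, run along d times: under G it closes up after d of the turns
    of delta, and it is followed here during the isotopy given by V. *)
Definition moving (i : nat) : R * S1 R -> S2 R :=
  turn (fun x => liftA i (x.1, powS d x.2)) (fun x => liftB i (x.1, powS d x.2)).

Definition component (i : nat) (z : S1 R) : S2 R := moving i (0, z).

Lemma powS_pi (a : R) : powS d (E (pi * a)) = E (pi * (d%:R * a)).
Proof. by rewrite powSE mulrCA. Qed.

Lemma movingE i t a : moving i (t, E (pi * a)) = G (lift i t (d%:R * a)).
Proof. by rewrite /moving turnE /= powS_pi. Qed.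

Lemma liftA_continuous i : continuous (liftA i).
Proof. by rewrite /liftA; have cf := @flip_continuous (odd i); ct. Qed.

Lemma liftB_continuous i : continuous (liftB i).
Proof. by rewrite /liftB; have cf := @flip_continuous (odd i); ct. Qed.

Lemma moving_continuous i : continuous (moving i).
Proof.
have cA := @liftA_continuous i; have cB := @liftB_continuous i.
have cp := @powS_continuous R d.
by apply: turn_continuous; ct.
Qed.

Lemma f_moving i t a : f (moving i (t, E (pi * a))) = F2 (lift i t (d%:R * a)).
Proof. by rewrite movingE fG. Qed.

Lemma moving_off i t z : 0 <= t <= 1 -> ~ P (moving i (t, z)).
Proof.
have [a <-] := Epi_surj z; move=> t01 /fP; rewrite f_moving F2_lift.
exact: V_off.
Qed.

Lemma comp_continuous i : continuous (component i).
Proof. by rewrite /component; have cm := @moving_continuous i; ct. Qed.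

Lemma compE i a : component i (E (pi * a)) = G (lift i 0 (d%:R * a)).
Proof. exact: movingE. Qed.

Lemma range_comp i : range (component i) = [set G (lift i 0 a) | a in [set: R]].
Proof.
apply/seteqP; split=> [_ [z _ <-]|_ [a _ <-]].
  by have [a <-] := Epi_surj z; exists (d%:R * a) => //; rewrite compE.
exists (E (pi * (a / d%:R))) => //; rewrite compE; congr (G (lift _ _ _)).
by rewrite mulrC divfK // gt_eqF.
Qed.

(** An even shift along the lift by 2 k lies in the group of G only if d divides k,
    and a half-turn in place of a shift would make a point of the lift integral. *)
Lemma comp_inj i : injective (component i).
Proof.
move=> z w; have [a <-] := Epi_surj z; have [a' <-] := Epi_surj w.
rewrite !compE => e; have := congr1 f e; rewrite !fG => /lift_same [k [lE aE]].
move: e => /GP [m [n]] /=; rewrite lE => -[[e1 e2]|[e1 e2]].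
  have n0 : (n%:~R : R) = 0.
    apply: (mulfI (lt0r_neq0 d'R)); rewrite mulr0.
    by move: e2; rewrite -{1}[liftB _ _]addr0 => /addrI; lra.
  have kE : (k%:~R : R) = d%:R * m%:~R.
    by move: e1; rewrite n0 mulr0 addr0 => /addrI; lra.
  apply/E_pi_eq; exists m; apply: (mulfI (lt0r_neq0 dR)); rewrite aE kE; ring.
exfalso; apply: (@lift_not_integral i (d%:R * a)).
exists (d%:Z * m + j * n - k), (d'%:Z * n).
rewrite intrB intrD !intrM -!pmulrn; congr pair.
  by move: e1; set u := liftA _ _ + _; lra.
by move: e2; set u := liftB _ _; lra.
Qed.

(** The heights of points of two lifts over the same point of delta differ by
    i' - i or add up to i + i' + 1, according to the parities. The group of G only
    allows multiples of 2 d' there, unless a point of the lift is integral. *)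
Lemma comp_disjoint i i' a a' : (i < d')%N -> (i' < d')%N ->
  G (lift i 0 a) = G (lift i' 0 a') -> i = i'.
Proof.
move=> id' i'd' e; have := congr1 f e; rewrite !fG.
have [_ ig _] := gammaP.
have [oi|oi] := eqVneq (odd i) (odd i').
  have eF : F2 (lift i' 0 a') = F2 (lift i 0 a') by rewrite -!gamma_lift oi.
  rewrite eF => /lift_same [k [lE _]].
  move: e => /GP [m [n]]; rewrite (lift_parity a' oi) lE /=.
  set u := (lift i 0 a).1; set v := (lift i 0 a).2 => -[[_ e2]|[e1 e2]].
    have e3 : ((i'%:Z - i%:Z)%:~R : R) = (2 * (d'%:Z * n))%:~R.
      by rewrite intrB !intrM -!pmulrn; lra.
    move/eqP: e3; rewrite eqr_int => /eqP e3.
    have : n = 0 by nia.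
    by move=> n0; move: e3; rewrite n0; lia.
  exfalso; apply: (@lift_not_integral i a).
  have [q qE] : exists q : int, i'%:Z - i%:Z = 2 * q.
    have := odd_double_half i; have := odd_double_half i'; rewrite oi => h1 h2.
    by exists (i'./2%:Z - i./2%:Z); lia.
  have qR : (i'%:R - i%:R : R) = 2 * q%:~R.
    by rewrite !pmulrn -intrB qE intrM.
  exists (d%:Z * m + j * n - k), (d'%:Z * n - q).
  rewrite [LHS]surjective_pairing -/u -/v !intrB intrD !intrM -!pmulrn.
  by congr pair; rewrite /u /v /lift /=; lra.
have fl : flip (odd i) (E (pi * - a')) = flip (odd i') (E (pi * a')).
  by rewrite !flipE; congr (E (pi * _)); case: (odd i) (odd i') oi => -[] //= _; rewrite ?expr0 ?expr1; ring.
have eF : F2 (lift i' 0 a') = F2 (lift i 0 (- a')) by rewrite -!gamma_lift fl.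
rewrite eF => /lift_same [k [lE _]].
move: e => /GP [m [n]]; rewrite -[a']opprK (lift_opposite _ oi) lE /=.
set u := (lift i 0 a).1; set v := (lift i 0 a).2 => -[[e1 e2]|[_ e2]].
  exfalso; apply: (@lift_not_integral i a).
  have [q qE] : exists q : int, i%:Z + i'%:Z + 1 = 2 * q.
    have := odd_double_half i; have := odd_double_half i'.
    by exists (i'./2%:Z + i./2%:Z + 1); case: (odd i) (odd i') oi H H0 => -[] //= _; lia.
  have qR : (i%:R + i'%:R + 1 : R) = 2 * q%:~R.
    by have := congr1 (fun z : int => z%:~R : R) qE; rewrite /= !intrD intrM -!pmulrn.
  exists (- (d%:Z * m + j * n) - k), (q - d'%:Z * n).
  rewrite [LHS]surjective_pairing -/u -/v !intrB mulrNz intrD !intrM -!pmulrn.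
  by congr pair; rewrite /u /v /lift /=; lra.
have e3 : ((i%:Z + i'%:Z + 1)%:~R : R) = (2 * (d'%:Z * n))%:~R.
  by rewrite !intrD !intrM -!pmulrn; lra.
move/eqP: e3; rewrite eqr_int => /eqP e3.
exfalso; have [n0|n0] : (n <= 0)%R \/ (1 <= n)%R by lia.
  have : (d'%:Z * n <= 0)%R by nia.
  lia.
have : (d'%:Z <= d'%:Z * n)%R by nia.
lia.
Qed.

(** Any lift of delta differs from the one with index 0 by an even translation
    and maybe a half-turn; the group of G brings its index below d'. *)
Lemma comp_cover x : delta (f (G x)) ->
  exists2 i, (i < d')%N & exists a, G x = G (lift i 0 a).
Proof.
have [_ _ gd] := gammaP.
pose X a := lift 0 0 a.
have XE b (k : int) : X (b + 2 * k%:~R) = ((X b).1 + 2 * k%:~R, (X b).2) := lift_period 0 k b.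
suff main y b (m n : int) : y = ((X b).1 + 2 * m%:~R, (X b).2 + 2 * n%:~R) ->
    exists2 i, (i < d')%N & exists a, G y = G (lift i 0 a).
  rewrite fG -gd => -[z _]; have [b <-] := Epi_surj z => ge.
  have : F2 (X b) = F2 x by rewrite -gamma_lift.
  move=> /(pillowP pF2) [m [n [e|e]]]; first exact: main e.
  have rot : G x = G (- x.1, - x.2).
    by apply/GP; exists 0, 0; right; rewrite /= !mulr0 !addr0 !mulr0 !addr0.
  have e' : (- x.1, - x.2) = ((X b).1 + 2 * (- m)%:~R, (X b).2 + 2 * (- n)%:~R).
    by rewrite e /= !mulrNz; congr pair; ring.
  by rewrite rot; exact: main e'.
move=> ->; pose q := (n %/ d'%:Z)%Z; pose r := `|(n %% d'%:Z)%Z|%N.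
have r0 : (0 <= (n %% d'%:Z)%Z)%R by apply: modz_ge0; lia.
have nE : n = q * d'%:Z + r%:Z by rewrite /r gez0_abs // -divz_eq.
have nR : (n%:~R : R) = q%:~R * d'%:R + r%:R by rewrite nE intrD intrM -!pmulrn.
have [rr|rr] := ltnP (r + r) d'.
  exists (r + r)%N => //; exists (b + 2 * (m - j * q)%:~R).
  have o : odd 0 = odd (r + r) by rewrite oddD addbb.
  rewrite (lift_parity _ o) -/(X _) XE /=; apply/esym/GP; exists 0, q; left.
  by rewrite /= nR intrB intrM natrD; congr pair; ring.
exists (d' + d' - (r + r)).-1; first by lia.
exists (- (b + 2 * (m - j * (q + 1))%:~R)).
have iE : (d' + d' - (r + r)).-1.+1 = (d' + d' - (r + r))%N by lia.
have o : odd 0 != odd (d' + d' - (r + r)).-1.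
  have : odd (d' + d' - (r + r)).-1.+1 = false by rewrite iE oddB ?oddD ?addbb //; lia.
  by rewrite /=; case: odd.
rewrite (lift_opposite _ o) -/(X _) XE /=; apply/esym/GP; exists 0, (q + 1); right.
have iR : ((d' + d' - (r + r)).-1%:R + 1 : R) = 2 * d'%:R - 2 * r%:R.
  by rewrite natr1 iE natrB ?natrD; [ring|lia].
rewrite /= nR intrB intrM intrD add0r iR; congr pair; ring.
Qed.

Lemma preimage_components :
  components (f @^-1` delta) = (fun i => range (component i)) @` `I_d'.
Proof.
have [_ _ gd] := gammaP.
apply: components_finite.
- apply/seteqP; split=> [w|w [i /= id'] [z _ <-]] /=.
    have [x <-] := G_surj w; move=> /comp_cover [i id' [a ->]].
    by exists i => //; rewrite range_comp; exists a.
  have [a <-] := Epi_surj z.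
  by rewrite /component f_moving -gamma_lift -gd; eexists.
- move=> i _; apply: compact_closed; first exact: S2_hausdorff.
  apply: continuous_compact; last exact: S1_compact.
  exact/continuous_subspaceT/comp_continuous.
- move=> i _; apply: connected_continuous_connected; first exact: S1_connected.
  exact/continuous_subspaceT/comp_continuous.
- by move=> i _; exists (component i (E 0)); exists (E 0).
- move=> i i' id' i'd' [w]; rewrite !range_comp => -[[a _ <-] [a' _ /esym]].
  exact: comp_disjoint.
Qed.

Lemma comp_parametrizes i : parametrizes (component i) (range (component i)).
Proof. by split=> //; [exact: comp_continuous|exact: comp_inj]. Qed.

Lemma comp_degree i : maps_with_degree R f (range (component i)) delta d.
Proof.
have [cg ig gd] := gammaP.
exists (component i), (gamma \o flip (odd i)), (powS d); split.
- exact: comp_parametrizes.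
- split.
  + by have cf := @flip_continuous (odd i); move=> z; apply: continuous_comp; [exact: cf|exact: cg].
  + by move=> z w /ig /(congr1 (flip (odd i))); rewrite !flipK.
  + rewrite -gd; apply/seteqP; split=> [_ [z _ <-]|_ [z _ <-]]; first by exists (flip (odd i) z).
    by exists (flip (odd i) z) => //=; rewrite flipK.
- move=> z; have [a <-] := Epi_surj z.
  by rewrite /component f_moving -gamma_lift /= powS_pi.
- exact: powS_covering.
- exact: powS_fiber.
Qed.

Hypothesis P_integral : forall x, P (G x) -> integral_point x.

Lemma level_not_int i (n : int) : level i <> n%:~R.
Proof.
move=> e; have /andP[] := level_bounds i; rewrite e.
by rewrite [i%:R]pmulrn [i.+1%:R]pmulrn !ltr_int; lia.
Qed.

(** The isotopy V moves the component to a curve at constant height, which is then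
    made horizontal; since the punctures lift to integral points, a curve at a
    non-integral height never meets them. *)
Lemma comp_homotopic i :
  freely_homotopic P (component i) (fun z => kap F1 (level i / d'%:R, z)).
Proof.
have dn' : (d'%:R : R) != 0 by rewrite gt_eqF.
apply: (@fh_trans R _ P (fun z => moving i (1, z))).
  by apply: (fh_of (@moving_continuous i)) => // t z; exact: moving_off.
pose c : R := j%:~R * (level i / d'%:R).
pose A (x : R * S1 R) := (1 - x.1) * liftA i (1, powS d x.2) + x.1 * c.
have cA : continuous A.
  have cl := @liftA_continuous i; have cp := @powS_continuous R d.
  by rewrite /A; ct.
have cT : continuous (turn A (fun=> level i)) by apply: turn_continuous => //; ct.
apply: (fh_of cT) => [t z _|z|z]; have [a <-] := Epi_surj z; rewrite ?turnE.
- by move=> /P_integral [m [n [_ /level_not_int]]].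
- rewrite /A /= subr0 mul1r mul0r addr0 movingE /lift powS_pi; congr (G (_, _)).
  by rewrite /liftB /= V1.
- rewrite (kapE F1_pillow) /A /= subrr mul0r add0r mul1r /F1 /=.
  by congr (G (_, _)); [rewrite addrC|rewrite mulrC divfK].
Qed.

Variables (c1 c2 c3 c4 : nat).
Hypothesis pu : punctures F1 P (c1%:R / d'%:R) (c2%:R / d'%:R) (c3%:R / d'%:R) (c4%:R / d'%:R).

Lemma coset_le : [/\ (c1 <= c2)%N, (c2 <= c3)%N, (c3 <= c4)%N & (c4 <= d')%N].
Proof.
have [_ [_ h12 h23 h34 h4]] := pu.
move: h12 h23 h34 h4; rewrite !ler_pM2r ?invr_gt0 // !ler_nat ler_pdivrMr // mul1r ler_nat.
by [].
Qed.

Lemma level_type (u : R) (C : set (S2 R)) (alpha : S1 R -> S2 R) : 0 < u < d'%:R ->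
  parametrizes alpha C -> freely_homotopic P alpha (fun z => kap F1 (u / d'%:R, z)) ->
  [/\ u < c1%:R \/ c4%:R < u -> null_homotopic R P C /\ ~ peripheral R P C,
      c1%:R < u < c2%:R \/ c3%:R < u < c4%:R -> peripheral R P C /\ ~ null_homotopic R P C
    & c2%:R < u < c3%:R -> ~ null_homotopic R P C /\ ~ peripheral R P C].
Proof.
move=> /andP[u0 ud] aC au.
have u01 : 0 < u / d'%:R < 1 by rewrite divr_gt0 //= ltr_pdivrMr // mul1r.
have := horizontal_type F1_pillow pu u01 aC au.
by rewrite !ltr_pM2r ?invr_gt0.
Qed.

(** The i-th component lies between the heights i and i + 1, and the punctures
    are at the integral heights c1, ..., c4. *)
Lemma comp_type i : (i < d')%N ->
  [/\ (i < c1)%N \/ (c4 <= i)%N ->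
        null_homotopic R P (range (component i)) /\ ~ peripheral R P (range (component i)),
      (c1 <= i < c2)%N \/ (c3 <= i < c4)%N ->
        peripheral R P (range (component i)) /\ ~ null_homotopic R P (range (component i))
    & (c2 <= i < c3)%N ->
        ~ null_homotopic R P (range (component i)) /\ ~ peripheral R P (range (component i))].
Proof.
move=> id'; have /andP[l0 l1] := level_bounds i.
have low c : (c <= i)%N -> (c%:R : R) < level i.
  by move=> ci; apply: le_lt_trans l0; rewrite ler_nat.
have high c : (i < c)%N -> level i < (c%:R : R).
  by move=> ci; apply: lt_le_trans l1 _; rewrite ler_nat.
have [|t1 t2 t3] := level_type _ (comp_parametrizes i) (comp_homotopic i).
  by apply/andP; split; [apply: (low 0)|exact: high].
split.
- by case=> h; apply: t1; [left; exact: high|right; exact: low].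
- by case=> /andP[h h']; apply: t2; [left|right]; rewrite low // high.
- by move=> /andP[h h']; apply: t3; rewrite low // high.
Qed.

Lemma comp_essential i : (i < d')%N -> (c2 <= i < c3)%N ->
  essential_nonperipheral R P (range (component i)).
Proof.
move=> id' ci; have [_ _ /(_ ci) [nn np]] := comp_type id'.
split=> //; split; first by exists (component i); exact: comp_parametrizes.
apply/seteqP; split=> // w [[z _ <-]]; apply: moving_off.
by rewrite lexx ler01.
Qed.

Lemma comp_cases i : (i < d')%N ->
  [\/ (i < c1)%N \/ (c4 <= i)%N, (c1 <= i < c2)%N \/ (c3 <= i < c4)%N | (c2 <= i < c3)%N].
Proof.
have [h12 h23 h34 h4] := coset_le; move=> id'.
have [h|h] := ltnP i c1; first by apply: Or31; left.
have [h'|h'] := ltnP i c2; first by apply: Or32; left; lia.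
have [h''|h''] := ltnP i c3; first by apply: Or33; lia.
have [h3|h3] := ltnP i c4; first by apply: Or32; right; lia.
by apply: Or31; right.
Qed.

Lemma count_components (Q : set (S2 R) -> Prop) (a b c e : nat) :
  (a <= b)%N -> (b <= c)%N -> (c <= e)%N -> (e <= d')%N ->
  (forall i, (i < d')%N -> Q (range (component i)) <-> (a <= i < b)%N \/ (c <= i < e)%N) ->
  [set K | components (f @^-1` delta) K /\ Q K] #= `I_(b - a + (e - c)).
Proof.
move=> ab bc ce ed Qi; apply: card_eq_trans (card_two_blocks ab bc ce).
have -> : [set K | components (f @^-1` delta) K /\ Q K] =
    (fun i => range (component i)) @` [set i | (a <= i < b)%N \/ (c <= i < e)%N].
  rewrite preimage_components; apply/seteqP; split=> [_ [[i id' <-]] /(Qi _ id') h|_ [i h <-]].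
    by exists i.
  have id' : (i < d')%N by case: h; lia.
  by split; [exists i|exact/(Qi _ id')].
apply: inj_card_eq => i i' /set_mem hi /set_mem hi' e1.
have id' : (i < d')%N by case: hi; lia.
have i'd' : (i' < d')%N by case: hi'; lia.
have : range (component i') (component i (E 0)) by rewrite -e1; exists (E 0).
have : range (component i) (component i (E 0)) by exists (E 0).
rewrite !range_comp => -[a1 _ <-] [a2 _ /esym].
exact: comp_disjoint.
Qed.

Lemma count_essential :
  [set K | components (f @^-1` delta) K /\ essential_nonperipheral R P K] #= `I_(c3 - c2).
Proof.
have [h12 h23 h34 h4] := coset_le.
have := @count_components (essential_nonperipheral R P) c2 c3 c3 c3 h23 (leqnn _) (leqnn _).
rewrite subnn addn0; apply; first exact: leq_trans h4.
move=> i id'; split=> [[_ nn np]|[h|]]; last by lia.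
  have [t1 t2 _] := comp_type id'.
  by case: (comp_cases id') => [/t1[]|/t2[]|h] //; left.
exact: comp_essential.
Qed.

Lemma count_peripheral :
  [set K | components (f @^-1` delta) K /\ peripheral R P K] #= `I_(c2 - c1 + (c4 - c3)).
Proof.
have [h12 h23 h34 h4] := coset_le.
apply: count_components => // i id'; have [t1 t2 t3] := comp_type id'.
split=> [p|/t2[] //].
by case: (comp_cases id') => [/t1[]|h|/t3[]].
Qed.

Lemma count_null :
  [set K | components (f @^-1` delta) K /\ null_homotopic R P K] #= `I_(c1 + (d' - c4)).
Proof.
have [h12 h23 h34 h4] := coset_le.
have := @count_components (null_homotopic R P) 0 c1 c4 d' (leq0n _) _ h4 (leqnn _).
rewrite subn0; apply; first by lia.
move=> i id'; have [t1 t2 t3] := comp_type id'; split=> [n|h].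
  case: (comp_cases id') => [[h|h]|/t2[]|/t3[]] //; first by left.
  by right; rewrite h.
suff /t1[] : (i < c1)%N \/ (c4 <= i)%N by [].
by case: h => /andP[]; [left|right].
Qed.

(** ** Lines of the given slope *)

Definition level_curve (y : R) : set (S2 R) := [set G (a, y) | a in [set: R]].

Lemma level_curve_range (u : R) : level_curve u = range (fun z => kap F1 (u / d'%:R, z)).
Proof.
have dn : (d%:R : R) != 0 by rewrite gt_eqF.
have dn' : (d'%:R : R) != 0 by rewrite gt_eqF.
have e a : kap F1 (u / d'%:R, E (pi * a)) = G (d%:R * a + j%:~R * (u / d'%:R), u).
  by rewrite (kapE F1_pillow) /F1 /= [d'%:R * _]mulrC divfK.
apply/seteqP; split=> [_ [a _ <-]|_ [z _ <-]].
  exists (E (pi * ((a - j%:~R * (u / d'%:R)) / d%:R))) => //.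
  by rewrite e; congr (G (_, _)); rewrite [d%:R * _]mulrC divfK // subrK.
by have [a <-] := Epi_surj z; exists (d%:R * a + j%:~R * (u / d'%:R)).
Qed.

Lemma level_curve_parametrizes (u : R) : 0 < u < d'%:R ->
  parametrizes (fun z => kap F1 (u / d'%:R, z)) (level_curve u).
Proof.
move=> /andP[u0 ud]; split; last by rewrite level_curve_range.
- have ck := kap_continuous F1_pillow.
  by apply: (ct_comp ck); ct.
- have u1 : 0 <= u / d'%:R < 1 by rewrite divr_ge0 ?(ltW u0) ?(ltW d'R) //= ltr_pdivrMr // mul1r.
  by move=> z w /(kap_inj F1_pillow u1 u1) [_]; apply; rewrite divr_gt0.
Qed.

Lemma level_curve_fold (y : R) : exists (o : bool) (n : int) (u : R),
  [/\ 0 <= u <= d'%:R, y = (-1) ^+ o * u + 2 * (d'%:R * n%:~R) & level_curve y = level_curve u].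
Proof.
have dn' : (d'%:R : R) != 0 by rewrite gt_eqF.
have rowE (o : bool) (n : int) (u : R) : y = (-1) ^+ o * u + 2 * (d'%:R * n%:~R) -> level_curve y = level_curve u.
  move=> yE; have shift a : G ((-1) ^+ o * a + 2 * (j%:~R * n%:~R), y) = G (a, u).
    apply/esym/GP; exists 0, n; rewrite yE /=; case: o yE => _; [right|left];
      by rewrite mulr0 add0r ?expr1 ?expr0 ?mulN1r ?mul1r.
  apply/seteqP; split=> [_ [a _ <-]|_ [a _ <-]].
    exists ((-1) ^+ o * (a - 2 * (j%:~R * n%:~R))) => //.
    by rewrite -shift mulrA -expr2 sqrr_sign mul1r subrK.
  by exists ((-1) ^+ o * a + 2 * (j%:~R * n%:~R)).
have [n n2 _] := mod2 (y / d'%:R).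
have yE : y = d'%:R * (y / d'%:R) by rewrite mulrC divfK.
have [h|h] := leP (y / d'%:R + 2 * n%:~R) 1.
  exists false, (- n), (d'%:R * (y / d'%:R + 2 * n%:~R)).
  have e : y = (-1) ^+ false * (d'%:R * (y / d'%:R + 2 * n%:~R)) + 2 * (d'%:R * (- n)%:~R).
    by rewrite expr0 mul1r mulrNz; field.
  split=> //; last exact: rowE e.
  case/andP: n2 => n2 _; rewrite mulr_ge0 ?(ltW d'R) //=.
  by rewrite -[leRHS]mulr1 ler_pM2l.
exists true, (1 - n), (d'%:R * (2 - (y / d'%:R + 2 * n%:~R))).
have e : y = (-1) ^+ true * (d'%:R * (2 - (y / d'%:R + 2 * n%:~R))) + 2 * (d'%:R * (1 - n)%:~R).
  by rewrite expr1 intrB; field.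
split=> //; last exact: rowE e.
case/andP: n2 => _ n2; rewrite mulr_ge0 ?(ltW d'R) ?subr_ge0 //=.
rewrite -[leRHS]mulr1 ler_pM2l //; lra.
Qed.

Lemma level_curve_essential (u : R) : c2%:R < u < c3%:R -> essential_nonperipheral R P (level_curve u).
Proof.
move=> /[dup] u23 /andP[u2 u3]; have [h12 h23 h34 h4] := coset_le.
have u0d : 0 < u < d'%:R.
  rewrite (le_lt_trans _ u2) ?ler0n //=; apply: lt_le_trans u3 _.
  by rewrite ler_nat (leq_trans h34).
have par := level_curve_parametrizes u0d.
have uP : level_curve u `&` P = set0.
  apply/seteqP; split=> // _ [[a _ <-] Pa].
  have [[x1 [x2 [x3 [x4 [z1 [z2 [z3 [z4 [Pdef [e1 e2 e3 e4] _]]]]]]]]] _] := pu.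
  have ga : level_curve u (G (a, u)) by exists a.
  have u01 : 0 <= u / d'%:R <= 1.
    by case/andP: u0d => u0 ud; rewrite divr_ge0 ?(ltW u0) ?(ltW d'R) //= ler_pdivrMr // mul1r ltW.
  have hk (c : nat) z : (c <= d')%N -> G (a, u) = kap F1 (c%:R / d'%:R, z) -> u = c%:R.
    move=> cd; move: ga; rewrite level_curve_range => -[w _ <-] /(kap_height F1_pillow u01).
    have c01 : 0 <= (c%:R / d'%:R : R) <= 1.
      by rewrite divr_ge0 ?(ltW d'R) ?ler0n //= ler_pdivrMr // mul1r ler_nat.
    by move=> /(_ c01) /(mulIf (invr_neq0 (lt0r_neq0 d'R))).
  have h23' : (c1%:R : R) <= c2%:R by rewrite ler_nat.
  have h34' : (c3%:R : R) <= c4%:R by rewrite ler_nat.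
  case/Pdef: Pa => xE; move: (xE); rewrite ?e1 ?e2 ?e3 ?e4 => /hk uE.
  - by have := uE (leq_trans h12 (leq_trans h23 (leq_trans h34 h4))); lra.
  - by have := uE (leq_trans h23 (leq_trans h34 h4)); lra.
  - by have := uE (leq_trans h34 h4); lra.
  - by have := uE h4; lra.
have zu z : level_curve u (kap F1 (u / d'%:R, z)) by rewrite level_curve_range; exists z.
have hfh : freely_homotopic P (fun z => kap F1 (u / d'%:R, z)) (fun z => kap F1 (u / d'%:R, z)).
  have ck := kap_continuous F1_pillow.
  have ch : continuous (fun x : R * S1 R => kap F1 (u / d'%:R, x.2)) by apply: (ct_comp ck); ct.
  apply: (fh_of ch) => // t z _ /= Pk.
  by have : (level_curve u `&` P) (kap F1 (u / d'%:R, z)) by []; rewrite uP.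
have [_ _ t3] := level_type u0d par hfh.
have [nn np] := t3 u23.
by split=> //; split=> //; eexists; exact: par.
Qed.

(** At the heights 0 and d' the image is a folded line, where every loop contracts;
    so u lies strictly between them, and the classification applies. *)
Lemma level_curve_essentialP (y : R) : essential_nonperipheral R P (level_curve y) ->
  exists (o : bool) (n : int) (u : R),
    c2%:R < u < c3%:R /\ y = (-1) ^+ o * u + 2 * (d'%:R * n%:~R).
Proof.
have dn' : (d'%:R : R) != 0 by rewrite gt_eqF.
have [s [n [u [u0d' yE ->]]]] := level_curve_fold y; case/andP: u0d' => u0 ud.
move=> [[[g gC] uP] nn np]; exists s, n, u; split=> //.
have u0' : u != 0.
  apply/eqP => u0'; apply: nn; apply: (fold_null F1_pillow _ uP gC).
  by rewrite u0' level_curve_range mul0r.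
have ud' : u != d'%:R.
  apply/eqP => ud'; apply: nn; apply: (fold_null (pillow_flip F1_pillow) _ uP gC).
  by rewrite ud' level_curve_range divff // /kap /= subr0.
have u0d : 0 < u < d'%:R by rewrite lt_neqAle eq_sym u0' u0 /= lt_neqAle ud' ud.
have zu z : level_curve u (kap F1 (u / d'%:R, z)) by rewrite level_curve_range; exists z.
have hfh : freely_homotopic P (fun z => kap F1 (u / d'%:R, z)) (fun z => kap F1 (u / d'%:R, z)).
  have ck := kap_continuous F1_pillow.
  have ch : continuous (fun x : R * S1 R => kap F1 (u / d'%:R, x.2)) by apply: (ct_comp ck); ct.
  apply: (fh_of ch) => // t z _ /= Pk.
  by have : (level_curve u `&` P) (kap F1 (u / d'%:R, z)) by []; rewrite uP.
have [t1 t2 t3] := level_type u0d (level_curve_parametrizes u0d) hfh.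
have [[x1 [x2 [x3 [x4 [z1 [z2 [z3 [z4 [Pdef [e1 e2 e3 e4] _]]]]]]]]] _] := pu.
have off (c : nat) x z : P x -> x = kap F1 (c%:R / d'%:R, z) -> u != c%:R.
  move=> Px xE; apply/eqP => uc.
  have : (level_curve u `&` P) x by split=> //; rewrite xE -uc.
  by rewrite uP.
have o1 := off c1 x1 z1 ((Pdef _).2 (Or41 _ _ _ erefl)) e1.
have o2 := off c2 x2 z2 ((Pdef _).2 (Or42 _ _ _ erefl)) e2.
have o3 := off c3 x3 z3 ((Pdef _).2 (Or43 _ _ _ erefl)) e3.
have o4 := off c4 x4 z4 ((Pdef _).2 (Or44 _ _ _ erefl)) e4.
case: (ltgtP u c1%:R) o1 => // h1 _; first by case: (t1 (or_introl h1)).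
case: (ltgtP u c4%:R) o4 => // h4 _; last by case: (t1 (or_intror h4)).
case: (ltgtP u c2%:R) o2 => // h2 _.
  by have /t2[] : c1%:R < u < c2%:R \/ c3%:R < u < c4%:R by left; rewrite h1.
case: (ltgtP u c3%:R) o3 => // h3 _.
by have /t2[] : c1%:R < u < c2%:R \/ c3%:R < u < c4%:R by right; rewrite h3.
Qed.

End Components.

(** * Sublattices of a lattice of rank two *)

Section Sublattice.
Variables (V : zmodType) (l m : V).

Definition subgroup (N : set V) : Prop := N 0 /\ forall x y, N x -> N y -> N (x - y).

(** The subgroup is generated by D l and J l + D' m. *)
Definition normal_form (N : set V) (D D' : nat) (J : int) : Prop :=
  forall a b : int, N (l *~ a + m *~ b) <->
    exists s t : int, a = D%:Z * s + J * t /\ b = D'%:Z * t.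

Lemma subgroupD (N : set V) x y : subgroup N -> N x -> N y -> N (x + y).
Proof. by move=> [N0 NsubN] Nx Ny; rewrite -[y]opprK -[- y]add0r; apply: (NsubN) => //; exact: NsubN. Qed.

Lemma subgroupMz (N : set V) x k : subgroup N -> N x -> N (x *~ k).
Proof.
move=> sN Nx; have nat_mul n : N (x *~ n%:Z).
  by elim: n => [|n IH]; [rewrite mulr0z; case: sN|rewrite -addn1 PoszD mulrzDr; apply: subgroupD].
case: k => // n; rewrite NegzE mulrNz -[- _]add0r; apply: sN.2 => //; exact: sN.1.
Qed.

Lemma coset_eq (N : set V) x x' : subgroup N -> N (x - x') ->
  [set y | N (y - x)] = [set y | N (y - x')].
Proof.
move=> sN h; apply/seteqP; split=> y /= yN.
  by rewrite -(subrK x y) -addrA; apply: subgroupD sN yN h.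
by rewrite -(subrK x' y) -addrA -[x' - x]opprB; exact: sN.2.
Qed.

Lemma comb_sub (a b a' b' : int) :
  l *~ a + m *~ b - (l *~ a' + m *~ b') = l *~ (a - a') + m *~ (b - b').
Proof. by rewrite !mulrzBr opprD addrACA. Qed.

(** The elements r l + s m with r < D and s < D' represent the cosets. *)
Lemma cosets_card (A N : set V) (D D' : nat) J :
  A = [set x | exists a b : int, x = l *~ a + m *~ b] ->
  subgroup N -> normal_form N D D' J -> (0 < D)%N -> (0 < D')%N ->
  cosets A N #= `I_(D * D').
Proof.
move=> AE sN nf D0 D'0.
pose rep (k : nat) := l *~ (k %% D)%N%:Z + m *~ (k %/ D)%N%:Z.
have -> : cosets A N = (fun k => [set y | N (y - rep k)]) @` `I_(D * D').
  apply/seteqP; split=> [C [x]|C [k _ <-]]; last first.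
    by exists (rep k) => //; rewrite AE; do 2 eexists.
  rewrite AE => -[a [b ->]] ->.
  have := divz_eq b D'; have := modz_ge0 b (lt0r_neq0 (D'0 : 0 < D'%:Z)).
  have := ltz_pmod b (D'0 : 0 < D'%:Z).
  move: (b %/ D')%Z (b %% D')%Z => t [s|//] sD' _ bE; rewrite ltz_nat in sD'.
  have := divz_eq (a - J * t) D; have := modz_ge0 (a - J * t) (lt0r_neq0 (D0 : 0 < D%:Z)).
  have := ltz_pmod (a - J * t) (D0 : 0 < D%:Z).
  move: ((a - J * t) %/ D)%Z ((a - J * t) %% D)%Z => w [r|//] rD _ aE; rewrite ltz_nat in rD.
  have e1 : ((s * D + r) %% D = r)%N by rewrite modnMDl modn_small.
  have e2 : ((s * D + r) %/ D = s)%N by rewrite divnMDl // divn_small // addn0.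
  exists (s * D + r)%N; first by rewrite /=; nia.
  apply: coset_eq => //; rewrite /rep e1 e2 -opprB -[- _]add0r; apply: sN.2; first exact: sN.1.
  by rewrite comb_sub; apply/nf; exists w, t; split; lia.
apply: inj_card_eq => k k'; rewrite !inE /= => kD k'D e.
have : N (rep k' - rep k).
  have : [set y | N (y - rep k')] (rep k') by rewrite /= subrr; exact: sN.1.
  by rewrite -e.
rewrite comb_sub => /nf[s [t [e1 e2]]].
have q1 : (k %/ D < D')%N by rewrite ltn_divLR // mulnC.
have q2 : (k' %/ D < D')%N by rewrite ltn_divLR // mulnC.
have r1 : (k %% D < D)%N by rewrite ltn_mod.
have r2 : (k' %% D < D)%N by rewrite ltn_mod.
rewrite (divn_eq k D) (divn_eq k' D).
move: (k %/ D)%N (k' %/ D)%N (k %% D)%N (k' %% D)%N q1 q2 r1 r2 e1 e2 => x x' r r' *.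
have t0 : t = 0 by nia.
subst t; have s0 : s = 0 by nia.
by subst s; congr (_ * _ + _)%N; lia.
Qed.

Lemma multiples_of_order (N : set V) (d : nat) (a : int) : subgroup N -> order_mod N l d ->
  N (l *~ a) -> exists s : int, a = d%:Z * s.
Proof.
move=> sN [d0 Nd dmin] Na.
have := divz_eq a d; have := modz_ge0 a (lt0r_neq0 (d0 : 0 < d%:Z)).
have := ltz_pmod a (d0 : 0 < d%:Z).
move: (a %/ d)%Z (a %% d)%Z => w [r|//] rd _ aE; rewrite ltz_nat in rd.
have Nr : N (l *+ r).
  rewrite -[_ *+ _]/(l *~ r%:Z) (_ : r%:Z = a - d%:Z * w) ?mulrzBr; last by lia.
  apply: sN.2 => //; rewrite mulrzA; exact: subgroupMz.
exists w; case: r Nr rd aE => [|r] Nr rd aE; first by lia.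
by case: (dmin r.+1).
Qed.

(** The least positive coefficient of m in N is d', by counting cosets. *)
Lemma subgroup_normal_form (A N : set V) (d d' : nat) :
  A = [set x | exists a b : int, x = l *~ a + m *~ b] ->
  subgroup N -> (exists a b : int, b != 0 /\ N (l *~ a + m *~ b)) ->
  order_mod N l d -> cosets A N #= `I_(d * d') ->
  exists J, normal_form N d d' J.
Proof.
move=> AE sN [a0 [b0 [b00 Nab0]]] ord card.
have [d0 Nd _] := ord.
have ex : exists e : nat, (0 < e)%N && `[< exists J : int, N (l *~ J + m *~ e%:Z) >].
  exists `|b0|%N; rewrite absz_gt0 b00 /=; apply/asboolP.
  case: b0 b00 Nab0 => n n0 Nn; first by exists a0.
  exists (- a0); rewrite -[X in N X]add0r -[X in 0 + X]opprK opprD -!mulrNz !opprK.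
  by apply: sN.2; first exact: sN.1.
case: (ex_minnP ex) => e /andP[e0 /asboolP[J NJ]] emin.
have nf : normal_form N d e J.
  move=> a b; split=> [Nab|[s [t [-> ->]]]]; last first.
    rewrite !mulrzDr -addrA ; apply: subgroupD => //.
      by rewrite mulrzA; apply: subgroupMz.
    by rewrite !mulrzA -mulrzDl; apply: subgroupMz.
  have := divz_eq b e; have := modz_ge0 b (lt0r_neq0 (e0 : 0 < e%:Z)).
  have := ltz_pmod b (e0 : 0 < e%:Z).
  move: (b %/ e)%Z (b %% e)%Z => t [r|//] re _ bE; rewrite ltz_nat in re.
  have Nr : N (l *~ (a - J * t) + m *~ r%:Z).
    rewrite (_ : r%:Z = b - e%:Z * t); last by lia.
    rewrite -comb_sub; apply: sN.2 => //; rewrite !mulrzA -mulrzDl; exact: subgroupMz.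
  case: r Nr re bE => [|r] Nr re bE; last first.
    suff : (e <= r.+1)%N by rewrite leqNgt re.
    by apply: emin; apply/asboolP; eexists; exact: Nr.
  rewrite mulr0z addr0 in Nr.
  by have [s sE] := multiples_of_order sN ord Nr; exists s, t; split; lia.
have := cosets_card AE sN nf d0 e0 => card'.
have /card_eq_II : `I_(d * d') #= `I_(d * e) by apply: card_eq_trans card'; rewrite card_eq_sym.
move=> /eqP; rewrite eqn_mul2l eqn0Ngt d0 /= => /eqP ->.
by exists J.
Qed.

End Sublattice.

(** * Coordinates in the plane *)

Section Coordinates.
Variables (R : realType) (l m : plane R).

Definition pt (x : R * R) : plane R := x.1 *: l + x.2 *: m.

Lemma ptE x : pt x = vec (x.1 * l ord0 ord0 + x.2 * m ord0 ord0)
                         (x.1 * l ord0 ord_max + x.2 * m ord0 ord_max).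
Proof. by apply: plane_eq; rewrite (vec0, vec1) !mxE. Qed.

Lemma pt_continuous : continuous pt.
Proof. by rewrite (funext ptE); ct. Qed.

Lemma ptD x y : pt (x.1 + y.1, x.2 + y.2) = pt x + pt y.
Proof. by rewrite /pt /= !scalerDl addrACA. Qed.

Lemma ptN x : pt (- x.1, - x.2) = - pt x.
Proof. by rewrite /pt /= !scaleNr opprD. Qed.

Lemma pt_int (a b : int) : pt (a%:~R, b%:~R) = l *~ a + m *~ b.
Proof. by rewrite /pt /= !scaler_int. Qed.

Lemma pt_double x : pt (2 * x.1, 2 * x.2) = pt x *+ 2.
Proof. by rewrite /pt /= !mulr_natl -!scalerMnl mulrnDl. Qed.

Lemma line_pt x : line (pt x) l = [set pt (a, x.2) | a in [set: R]].
Proof.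
apply/seteqP; split=> [_ [t _ <-]|_ [a _ <-]].
  by exists (x.1 + t) => //; rewrite /pt /= scalerDl addrAC.
by exists (a - x.1) => //; rewrite /pt addrAC -scalerDl [x.1 + _]addrC subrK.
Qed.

Variables (L : set (plane R)).
Hypothesis basis : lattice_basis L l m.

Lemma pt_inj : injective pt.
Proof.
move=> [a b] [a' b'] e; have [] := basis.1 (a - a') (b - b').
  by rewrite !scalerBl addrACA -opprD -/(pt (a, b)) -/(pt (a', b')) e subrr.
by move=> /subr0_eq -> /subr0_eq ->.
Qed.

Lemma pt_surj w : exists x, pt x = w.
Proof.
pose a := l ord0 ord0; pose b := l ord0 ord_max.
pose c := m ord0 ord0; pose e := m ord0 ord_max.
pose D := a * e - b * c.
have D0 : D != 0.
  apply/eqP => D0; rewrite /D in D0.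
  have z x : x.1 * a + x.2 * c = 0 -> x.1 * b + x.2 * e = 0 -> x.1 = 0 /\ x.2 = 0.
    move=> e1 e2; apply: basis.1; rewrite -/(pt x) ptE e1 e2.
    by apply: plane_eq; rewrite (vec0, vec1) mxE.
  have [] := z (e, - b); rewrite /=; [lra|lra|move=> e0 /eqP; rewrite oppr_eq0 => /eqP b0].
  have [] := z (c, - a); rewrite /=; [lra|lra|move=> c0 /eqP; rewrite oppr_eq0 => /eqP a0].
  have [] := z (1, 0); rewrite /= ?a0 ?b0; [lra|lra|lra].
exists ((w ord0 ord0 * e - w ord0 ord_max * c) / D, (w ord0 ord_max * a - w ord0 ord0 * b) / D).
by rewrite ptE; apply: plane_eq; rewrite (vec0, vec1) /=; move: D0; rewrite /D /a /b /c /e => D0; field.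
Qed.

Lemma pt_lattice x : L (pt x) <-> integral_point x.
Proof.
rewrite basis.2; split=> [[a [b]]|[a [b ->]]]; last by rewrite pt_int; exists a, b.
by rewrite -pt_int => /pt_inj ->; exists a, b.
Qed.

End Coordinates.

(** * The sphere as a quotient of the plane *)

(** Branch points are values, and other points have two preimages. *)
Lemma degree_two_surj (R : realType) (T : topologicalType) (p : T -> S2 R) :
  map_degree R p 2 -> forall w, exists x, p x = w.
Proof.
move=> deg w; have [[x _ <-]|nb] := pselect (branch_points R p w); first by exists x.
have [e|/set0P[x xw]] := eqVneq (p @^-1` [set w]) set0; last by exists x.
have := deg w nb; rewrite e card_eq_sym card_eq0 => /eqP I0.
by have : `I_2 0%N by []; rewrite I0.
Qed.

Lemma lattice_subgroup (R : realType) (L : set (plane R)) : is_lattice L -> subgroup L.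
Proof.
move=> [u [v [_ ->]]]; split=> [|_ _ [a [b ->]] [a' [b' ->]]].
  by exists 0, 0; rewrite !mulr0z addr0.
by rewrite comb_sub; exists (a - a'), (b - b').
Qed.

Lemma double_inj (R : realType) (u v : plane R) : u *+ 2 = v *+ 2 -> u = v.
Proof.
move=> e; apply/matrixP => i j.
have : (u *+ 2) i j = (v *+ 2) i j by rewrite e.
rewrite !mulr2n !mxE; lra.
Qed.

Lemma complex_power1 (R : realType) (z : plane R) : complex_power 1 z = z.
Proof. by rewrite /complex_power expr1 /=; apply: plane_eq; rewrite (vec0, vec1). Qed.

Section Net.
Variables (R : realType) (f : S2 R -> S2 R) (T1 T2 : topologicalType).
Variables (p1 : T1 -> S2 R) (p2 : T2 -> S2 R) (ft : T1 -> T2).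
Variables (q1 : plane R -> T1) (q2 : plane R -> T2) (L1 L2 : set (plane R)).
Hypothesis net : NET_data f p1 p2 ft q1 q2 L1 L2.

Lemma quotient_map_lifts x : f (p1 (q1 x)) = p2 (q2 x).
Proof. by rewrite (id_lifts_ft net) (ft_lifts_f net). Qed.

Lemma fiber1 x y : p1 (q1 x) = p1 (q1 y) <->
  exists2 v, L1 v & y = v *+ 2 + x \/ y = v *+ 2 - x.
Proof.
rewrite (fiber_p1q1 net) (deck1 net); split=> [[g [v Lv [->|->]] ->]|[v Lv [->|->]]].
- by exists v => //; left.
- by exists v => //; right.
- by exists (fun x => v *+ 2 + x) => //; exists v => //; left.
- by exists (fun x => v *+ 2 - x) => //; exists v => //; right.
Qed.

Lemma fiber2 x y : p2 (q2 x) = p2 (q2 y) <->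
  exists2 v, L2 v & y = v *+ 2 + x \/ y = v *+ 2 - x.
Proof.
rewrite (fiber_p2q2 net) (deck2 net); split=> [[g [v Lv [->|->]] ->]|[v Lv [->|->]]].
- by exists v => //; left.
- by exists v => //; right.
- by exists (fun x => v *+ 2 + x) => //; exists v => //; left.
- by exists (fun x => v *+ 2 - x) => //; exists v => //; right.
Qed.

(** A rotation about a point of the first lattice is a deck transformation of the
    second quotient map, since the latter factors through the first one. *)
Lemma lattice_sub : L1 `<=` L2.
Proof.
move=> v Lv.
have : deck_group (p1 \o q1) (fun x => v *+ 2 - x) by rewrite (deck1 net); exists v => //; right.
move=> [hom fib].
have : deck_group (p2 \o q2) (fun x => v *+ 2 - x).
  by split=> // x /=; rewrite -!quotient_map_lifts; congr f; exact: fib.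
rewrite (deck2 net) => -[w Lw] [] /(congr1 (fun h => h 0)).
  by rewrite subr0 addr0 => /double_inj ->.
by rewrite !subr0 => /double_inj ->.
Qed.

Lemma surj1 w : exists x, p1 (q1 x) = w.
Proof.
have [y <-] := degree_two_surj (p1_branched net).2 w.
have [_ rq _] := q1_covering net.
have [x _ <-] : range q1 y by rewrite rq.
by exists x.
Qed.

Lemma surj2 w : exists x, p2 (q2 x) = w.
Proof.
have [y <-] := degree_two_surj (p2_branched net).2 w.
have [_ rq _] := q2_covering net.
have [x _ <-] : range q2 y by rewrite rq.
by exists x.
Qed.

Lemma continuous1 : continuous (p1 \o q1).
Proof.
have [c1 _ _] := q1_covering net; have c2 := (p1_branched net).1.1.
by move=> x; apply: continuous_comp; [exact: c1|exact: c2].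
Qed.

Lemma continuous2 : continuous (p2 \o q2).
Proof.
have [c1 _ _] := q2_covering net; have c2 := (p2_branched net).1.1.
by move=> x; apply: continuous_comp; [exact: c1|exact: c2].
Qed.

Lemma postcritical_forward w : branch_points R p2 w -> branch_points R p2 (f w).
Proof.
rewrite (branch_p2 net) => -[k [c [k0 cc <-]]].
by exists k.+1, c.
Qed.

Variables (l m : plane R).
Hypothesis basis : lattice_basis L2 l m.

Definition quotient1 (x : R * R) : S2 R := p1 (q1 (pt l m x)).
Definition quotient2 (x : R * R) : S2 R := p2 (q2 (pt l m x)).

Lemma quotient2_pillow : pillow quotient2.
Proof.
split.
- have cp := @pt_continuous R l m; have c2 := continuous2.
  by move=> x; apply: (@continuous_comp _ _ _ (pt l m) (p2 \o q2)); [exact: cp|exact: c2].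
- by move=> w; have [y <-] := surj2 w; have [x <-] := pt_surj basis y; exists x.
move=> x y; rewrite /quotient2 fiber2; split.
  move=> [v]; have [z <-] := pt_surj basis v.
  move=> /(pt_lattice basis)[a [b ->]]; rewrite -pt_double -ptN -!ptD.
  by case=> /(pt_inj basis) -> /=; exists a, b; [left|right]; congr pair; rewrite addrC.
move=> [a [b h]]; exists (pt l m (a%:~R, b%:~R)); first by apply/(pt_lattice basis); exists a, b.
rewrite -pt_double -ptN -!ptD /=.
by case: h => ->; [left|right]; congr (pt _ _ (_, _)); rewrite addrC.
Qed.

(** Were p2 injective near the image of a lattice point x, then q2 would not
    distinguish points near x that the rotation about x exchanges. *)
Lemma quotient2_integral x : integral_point x -> branch_points R p2 (quotient2 x).
Proof.
move=> xI; have Lx : L2 (pt l m x) by apply/(pt_lattice basis).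
have [k [phi [psi [k0 ph ps hk]]]] := (p2_branched net).1.2 (q2 (pt l m x)).
exists (q2 (pt l m x)) => //; exists k; last by exists phi, psi.
case: k k0 hk => [//|[|//]] _ hk; exfalso.
have [_ _ phi_open phi0] := ph; have [_ psi_inj _ _] := ps.
pose c (t : R) := q2 (pt l m (x.1 + t, x.2)).
have cq : continuous q2 by case: (q2_covering net).
have cp := @pt_continuous R l m.
have c_ct : continuous c by rewrite /c; ct.
have oU : open (range phi) by apply: phi_open; exact: openT.
have oW : open (c @^-1` range phi `&` (fun t => c (- t)) @^-1` range phi).
  have cn_ct : continuous (fun t => c (- t)) by ct.
  by move/continuousP: c_ct => oc; move/continuousP: cn_ct => ocn; apply: openI; [exact: oc|exact: ocn].
have W0 : (c @^-1` range phi `&` (fun t => c (- t)) @^-1` range phi) 0.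
  by split=> /=; exists 0 => //; rewrite phi0 /c ?oppr0 addr0; case: (x).
have /nbhs_ballP[e /= e0 eW] := open_nbhs_nbhs (conj oW W0).
have [t [t0 t1 te]] : exists t : R, [/\ 0 < t, t < 1 & t < e].
  exists (Num.min (1 / 2) (e / 2)); rewrite lt_min !gt_min; split; last first.
  - by apply/orP; right; move: (e0 : 0 < e); lra.
  - by apply/orP; left; lra.
  - by apply/andP; split; move: (e0 : 0 < e); lra.
have [|[z _ zE] [z' _ z'E]] := eW t.
  by rewrite /ball /= sub0r normrN gtr0_norm.
have : p2 (c t) = p2 (c (- t)).
  apply/fiber2; exists (pt l m x) => //; right.
  by rewrite -pt_double -ptN -ptD /=; congr (pt _ _ (_, _)); ring.
rewrite -zE -z'E !hk !complex_power1 => /psi_inj zz'.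
have : c (- t) = c t by rewrite -zE -z'E zz'.
move=> /(fiber_q2 net)[v Lv]; rewrite -ptN -ptD /=.
rewrite (_ : (_, _) = (2 * t, 2 * 0)); last by congr pair; ring.
rewrite (pt_double l m (t, 0)) => /double_inj vE.
move: Lv; rewrite vE => /(pt_lattice basis)[a [b [ta _]]].
by have := @int_lt1 R a; rewrite -ta => /(_ _ _) a0; move: ta; rewrite a0 ?mulr0z; lra.
Qed.

End Net.

(** * Coset numbers *)

Section CosetNumbers.
Variables (R : realType) (f : S2 R -> S2 R) (T1 T2 : topologicalType).
Variables (p1 : T1 -> S2 R) (p2 : T2 -> S2 R) (ft : T1 -> T2).
Variables (q1 : plane R -> T1) (q2 : plane R -> T2) (L1 L2 : set (plane R)).
Hypothesis net : NET_data f p1 p2 ft q1 q2 L1 L2.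
Variables (l m : plane R) (d d' : nat).
Hypothesis basis : lattice_basis L2 l m.

Local Notation P := (branch_points R p2).
Local Notation G := (quotient1 p1 q1 l m).

Lemma lattice_point v : L2 v -> exists a b : int, v = l *~ a + m *~ b.
Proof. by rewrite basis.2. Qed.

Lemma comb_inj (a b a' b' : int) : l *~ a + m *~ b = l *~ a' + m *~ b' -> a = a' /\ b = b'.
Proof. by rewrite -!pt_int => /(pt_inj basis)[/intr_inj -> /intr_inj ->]. Qed.

(** Two generators of the sublattice that are multiples of l would be linearly
    dependent. *)
Lemma sublattice_rank_two : exists a b : int, b != 0 /\ L1 (l *~ a + m *~ b).
Proof.
have [u [v [free L1E]]] := L1_lattice net.
have Lu : L1 u by rewrite L1E; exists 1, 0; rewrite mulr0z addr0.
have Lv : L1 v by rewrite L1E; exists 0, 1; rewrite mulr0z add0r.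
have [a [b uE]] := lattice_point (lattice_sub net Lu).
have [a' [b' vE]] := lattice_point (lattice_sub net Lv).
have [b0|b0] := eqVneq b 0; last by exists a, b; rewrite -uE.
have [b'0|b'0] := eqVneq b' 0; last by exists a', b'; rewrite -vE.
rewrite b0 mulr0z addr0 in uE; rewrite b'0 mulr0z addr0 in vE.
have [_ /eqP] : (a'%:~R : R) = 0 /\ (- a%:~R : R) = 0.
  by apply: free; rewrite scaleNr !scaler_int uE vE -!mulrzA mulrC subrr.
rewrite oppr_eq0 intr_eq0 => /eqP a0.
have [] := free 1 0; first by rewrite scale0r addr0 scale1r uE a0 mulr0z.
by move=> /eqP; rewrite oner_eq0.
Qed.

Variable j : int.
Hypotheses (d0 : (0 < d)%N) (d'0 : (0 < d')%N) (nf : normal_form l m L1 d d' j).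

Lemma G_fiber x y : G x = G y <-> sub_shift d d' j x y.
Proof.
rewrite /quotient1 (fiber1 net); split.
  move=> [v Lv]; have [a [b vE]] := lattice_point (lattice_sub net Lv).
  rewrite vE in Lv *; have [s [t [-> ->]]] := (nf a b).1 Lv.
  rewrite -pt_int -pt_double -ptN -!ptD.
  case=> /(pt_inj basis) -> /=; exists s, t; [left|right];
    by rewrite addrC [_ * (d'%:Z * _)%:~R + _]addrC !intrD !intrM.
move=> [s [t h]]; exists (l *~ (d%:Z * s + j * t) + m *~ (d'%:Z * t)).
  by apply/nf; exists s, t.
rewrite -pt_int -pt_double -ptN -!ptD /= !intrD !intrM.
by case: h => ->; [left|right]; congr (pt _ _ (_, _)); rewrite addrC.
Qed.

Let M := twice L1.
Let B := cyclic_mod M l.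

Lemma doubled_subgroup : subgroup M.
Proof.
have sL := lattice_subgroup (L1_lattice net).
split=> [|_ _ [u Lu <-] [v Lv <-]]; first by exists 0; [exact: sL.1|rewrite mul0rn].
by exists (u - v); [exact: sL.2|rewrite mulrnBl].
Qed.

Lemma cyclic_subgroup : subgroup B.
Proof.
have sM := doubled_subgroup.
split=> [|x y [k hx] [n hy]]; first by exists 0; rewrite mulr0z subr0; exact: sM.1.
exists (k - n); rewrite mulrzBr (_ : _ - _ = (x - l *~ k) - (y - l *~ n)); first exact: sM.2.
by rewrite !opprB addrACA [RHS]addrACA; congr (_ + _); rewrite addrC.
Qed.

(** The quotient of the big lattice by B is cyclic of order 2 d', generated by the
    image of m. *)
Lemma cyclic_normal_form : normal_form l m B 1 (2 * d') 0.
Proof.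
move=> a b; split=> [[k [v Lv]]|[s [t [aE bE]]]].
  have [a' [b' vE]] := lattice_point (lattice_sub net Lv).
  rewrite vE in Lv *; have [s [t [_ b'E]]] := (nf a' b').1 Lv.
  rewrite addrAC -mulrzBr mulrnDl !pmulrn -!mulrzA => /comb_inj[_ e].
  by exists a, t; split; lia.
exists (a - 2 * (j * t)), (l *~ (j * t) + m *~ (d'%:Z * t)).
  by apply/nf; exists 0, t; rewrite mulr0 add0r.
rewrite addrAC -mulrzBr mulrnDl !pmulrn -!mulrzA; congr (_ *~ _ + _ *~ _); lia.
Qed.

(** The preimages in the plane of a point of P form one inverse pair modulo M.
    That of h i contains an element of the form k l + c m, where c is the i-th
    coset number; so the coset numbers are the heights, between 0 and d', at
    which the four points of P occur. *)
Lemma coset_points (c : 4.-tuple nat) :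
  coset_numbers L2 M (q1 @^-1` (p1 @^-1` P)) B m c ->
  [/\ sorted leq c, forall i, (tnth c i <= d')%N,
    forall x, P (G x) -> integral_point x
  & exists k : 'I_4 -> int,
    (forall w, P w <-> exists i, w = G ((k i)%:~R, (tnth c i)%:R)) /\
    injective (fun i => G ((k i)%:~R, (tnth c i)%:R))].
Proof.
move=> [n [h [_ card HE disj [srt hc]]]].
have sM := doubled_subgroup; have sL := lattice_subgroup (L2_lattice net).
have card2 := cosets_card basis.2 cyclic_subgroup cyclic_normal_form (ltn0Sn 0) (leq_mul (ltn0Sn 1) d'0).
have nE : n = (1 * (2 * d'))%N.
  by apply/card_eq_II; apply: card_eq_trans card2; rewrite card_eq_sym.
have cd i : (tnth c i <= d')%N by have [+ _] := hc i; rewrite nE; lia.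
have pair_rep i : exists k : int, inverse_pair M (h i) (l *~ k + m *~ (tnth c i)%:Z).
  have [_ [x hx [k [v Lv vE]]]] := hc i.
  exists k; have -> : l *~ k + m *~ (tnth c i)%:Z = x - v *+ 2.
    by rewrite vE -addrA -opprD subKr addrC pmulrn.
  have Mv : M (v *+ 2) by exists v.
  case: hx => hx; [left|right]; by rewrite addrAC; apply: sM.2.
have [k hk] := choice pair_rep.
have LM v : M v -> L2 v.
  by move=> [u /(lattice_sub net) Lu <-]; rewrite mulr2n; apply: subgroupD.
have Lrep i : L2 (l *~ k i + m *~ (tnth c i)%:Z) by rewrite basis.2; do 2 eexists.
have Lh i : L2 (h i).
  have := Lrep i; move: (l *~ k i + m *~ _) (hk i) => x [] /LM Lx Lx'.
    by rewrite -(subKr x (h i)); apply: sL.2.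
  by rewrite -[h i](addrK x) addrC [h i + x]addrC; rewrite addrC; apply: sL.2.
have pairL i x : inverse_pair M (h i) x -> L2 x.
  case=> /LM Lx; first by rewrite -[x](subrK (h i)); apply: subgroupD.
  by rewrite -[x](addrK (h i)); apply: sL.2.
have GE i : G ((k i)%:~R, (tnth c i)%:R) = p1 (q1 (l *~ k i + m *~ (tnth c i)%:Z)).
  by rewrite -pt_int.
(* Two points of the same inverse pair are exchanged by a deck transformation. *)
have pair_fiber i x y : inverse_pair M (h i) x -> inverse_pair M (h i) y -> p1 (q1 x) = p1 (q1 y).
  move=> hx hy; apply/(fiber1 net).
  suff [[v Lv vE]|[v Lv vE]] : M (y - x) \/ M (y + x).
  - by exists v => //; left; rewrite vE subrK.
  - by exists v => //; right; rewrite vE addrK.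
  case: hx => hx; case: hy => hy.
  - by left; rewrite (_ : y - x = (y - h i) - (x - h i)); [apply: sM.2|rewrite opprB addrA subrK].
  - right; rewrite (_ : y + x = (y + h i) + (x - h i)); [exact: subgroupD|by rewrite addrACA subrr addr0].
  - right; rewrite (_ : y + x = (y - h i) + (x + h i)); [exact: subgroupD|by rewrite addrACA addNr addr0].
  - by left; rewrite (_ : y - x = (y + h i) - (x + h i)); [apply: sM.2|rewrite opprD addrACA subrr addr0].
have pair_class i x y : inverse_pair M (h i) x -> p1 (q1 x) = p1 (q1 y) -> inverse_pair M (h i) y.
  move=> hx /(fiber1 net)[v Lv yE]; have Mv : M (v *+ 2) by exists v.
  case: hx => hx; case: yE => ->.
  - by left; rewrite -addrA; apply: subgroupD.
  - by right; rewrite -addrA [_ + h i]addrC -opprB; apply: sM.2.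
  - by right; rewrite -addrA; apply: subgroupD.
  - by left; rewrite -addrA -opprD; apply: sM.2.
have inH x : P (p1 (q1 x)) <-> exists i, inverse_pair M (h i) x.
  rewrite -[P _]/((q1 @^-1` (p1 @^-1` P)) x) HE.
  by split=> [[i _ hi]|[i hi]]; exists i.
split=> // [x /inH[i /pairL /(pt_lattice basis)] //|].
exists k; split=> [w|i i'].
  split=> [|[i ->]]; last by rewrite GE; apply/inH; exists i.
  by have [x <-] := surj1 net w; move=> /inH[i hi]; exists i; rewrite GE; exact: pair_fiber hi (hk i).
rewrite !GE => e; apply/eqP/negPn/negP => ii'.
have hi' := pair_class _ _ _ (hk i) e.
by move/eqP: ii'; apply; apply: (disj i i') => //; eexists; split; [exact: hi'|exact: hk].
Qed.

Lemma coset_punctures (c1 c2 c3 c4 : nat) :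
  coset_numbers L2 M (q1 @^-1` (p1 @^-1` P)) B m [tuple c1; c2; c3; c4] ->
  [/\ (c1 <= c2)%N, (c2 <= c3)%N, (c3 <= c4)%N & (c4 <= d')%N] /\
  (forall x, P (G x) -> integral_point x) /\
  punctures (F1 G d d' j) P (c1%:R / d'%:R) (c2%:R / d'%:R) (c3%:R / d'%:R) (c4%:R / d'%:R).
Proof.
move=> /coset_points[/= /and4P[h12 h23 h34 _] cd int [k [PE inj]]].
have h4 : (c4 <= d')%N by have := cd ord_max; rewrite (tnth_nth 0%N).
have dn : (d%:R : R) != 0 by rewrite pnatr_eq0 -lt0n.
have dn' : (d'%:R : R) != 0 by rewrite pnatr_eq0 -lt0n.
have G_ct : continuous G.
  have cp := @pt_continuous R l m; have c1' := continuous1 net.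
  by move=> x; apply: (@continuous_comp _ _ _ (pt l m) (p1 \o q1)); [exact: cp|exact: c1'].
have G_surj w : exists x, G x = w.
  by have [y <-] := surj1 net w; have [x <-] := pt_surj basis y; exists x.
have pF := F1_pillow d0 d'0 G_ct G_surj G_fiber.
split=> //; split=> //.
pose z i : S1 R := E (pi * (((k i)%:~R - j%:~R * ((tnth [tuple c1; c2; c3; c4] i)%:R / d'%:R)) / d%:R)).
have GE i : G ((k i)%:~R, (tnth [tuple c1; c2; c3; c4] i)%:R) =
    kap (F1 G d d' j) ((tnth [tuple c1; c2; c3; c4] i)%:R / d'%:R, z i).
  rewrite (kapE pF) /F1 /=; congr (G (_, _)); last by rewrite [d'%:R * _]mulrC divfK.
  by rewrite [d%:R * _]mulrC divfK // subrK.
pose w i := kap (F1 G d d' j) ((tnth [tuple c1; c2; c3; c4] i)%:R / d'%:R, z i).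
have neq i i' : i != i' -> w i <> w i'.
  by move=> ii' e; case/eqP: ii'; apply: inj; rewrite !GE.
pose i0 : 'I_4 := inord 0; pose i1 : 'I_4 := inord 1.
pose i2 : 'I_4 := inord 2; pose i3 : 'I_4 := inord 3.
have all4 i : [\/ i = i0, i = i1, i = i2 | i = i3].
  case: i => [[|[|[|[|//]]]] hi]; [constructor 1|constructor 2|constructor 3|constructor 4];
    by apply: val_inj; rewrite /= inordK.
have te (i : nat) : (i < 4)%N -> tnth [tuple c1; c2; c3; c4] (inord i) = nth 0%N [:: c1; c2; c3; c4] i.
  by move=> hi; rewrite (tnth_nth 0%N) inordK.
constructor.
- exists (w i0), (w i1), (w i2), (w i3), (z i0), (z i1), (z i2), (z i3); split.
  + move=> x; rewrite PE; split=> [[i ->]|].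
      rewrite GE; case: (all4 i) => ->; [exact: Or41|exact: Or42|exact: Or43|exact: Or44].
    by case=> ->; eexists; rewrite GE.
  + by rewrite /w !te.
  + by split; split; apply: neq; rewrite -(inj_eq val_inj) /= !inordK.
- have le (a b : nat) : (a <= b)%N -> (a%:R : R) / d'%:R <= b%:R / d'%:R.
    by move=> ab; rewrite ler_pM2r ?invr_gt0 ?ltr0n // ler_nat.
  split; try exact: le; first by rewrite divr_ge0 ?ler0n.
  by rewrite -[leRHS](divff dn'); exact: le.
Qed.

End CosetNumbers.

(** * Curves of a given slope *)

(** A line that avoids the integral points can be moved by the pillow group to a
    height strictly between 0 and 1 without changing its image. *)
Lemma pillow_height (R : realType) (F : R * R -> S2 R) (b : R) : pillow F ->
  (forall n : int, b <> n%:~R) ->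
  exists2 y : R, 0 < y < 1 & [set F (a, b) | a in [set: R]] = [set F (a, y) | a in [set: R]].
Proof.
move=> pF bZ; have [n n2 _] := mod2 b.
have e1 a : F (a, b + 2 * n%:~R) = F (a, b).
  by have := pillow_shift pF (a, b) 0 n; rewrite /= mulr0 addr0.
have e2 a : F (a, 2 - (b + 2 * n%:~R)) = F (- a, b).
  rewrite -e1 -(pillow_rot pF) /=.
  have := pillow_shift pF (- a, - (2 - (b + 2 * n%:~R))) 0 1.
  by rewrite /= mulr0 addr0 => <-; congr (F (_, _)); ring.
have nZ (k : int) : b + 2 * n%:~R <> k%:~R.
  by move=> e; apply: (bZ (k - 2 * n)); rewrite intrB intrM -e; ring.
have n0 := nZ 0; have n1 := nZ 1; have n2' := nZ 2.
have [h|h] := ltP (b + 2 * n%:~R) 1.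
  exists (b + 2 * n%:~R).
    by case/andP: n2 => h0 _; rewrite h andbT lt_neqAle h0 andbT eq_sym; apply/eqP.
  by apply/seteqP; split=> _ [a _ <-]; exists a.
exists (2 - (b + 2 * n%:~R)).
  case/andP: n2 => _ h2; rewrite subr_gt0 lt_neqAle h2 andbT ltrBlDr.
  apply/andP; split; first exact/eqP.
  rewrite -ltrBlDl (_ : 2 - 1 = 1) ?lt_neqAle ?h ?andbT; last by ring.
  by rewrite eq_sym; apply/eqP.
by apply/seteqP; split=> _ [a _ <-]; exists (- a); rewrite ?e2 ?opprK.
Qed.

Lemma has_card_nat (T : Type) (A : set T) (n : nat) (z : int) :
  A #= `I_n -> z = n%:Z -> has_card A z.
Proof. by move=> An ->; exists n. Qed.

Theorem theorem4p1 (R : realType) (f : S2 R -> S2 R)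
    (T1 T2 : topologicalType) (p1 : T1 -> S2 R) (p2 : T2 -> S2 R)
    (ft : T1 -> T2) (q1 : plane R -> T1) (q2 : plane R -> T2)
    (L1 L2 : set (plane R)) (l2 m2 : plane R) (P2 : set (S2 R))
    (delta : set (S2 R)) (p q : int) (l m : plane R)
    (d d' c1 c2 c3 c4 : nat) :
  NET_map f ->
  NET_data f p1 p2 ft q1 q2 L1 L2 ->
  lattice_basis L2 l2 m2 ->
  P2 = branch_points R p2 ->
  essential_nonperipheral R P2 delta ->
  coprimez p q ->
  has_slope (p2 \o q2) L2 P2 l2 m2 p q delta ->
  l = l2 *~ q + m2 *~ p ->
  order_mod L1 l d ->
  (0 < d')%N -> cosets L2 L1 #= `I_(d * d') -> map_degree R f (d * d') ->
  lattice_basis L2 l m ->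
  coset_numbers L2 (twice L1) (q1 @^-1` (p1 @^-1` P2))
    (cyclic_mod (twice L1) l) m [tuple c1; c2; c3; c4] ->
  [/\ (* (1) *)
      forall K, components (f @^-1` delta) K ->
        maps_with_degree R f K delta d,
      (* (2) *)
      has_card [set K | components (f @^-1` delta) K /\
                        essential_nonperipheral R P2 K]
        (c3%:Z - c2%:Z),
      (* (3) *)
      has_card [set K | components (f @^-1` delta) K /\ peripheral R P2 K]
        (c2%:Z - c1%:Z + c4%:Z - c3%:Z),
      (* (4) *)
      has_card [set K | components (f @^-1` delta) K /\ null_homotopic R P2 K]
        (c1%:Z - c4%:Z + d'%:Z)
    & (* (5) *)
      forall L : set (plane R),
        ((exists x, L = line x l) /\
         essential_nonperipheral R P2 ((p1 \o q1) @` L)) <->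
        (exists (g : plane R -> plane R) (u : R),
          [/\ deck_group (p1 \o q1) g,
           c2%:R < u < c3%:R & L = g @` line (u *: m) l])].
Proof.
move=> _ net _ -> _ _ [x0 line_off [gamma0 [gamma1 [par0 par1 homo]]]] lE ord d'0 card _ basis coset.
rewrite -lE in line_off par1.
have [d0 _ _] := ord.
have sL1 := lattice_subgroup (L1_lattice net).
have [j nf] := subgroup_normal_form basis.2 sL1 (sublattice_rank_two net basis) ord card.
have GP := G_fiber net basis nf.
have [[h12 h23 h34 h4] [PG pu]] := coset_punctures net basis d0 d'0 nf coset.
have G_ct : continuous (quotient1 p1 q1 l m).
  have cp := @pt_continuous R l m; have c1' := continuous1 net.
  by move=> x; apply: (@continuous_comp _ _ _ (pt l m) (p1 \o q1)); [exact: cp|exact: c1'].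
have G_surj w : exists x, quotient1 p1 q1 l m x = w.
  by have [y <-] := surj1 net w; have [x <-] := pt_surj basis y; exists x.
have fG x : f (quotient1 p1 q1 l m x) = quotient2 p2 q2 l m x by exact: quotient_map_lifts net _.
have pF2 := quotient2_pillow net basis.
have F2P := quotient2_integral net basis.
have fP := postcritical_forward net.
have [[a0 b0] xE] := pt_surj basis x0.
have b0Z (n : int) : b0 <> n%:~R.
  move=> e; have : (line x0 l `&` L2) (pt l m (0, b0)).
    split; first by rewrite -xE line_pt; exists 0.
    by apply/(pt_lattice basis); exists 0, n; rewrite e.
  by rewrite line_off.
have [y0 y01 yE] := pillow_height pF2 b0Z.
have imE : (p2 \o q2) @` line x0 l = [set quotient2 p2 q2 l m (a, y0) | a in [set: R]].
  rewrite -yE -xE line_pt; apply/seteqP; split=> [_ [_ [a _ <-] <-]|_ [a _ <-]].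
    by exists a.
  by exists (pt l m (a, b0)) => //; exists a.
rewrite imE in par1.
have [V [gamma [V_ct gammaP gammaE V_off V1]]] := straighten pF2 F2P y01 par0 par1 homo.
split.
- move=> K; rewrite (preimage_components d0 d'0 G_ct G_surj GP fG pF2 F2P y01 V_ct gammaP gammaE V_off).
  by move=> [i _ <-]; have := comp_degree d0 d'0 G_ct GP fG pF2 F2P V_ct gammaP gammaE V_off i.
- apply: (has_card_nat (count_essential d0 d'0 G_ct G_surj GP fG pF2 F2P fP y01 V_ct gammaP gammaE V_off V1 PG pu)).
  by lia.
- apply: (has_card_nat (count_peripheral d0 d'0 G_ct G_surj GP fG pF2 F2P fP y01 V_ct gammaP gammaE V_off V1 PG pu)).
  by lia.
- apply: (has_card_nat (count_null d0 d'0 G_ct G_surj GP fG pF2 F2P fP y01 V_ct gammaP gammaE V_off V1 PG pu)).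
  by lia.
have line_image x : (p1 \o q1) @` line (pt l m x) l = level_curve (quotient1 p1 q1 l m) x.2.
  rewrite line_pt; apply/seteqP; split=> [_ [_ [a _ <-] <-]|_ [a _ <-]]; first by exists a.
  by exists (pt l m (a, x.2)) => //; exists a.
move=> L; rewrite (deck1 net); split=> [[[x ->]]|[g [u [[v Lv gE] u23 ->]]]].
  have [y <-] := pt_surj basis x; rewrite line_image.
  move=> /(level_curve_essentialP d0 d'0 G_ct G_surj GP pu)[s [n [u [u23 yE']]]].
  pose v := l *~ (j * n) + m *~ (d'%:Z * n).
  have Lv : L1 v by apply/nf; exists 0, n; rewrite mulr0 add0r.
  have vE : v *+ 2 = pt l m (2 * (j * n)%:~R, 2 * (d'%:Z * n)%:~R).
    by rewrite /v -pt_int -pt_double.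
  have uE a : u *: m + a *: l = pt l m (a, u) by rewrite /pt addrC.
  exists (fun x => if s then v *+ 2 - x else v *+ 2 + x), u; split=> //.
    by exists v => //; case: s {yE'}; [right|left].
  rewrite line_pt yE'; apply/seteqP; split=> [_ [a _ <-]|_ [_ [a _ <-] <-]].
    exists (u *: m + ((-1) ^+ s * (a - 2 * (j * n)%:~R)) *: l); first by eexists.
    rewrite uE vE -ptN -!ptD /= !intrM; case: s {yE'}; congr (pt _ _ (_, _)); rewrite /= ?expr1 ?expr0; ring.
  exists (2 * (j * n)%:~R + (-1) ^+ s * a) => //.
  rewrite uE vE -ptN -!ptD /= !intrM; case: s {yE'}; congr (pt _ _ (_, _)); rewrite /= ?expr1 ?expr0; ring.
have uE a : u *: m + a *: l = pt l m (a, u) by rewrite /pt addrC.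
have [x vE] := pt_surj basis v.
split.
  case: gE => ->.
    exists (v *+ 2 + u *: m); apply/seteqP; split=> [_ [_ [a _ <-] <-]|_ [a _ <-]].
      by exists a => //; rewrite addrA.
    by exists (u *: m + a *: l); [exists a|rewrite addrA].
  exists (v *+ 2 - u *: m); apply/seteqP; split=> [_ [_ [a _ <-] <-]|_ [a _ <-]].
    by exists (- a) => //; rewrite scaleNr opprD addrA.
  by exists (u *: m + (- a) *: l); [exists (- a)|rewrite scaleNr opprB addrA addrAC].
rewrite image_comp.
have -> : ((p1 \o q1) \o g) @` line (u *: m) l = (p1 \o q1) @` line (pt l m (0, u)) l.
  rewrite (_ : pt l m (0, u) = u *: m); last by rewrite /pt scale0r add0r.
  apply: eq_imagel => y yl; apply: esym; apply: (iffRL (fiber1 net _ _)); exists v => //.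
  by case: gE => ->; [left|right].
rewrite line_image; exact: level_curve_essential d0 d'0 G_ct G_surj GP _ _ _ _ pu _ u23.
Qed.
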